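(* Assume the standing hypotheses (H), (L) and (g) below. Let $u\in W^{1,1}(0,T;X)$ and $x_0\in X$ be such that $x_0\in Z(g(0,u(0),u(0)-x_0))$. Then there exists a unique solution $\xi\in\Omega_{x_0}(u)$ of the state-dependent sweeping process with input $u$ and initial condition $x_0$.
   Context: $T>0$. $X$ is a real Hilbert space with inner product $\langle\cdot,\cdot\rangle$ and norm $|x|=\sqrt{\langle x,x\rangle}$; $W$ is a real Banach space with norm $|\cdot|_W$, dual $W'$ (norm $|\cdot|_{W'}$), duality pairing $\langle v,f\rangle_W$; $\mathcal L(X,W)$ is the space of bounded linear operators with operator norm. $G:X\times W\to[0,\infty)$ is locally Lipschitz continuous and $Z(w):=\{x\in X: G(x,w)\le 1\}$; $\partial Z(w)$ is its boundary, $\mathrm{dist}(x,S)=\inf_{s\in S}|x-s|$. Partial gradients: $\nabla_xG(x,w)\in X$ with $\langle\nabla_xG(x,w),y\rangle=\lim_{t\to0}\frac1t(G(x+ty,w)-G(x,w))$ for all $y\in X$; $\nabla_wG(x,w)\in W'$ with $\langle v,\nabla_wG(x,w)\rangle_W=\lim_{t\to0}\frac1t(G(x,w+tv)-G(x,w))$ for all $v\in W$. (H): $\nabla_xG(x,w)$ exists for all $(x,w)$, and there are positive constants $\lambda,c,L$ and functions $\mu_1:W\times[0,\infty)\to[0,\infty)$, $\mu_2:[0,\infty)\to[0,\infty)$ with $\mu_1(w,0)=\mu_2(0)=0$, $\lim_{s\to\infty}\mu_1(w,s)=\lim_{s\to\infty}\mu_2(s)=\infty$ for every $w$, such that for all $x,y,z\in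 X$, $w,w'\in W$: (i) $G(x,w)=1\Rightarrow|\nabla_xG(x,w)|\ge c$; (ii) $|\nabla_xG(x,w)-\nabla_xG(y,w)|\le\mu_1(w,|x-y|)$ if $x,y\in Z(w)$; (iii) $\langle\nabla_xG(x,w)-\nabla_xG(z,w),x-z\rangle\ge-\lambda|x-z|^2$ if $x\in\partial Z(w)$, $z\in Z(w)$; (iv) $|G(x,w)-G(x,w')|\le L|w-w'|_W$; (v) for $\rho>0$, $\mathrm{dist}(x,Z(w))\ge\rho\Rightarrow G(x,w)-1\ge\mu_2(\rho)$. Set $r:=c/\lambda$. (L): $\nabla_xG,\nabla_wG$ exist on all of $X\times W$ and there are positive constants $K_0,K_1,C_0,C_1$ with $|\nabla_xG|\le K_0$, $|\nabla_wG|_{W'}\le K_1$, $|\nabla_xG(x,w)-\nabla_xG(x',w')|\le C_0(|x-x'|+|w-w'|_W)$, $|\nabla_wG(x,w)-\nabla_wG(x',w')|_{W'}\le C_1(|x-x'|+|w-w'|_W)$. (g): $g:[0,T]\times X\times X\to W$ is continuous, its partial derivatives $\partial_tg$, $\partial_ug$, $\partial_\xi g$ exist, and there are $a,b\in L^1(0,T)$ and constants $\gamma,\omega,C_\xi,C_u>0$ such that for all $u,v,\xi,\eta\in X$ and a.e. $t\in(0,T)$: $|\partial_\xi g(t,u,\xi)|_{\mathcal L(X,W)}\le\gamma$, $|\partial_ug(t,u,\xi)|_{\mathcal L(X,W)}\le\omega$, $|\partial_tg(t,u,\xi)|_W\le a(t)$, $|\partial_\xi g(t,u,\xi)-\partial_\xi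 g(t,v,\eta)|_{\mathcal L(X,W)}\le C_\xi(|u-v|+|\xi-\eta|)$, $|\partial_ug(t,u,\xi)-\partial_ug(t,v,\eta)|_{\mathcal L(X,W)}\le C_u(|u-v|+|\xi-\eta|)$, $|\partial_tg(t,u,\xi)-\partial_tg(t,v,\eta)|_W\le b(t)(|u-v|+|\xi-\eta|)$; moreover $\delta:=K_1\gamma/c<1$. State-dependent sweeping process: given $u\in W^{1,1}(0,T;X)$ and $x_0\in X$ with $x_0\in Z(g(0,u(0),u(0)-x_0))$, a function $\xi\in W^{1,1}(0,T;X)$ is a solution with input $u$ and initial condition $x_0$ if, with $x:=u-\xi$: $x(t)\in Z(g(t,u(t),\xi(t)))$ for all $t\in[0,T]$; $\langle x(t)-z,\dot\xi(t)\rangle+\frac{|\dot\xi(t)|}{2r}|x(t)-z|^2\ge0$ for all $z\in Z(g(t,u(t),\xi(t)))$, a.e. $t$; $x(0)=x_0$. For such $u,x_0$: $\Omega_{x_0}(u)$ is the set of $\eta\in W^{1,1}(0,T;X)$ with $\eta(0)=u(0)-x_0$ and $|\dot\eta(t)|\le\frac1{1-\delta}\big((1+\frac{\omega K_1}{c})|\dot u(t)|+\frac{K_1}{c}a(t)\big)$ for a.e. $t\in(0,T)$. *)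

(* Defs.v *)
From HB Require Import structures.
From mathcomp Require Import all_boot all_order all_algebra.
From mathcomp Require Import all_classical all_reals all_analysis.
Set Implicit Arguments. Unset Strict Implicit. Unset Printing Implicit Defensive.
Import Order.TTheory GRing.Theory Num.Theory.
Import numFieldNormedType.Exports.
Local Open Scope classical_set_scope.
Local Open Scope ring_scope.

(* ip is the inner product of the real Hilbert space X, compatible with the
   norm of X (X is a complete normed space, i.e. with ip a Hilbert space). *)
Definition hilbert_inner {R : realType} {X : normedModType R} (ip : X -> X -> R) :=
  [/\ forall x y, ip x y = ip y x,
      forall (a : R) (x y z : X), ip (a *: x + y) z = a * ip x z + ip y z &
      forall x, ip x x = `|x| ^+ 2].

Definition Zset {R : realType} {X W : Type} (G : X -> W -> R) (w : W) : set X :=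
  [set x | G x w <= 1].

Definition bdry {T : topologicalType} (A : set T) : set T :=
  closure A `\` interior A.

(* dist(x,S) = inf_{s in S} |x - s|, extended-real valued (+oo for S empty) *)
Definition edist {R : realType} {X : normedModType R} (x : X) (S : set X) : \bar R :=
  ereal_inf [set (`|x - s|)%:E | s in S].

Definition loc_lipschitz2 {R : realType} {X W : normedModType R} (G : X -> W -> R) :=
  forall (x : X) (w : W), exists2 rho : R, 0 < rho & exists Lc : R,
    forall x1 x2 w1 w2, `|x1 - x| < rho -> `|x2 - x| < rho ->
      `|w1 - w| < rho -> `|w2 - w| < rho ->
      `|G x1 w1 - G x2 w2| <= Lc * (`|x1 - x2| + `|w1 - w2|).

Definition is_grad_x {R : realType} {X W : normedModType R} (ip : X -> X -> R)
  (G : X -> W -> R) (gx : X -> W -> X) :=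
  forall (x : X) (w : W) (y : X),
    (fun t : R => t^-1 * (G (x + t *: y) w - G x w)) @ 0^' --> ip (gx x w) y.

Definition is_grad_w {R : realType} {X W : normedModType R}
  (G : X -> W -> R) (gw : X -> W -> W -> R) :=
  forall (x : X) (w : W),
    [/\ forall (a : R) (v1 v2 : W), gw x w (a *: v1 + v2) = a * gw x w v1 + gw x w v2,
        (exists M : R, forall v, `|gw x w v| <= M * `|v|) &
        forall v : W, (fun t : R => t^-1 * (G x (w + t *: v) - G x w)) @ 0^' --> gw x w v].

Definition hypH {R : realType} {X W : normedModType R} (ip : X -> X -> R)
  (G : X -> W -> R) (gx : X -> W -> X) (lam c L : R)
  (mu1 : W -> R -> R) (mu2 : R -> R) :=
  [/\ is_grad_x ip G gx, [/\ 0 < lam, 0 < c & 0 < L],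
      [/\ forall w s, 0 <= s -> 0 <= mu1 w s,
          forall s, 0 <= s -> 0 <= mu2 s,
          (forall w, mu1 w 0 = 0) /\ mu2 0 = 0,
          forall w, mu1 w s @[s --> +oo] --> +oo &
          mu2 s @[s --> +oo] --> +oo] &
      [/\ (* (i) *) forall x w, G x w = 1 -> c <= `|gx x w|,
          (* (ii) *) forall x y w, Zset G w x -> Zset G w y ->
             `|gx x w - gx y w| <= mu1 w `|x - y|,
          (* (iii) *) forall x z w, bdry (Zset G w) x -> Zset G w z ->
             - lam * `|x - z| ^+ 2 <= ip (gx x w - gx z w) (x - z),
          (* (iv) *) forall x w w', `|G x w - G x w'| <= L * `|w - w'| &
          (* (v) *) forall x w (rho : R), 0 < rho -> (rho%:E <= edist x (Zset G w))%E ->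
             mu2 rho <= G x w - 1]].

(* Hypothesis (L); operator norms in W' are unfolded *)
Definition hypL {R : realType} {X W : normedModType R}
  (G : X -> W -> R) (gx : X -> W -> X) (gw : X -> W -> W -> R) (K0 K1 C0 C1 : R) :=
  [/\ is_grad_w G gw, 0 < K0, 0 < K1, 0 < C0 & 0 < C1] /\
  [/\ forall x w, `|gx x w| <= K0,
      forall x w v, `|gw x w v| <= K1 * `|v|,
      forall x w x' w', `|gx x w - gx x' w'| <= C0 * (`|x - x'| + `|w - w'|) &
      forall x w x' w' v, `|gw x w v - gw x' w' v| <= C1 * (`|x - x'| + `|w - w'|) * `|v|].

Definition L1 {R : realType} (T : R) (a : R -> R) :=
  (@lebesgue_measure R).-integrable `[0, T]%classic (EFin \o a).

(* Hypothesis (g); partial derivatives in u and xi are Frechet derivatives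
   ('d), the one in t is the derivative 'D_1; operator norms in L(X,W)
   are unfolded. *)
Definition hypg {R : realType} {X W : normedModType R} (T : R)
  (g : R -> X -> X -> W) (a b : R -> R) (gam om Cxi Cu : R) :=
  [/\ {within `[0, T]%classic `*` setT `*` setT, continuous (fun p : R * X * X => g p.1.1 p.1.2 p.2)},
      forall t u xi, `[0, T]%classic t ->
        differentiable (g t u) xi /\ differentiable (fun u' => g t u' xi) u,
      forall t u xi, `]0, T[%classic t -> derivable (fun s => g s u xi) t 1,
      [/\ L1 T a, L1 T b & [/\ 0 < gam, 0 < om, 0 < Cxi & 0 < Cu]] &
      {ae @lebesgue_measure R, forall t, `]0, T[%classic t -> forall u v xi eta : X,
        [/\ [/\ forall h, `|'d (g t u) xi h| <= gam * `|h|,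
                forall h, `|'d (fun u' => g t u' xi) u h| <= om * `|h| &
                `|'D_1 (fun s => g s u xi) t| <= a t],
            forall h, `|'d (g t u) xi h - 'd (g t v) eta h|
                        <= Cxi * (`|u - v| + `|xi - eta|) * `|h|,
            forall h, `|'d (fun u' => g t u' xi) u h - 'd (fun u' => g t u' eta) v h|
                        <= Cu * (`|u - v| + `|xi - eta|) * `|h| &
            `|'D_1 (fun s => g s u xi) t - 'D_1 (fun s => g s v eta) t|
              <= b t * (`|u - v| + `|xi - eta|)]}].

Definition abs_cont {R : realType} {X : normedModType R} (T : R) (f : R -> X) :=
  forall e : R, 0 < e -> exists2 d : R, 0 < d &
    forall (n : nat) (a b : nat -> R),
      (forall i, (i < n)%N -> 0 <= a i /\ a i <= b i /\ b i <= T) ->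
      (forall i j, (i < j < n)%N -> b i <= a j) ->
      \sum_(i < n) (b i - a i) < d ->
      \sum_(i < n) `|f (b i) - f (a i)| < e.

(* W^{1,1}(0,T;X) for X a Hilbert space: absolutely continuous on [0,T]
   (hence a.e. differentiable with integrable derivative); the derivative
   is written 'D_1 f t. *)
Definition W11 {R : realType} {X : normedModType R} (T : R) (f : R -> X) :=
  abs_cont T f /\ {ae @lebesgue_measure R, forall t, `]0, T[%classic t -> derivable f t 1}.

(* xi is a solution of the state-dependent sweeping process with input u and
   initial condition x0, with r = c/lambda *)
Definition is_solution {R : realType} {X W : normedModType R} (ip : X -> X -> R)
  (G : X -> W -> R) (g : R -> X -> X -> W) (T r : R) (u : R -> X) (x0 : X)
  (xi : R -> X) :=
  [/\ W11 T xi,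
      forall t, `[0, T]%classic t -> Zset G (g t (u t) (xi t)) (u t - xi t),
      {ae @lebesgue_measure R, forall t, `]0, T[%classic t ->
         forall z, Zset G (g t (u t) (xi t)) z ->
           0 <= ip (u t - xi t - z) ('D_1 xi t)
                + `|'D_1 xi t| / (2 * r) * `|u t - xi t - z| ^+ 2} &
      u 0 - xi 0 = x0].

Definition Omega {R : realType} {X : normedModType R} (T : R) (u : R -> X) (x0 : X)
  (K1 c om delta : R) (a : R -> R) (eta : R -> X) :=
  [/\ W11 T eta, eta 0 = u 0 - x0 &
      {ae @lebesgue_measure R, forall t, `]0, T[%classic t ->
         `|'D_1 eta t| <= (1 - delta)^-1 * ((1 + om * K1 / c) * `|'D_1 u t| + K1 / c * a t)}].

(* Main.v *)
Require Import Defs.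
From HB Require Import structures.
From mathcomp Require Import all_boot all_order all_algebra.
From mathcomp Require Import all_classical all_reals all_analysis.
From mathcomp Require Import measurable_realfun ring lra.
Set Implicit Arguments. Unset Strict Implicit. Unset Printing Implicit Defensive.
Import Order.TTheory GRing.Theory Num.Theory.
Import numFieldNormedType.Exports.
Local Open Scope classical_set_scope.
Local Open Scope ring_scope.

(* Hypothesis (iii) makes each sublevel set of [G] prox-regular with radius
   [c / lam]: an exterior ball of radius [rho < c / lam] touching the set at a
   boundary point can always be enlarged, for otherwise a second, almost touching
   point would share its center, which contradicts hypomonotonicity. Hence the
   variational inequality says that the velocity of [xi] is zero while the level
   [G (u - xi) (g t u xi)] is below 1, and a nonnegative multiple of the gradient
   of [G] while it equals 1.

   Let [x1] and [x2] be two such trajectories, possibly with gradient directions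
   known up to [eps], and let [gamma] be the difference of their levels. An
   active level is at its maximum, so its derivative vanishes; combined with the
   chain rule this gives almost everywhere, for some integrable [phi],
   [(1 - delta) c |x1' - x2'| + |gamma|' <= C phi (|x1 - x2| + eps)].
   Gronwall's lemma yields uniqueness, and integrating the inequality once more
   bounds the variation of [x1 - x2] by the increments of
   [C eps (primitive phi) - |gamma|].

   Approximate solutions are obtained on short intervals by moving along one
   fixed gradient direction, by the least amount that keeps the level below 1.
   By the comparison they form a Cauchy sequence, and the variation estimate with
   Fatou's lemma shows that at almost every time their velocities converge, along
   a subsequence, to that of the limit. This replaces the Radon-Nikodym property
   of Hilbert spaces. *)

(* [lmod] proves identities in a module by reflecting both sides to formal
   linear combinations of atoms and comparing the coefficients with [ring]. *)
Section lmod_reflection.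
Variables (K : comPzRingType) (V : lmodType K).

Inductive lexpr :=
  | LVar of nat | LZero | LAdd of lexpr & lexpr | LOpp of lexpr | LScale of K & lexpr.

Fixpoint leval (env : seq V) (e : lexpr) : V :=
  match e with
  | LVar n => nth 0 env n
  | LZero => 0
  | LAdd a b => leval env a + leval env b
  | LOpp a => - leval env a
  | LScale k a => k *: leval env a
  end.

Fixpoint lcoef (e : lexpr) (i : nat) : K :=
  match e with
  | LVar n => if eqn i n then 1 else 0
  | LZero => 0
  | LAdd a b => lcoef a i + lcoef b i
  | LOpp a => - lcoef a i
  | LScale k a => k * lcoef a i
  end.

Lemma levalE env e : leval env e = \sum_(i < size env) lcoef e i *: nth 0 env i.
Proof.
elim: e => [n||a IHa b IHb|a IHa|k a IHa] /=; rewrite ?IHa ?IHb.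
- have [ns|ns] := ltnP n (size env); last first.
    rewrite nth_default // big1 // => i _.
    have -> : eqn i n = false by apply/negbTE/eqP => E; move: (ltn_ord i); rewrite E ltnNge ns.
    by rewrite scale0r.
  rewrite (bigD1 (Ordinal ns)) //= eqnE eqxx scale1r big1 ?addr0 // => i Hi.
  have -> : (i == n :> nat) = false by apply/negbTE; move: Hi; rewrite -val_eqE.
  by rewrite scale0r.
- by rewrite big1 // => i _; rewrite scale0r.
- by rewrite -big_split; apply: eq_bigr => i _; rewrite scalerDl.
- by rewrite -sumrN; apply: eq_bigr => i _; rewrite scaleNr.
- by rewrite scaler_sumr; apply: eq_bigr => i _; rewrite scalerA.
Qed.

Fixpoint same_coefs (n : nat) (a b : lexpr) : Prop :=
  if n is n'.+1 then lcoef a n' = lcoef b n' /\ same_coefs n' a b else True.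

Lemma same_coefsP n a b : same_coefs n a b -> forall i, (i < n)%N -> lcoef a i = lcoef b i.
Proof.
elim: n => [//|n IH] /= [Hn /IH Hs] i; rewrite ltnS leq_eqVlt => /orP[/eqP->//|]; exact: Hs.
Qed.

Lemma leval_same env a b : same_coefs (size env) a b -> leval env a = leval env b.
Proof.
by move=> same_ab; rewrite !levalE; apply: eq_bigr => i _; rewrite (same_coefsP same_ab).
Qed.

End lmod_reflection.

Ltac lmod_add t l :=
  lazymatch l with
  | context [cons t _] => l
  | _ => constr:(cons t l)
  end.
Ltac lmod_atoms t l :=
  lazymatch t with
  | @Algebra.add _ ?a ?b => let l' := lmod_atoms a l in lmod_atoms b l'
  | @Algebra.opp _ ?a => lmod_atoms a l
  | @GRing.scale _ _ _ ?a => lmod_atoms a l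
  | @Algebra.zero _ => l
  | _ => lmod_add t l
  end.
Ltac lmod_index t l :=
  lazymatch l with
  | cons t _ => constr:(O)
  | cons _ ?l' => let n := lmod_index t l' in constr:(S n)
  end.
Ltac lmod_quote K t l :=
  lazymatch t with
  | @Algebra.add _ ?a ?b =>
      let a' := lmod_quote K a l in let b' := lmod_quote K b l in constr:(@LAdd K a' b')
  | @Algebra.opp _ ?a => let a' := lmod_quote K a l in constr:(@LOpp K a')
  | @GRing.scale _ _ ?k ?a => let a' := lmod_quote K a l in constr:(@LScale K k a')
  | @Algebra.zero _ => constr:(@LZero K)
  | _ => let n := lmod_index t l in constr:(@LVar K n)
  end.
Ltac lmod_over K V :=
  lazymatch goal with
  | |- ?a = ?b =>
    let l := lmod_atoms a (@nil (GRing.Lmodule.sort V)) in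
    let l := lmod_atoms b l in
    let a' := lmod_quote K a l in let b' := lmod_quote K b l in
    change (@leval K V l a' = @leval K V l b');
    apply: leval_same; cbn [same_coefs size lcoef eqn]; repeat split; try ring; try (field; lra)
  end.
Ltac lmod :=
  lazymatch goal with
  | |- @eq (@NormedModule.sort (reals_Real__to__Num_NumDomain ?R) ?V) _ _ =>
     lmod_over (R : comPzRingType) (V : lmodType R)
  | R : realType |- @eq ?T _ _ => lmod_over (R : comPzRingType) (T : lmodType R)
  end.

(** * Derivatives of functions of a real variable *)

Section derivative_estimates.
Context {R : realType}.
Implicit Types (V W : normedModType R) (s t e : R).

Lemma is_derive1P V (f : R -> V) t d : is_derive t 1 f d <->
  forall e, 0 < e -> \forall s \near t, `|f s - f t - (s - t) *: d| <= e * `|s - t|.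
Proof.
pose q h : V := h^-1 *: ((f \o shift t) (h *: 1) - f t).
have qE h : h != 0 -> `|d - q h| = `|h|^-1 * `|f (h + t) - f t - h *: d|.
  move=> h0; rewrite /q /= [h *: 1]mulr1 -normfV -normrZ (scalerBr _ _ (h *: d)) scalerA mulVf //.
  by rewrite scale1r distrC.
transitivity (q @ 0^' --> d).
  split=> [[df <-] //|qd]; apply: DeriveDef; first exact: cvgP qd.
  exact: cvg_lim qd.
split=> [/cvgrPdist_le qd e /qd|fd].
  rewrite near_withinE => /nbhs_ballP[r /= r0 qe]; apply/nbhs_ballP; exists r => // s.
  have [->|st] := eqVneq s t; first by rewrite !subrr scale0r subr0 !normr0 mulr0.
  have st0 : s - t != 0 by rewrite subr_eq0.
  rewrite /ball /= => ts; have := qe (s - t); rewrite /ball /= sub0r opprB => /(_ ts st0).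
  by rewrite qE // subrK ler_pdivrMl ?normr_gt0 // mulrC.
apply/cvgrPdist_le => e /fd /nbhs_ballP[r /= r0 fe].
rewrite near_withinE; apply/nbhs_ballP; exists r => // h.
rewrite /ball /= sub0r normrN => hr h0; rewrite qE // ler_pdivrMl ?normr_gt0 // mulrC.
by have := fe (h + t); rewrite /ball /= distrC addrK; apply.
Qed.

Lemma is_derive1_lipschitz V (f : R -> V) t d : is_derive t 1 f d ->
  \forall s \near t, `|f s - f t| <= (`|d| + 1) * `|s - t|.
Proof.
move=> /is_derive1P /(_ 1 ltr01); apply: filterS => s fs.
rewrite -[f s - f t](subrK ((s - t) *: d)) addrC (le_trans (ler_normD _ _)) //.
by rewrite normrZ mulrDl [`|d| * _]mulrC lerD2l.
Qed.

Lemma is_derive1_norm_le V W (f : R -> V) (g : R -> W) t d l :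
  is_derive t 1 f d -> is_derive t 1 g l ->
  (\forall s \near t^'+, `|f s - f t| <= `|g s - g t|) -> `|d| <= `|l|.
Proof.
move=> /is_derive1P fd /is_derive1P gl fg; apply/ler_addgt0Pr => e e0.
have e2 : 0 < e / 2 by rewrite divr_gt0.
near (t^'+) => s.
have st : 0 < s - t by rewrite subr_gt0; near: s; exact: nbhs_right_gt.
have fgs : `|f s - f t| <= `|g s - g t| by near: s.
have fs : `|f s - f t - (s - t) *: d| <= e / 2 * `|s - t|.
  by near: s; exact: cvg_within (fd _ e2).
have gs : `|g s - g t - (s - t) *: l| <= e / 2 * `|s - t|.
  by near: s; exact: cvg_within (gl _ e2).
rewrite (gtr0_norm st) in fs gs; rewrite -(ler_pM2l st) -{1}(gtr0_norm st) -normrZ.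
have -> : (s - t) *: d = (f s - f t) - (f s - f t - (s - t) *: d) by lmod.
have gE : g s - g t = (g s - g t - (s - t) *: l) + (s - t) *: l by lmod.
have := ler_normD (g s - g t - (s - t) *: l) ((s - t) *: l).
rewrite -gE normrZ (gtr0_norm st) => gsl.
by rewrite (le_trans (ler_normB _ _)) // mulrDr; lra.
Unshelve. all: by end_near.
Qed.

Lemma is_derive1_ge0 (f : R -> R) t d : is_derive t 1 f d ->
  (\forall s \near t^'+, f t <= f s) -> 0 <= d.
Proof.
move=> /is_derive1P fd ft; rewrite -oppr_le0; apply/ler_addgt0Pr => e e0; rewrite add0r.
near (t^'+) => s.
have st : 0 < s - t by rewrite subr_gt0; near: s; exact: nbhs_right_gt.
have fts : f t <= f s by near: s.
have : `|f s - f t - (s - t) *: d| <= e * `|s - t| by near: s; exact: cvg_within (fd _ e0).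
rewrite (gtr0_norm st) ler_norml /GRing.scale /= => /andP[_ fs].
by rewrite -(ler_pM2l st); lra.
Unshelve. all: by end_near.
Qed.

Lemma is_derive1_min (f : R -> R) t d : is_derive t 1 f d ->
  (\forall s \near t, f t <= f s) -> d = 0.
Proof.
move=> fd ft; apply/eqP; rewrite eq_le (is_derive1_ge0 fd) ?andbT; last exact: cvg_within ft.
apply/ler_addgt0Pr => e e0; rewrite add0r; move/is_derive1P : fd => fd.
near (t^'-) => s.
have st : 0 < t - s by rewrite subr_gt0; near: s; exact: nbhs_left_lt.
have fts : f t <= f s by near: s; exact: cvg_within ft.
have : `|f s - f t - (s - t) *: d| <= e * `|s - t| by near: s; exact: cvg_within (fd _ e0).
rewrite distrC [`|s - t|]distrC (gtr0_norm st) ler_norml /GRing.scale /= => /andP[fs _].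
by rewrite -(ler_pM2l st); lra.
Unshelve. all: by end_near.
Qed.

Lemma is_derive1_unique V (f : R -> V) t d d' :
  is_derive t 1 f d -> is_derive t 1 f d' -> d = d'.
Proof. by move=> [_ <-] [_ <-]. Qed.

Lemma is_derive1_continuous V (f : R -> V) t d : is_derive t 1 f d -> {for t, continuous f}.
Proof. by move=> [/derivable1_diffP/differentiable_continuous]. Qed.

Lemma is_derive1Zl V (f : R -> R) (v : V) t d : is_derive t 1 f d ->
  is_derive t 1 (fun s => f s *: v) (d *: v).
Proof.
move=> /is_derive1P fd; apply/is_derive1P => e e0.
have v1 : 0 < `|v| + 1 by rewrite ltr_wpDl.
have : 0 < e / (`|v| + 1) by rewrite divr_gt0.
move=> /fd; apply: filterS => s fs.
have -> : f s *: v - f t *: v - (s - t) *: (d *: v) = (f s - f t - (s - t) *: d) *: v.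
  by rewrite scalerA -!scalerBl.
rewrite normrZ (le_trans (ler_wpM2r (normr_ge0 v) fs)) // mulrAC ler_wpM2r //.
by rewrite mulrAC ler_pdivrMr // ler_wpM2l ?ltW // ltrDl.
Qed.

End derivative_estimates.

(** * Inner products and rays *)

Section hilbert.
Variables (R : realType) (X : normedModType R) (ip : X -> X -> R).
Hypothesis hX : hilbert_inner ip.
Implicit Types (x y z p d : X) (a c e k eps : R).

Lemma ipC x y : ip x y = ip y x. Proof. by case: hX. Qed.
Lemma ipxx x : ip x x = `|x| ^+ 2. Proof. by case: hX. Qed.
Lemma ipDl x y z : ip (x + y) z = ip x z + ip y z.
Proof. by case: hX => _ /(_ 1 x y z); rewrite scale1r mul1r. Qed.
Lemma ip0l z : ip 0 z = 0.
Proof. by apply: (addrI (ip 0 z)); rewrite -ipDl !addr0. Qed.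
Lemma ipZl k x z : ip (k *: x) z = k * ip x z.
Proof. by case: hX => _ /(_ k x 0 z); rewrite addr0 ip0l addr0. Qed.
Lemma ipNl x z : ip (- x) z = - ip x z.
Proof. by rewrite -scaleN1r ipZl mulN1r. Qed.
Lemma ipBl x y z : ip (x - y) z = ip x z - ip y z.
Proof. by rewrite ipDl ipNl. Qed.
Lemma ipDr x y z : ip z (x + y) = ip z x + ip z y.
Proof. by rewrite !(ipC z) ipDl. Qed.
Lemma ip0r z : ip z 0 = 0.
Proof. by rewrite ipC ip0l. Qed.
Lemma ipZr k x z : ip z (k *: x) = k * ip z x.
Proof. by rewrite !(ipC z) ipZl. Qed.
Lemma ipNr x z : ip z (- x) = - ip z x.
Proof. by rewrite !(ipC z) ipNl. Qed.
Lemma ipBr x y z : ip z (x - y) = ip z x - ip z y.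
Proof. by rewrite !(ipC z) ipBl. Qed.
Definition ipE := (ipDl, ipDr, ipBl, ipBr, ipNl, ipNr, ipZl, ipZr, ip0l, ip0r).

Lemma normD_sqr x y : `|x + y| ^+ 2 = `|x| ^+ 2 + 2 * ip x y + `|y| ^+ 2.
Proof. by rewrite -!ipxx !ipE (ipC y x); ring. Qed.

Lemma normB_sqr x y : `|x - y| ^+ 2 = `|x| ^+ 2 - 2 * ip x y + `|y| ^+ 2.
Proof. by rewrite -!ipxx !ipE (ipC y x); ring. Qed.

Lemma cauchy_schwarz x y : `|ip x y| <= `|x| * `|y|.
Proof.
have [->|y0] := eqVneq y 0; first by rewrite ip0r !normr0 mulr0.
have ny : 0 < `|y| by rewrite normr_gt0.
have y2 : 0 < `|y| ^+ 2 by rewrite exprn_gt0.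
rewrite -(@ler_pXn2r _ 2) // ?nnegrE ?mulr_ge0 // real_normK ?num_real // exprMn.
have := sqr_ge0 `|x - (ip x y / `|y| ^+ 2) *: y|.
rewrite normB_sqr ipZr normrZ exprMn real_normK ?num_real //.
rewrite -(pmulr_rge0 _ y2).
rewrite (_ : _ * _ = `|x| ^+ 2 * `|y| ^+ 2 - ip x y ^+ 2) ?subr_ge0 //.
by field; exact: lt0r_neq0.
Qed.

Lemma ip_le x y : ip x y <= `|x| * `|y|.
Proof. exact: le_trans (ler_norm _) (cauchy_schwarz _ _). Qed.

Lemma ip_geN x y : - (`|x| * `|y|) <= ip x y.
Proof. by rewrite lerNl -ipNl -(normrN x) ip_le. Qed.

Lemma ray_closed p d : p != 0 ->
  (forall e, 0 < e -> exists2 a, 0 <= a & `|d - a *: p| <= e) ->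
  exists2 a, 0 <= a & d = a *: p.
Proof.
move=> p0 dp; have np : 0 < `|p| by rewrite normr_gt0.
have np2 : `|p| ^+ 2 != 0 by rewrite expf_neq0 ?normr_eq0.
exists (ip d p / `|p| ^+ 2).
  rewrite divr_ge0 ?sqr_ge0 // -oppr_le0; apply/ler_addgt0Pr => e e0; rewrite add0r.
  have [|a a0 dae] := dp (e / `|p|); first exact: divr_gt0.
  rewrite (_ : d = (d - a *: p) + a *: p); last by lmod.
  rewrite ipDl ipZl ipxx; have := ip_geN (d - a *: p) p.
  have : `|d - a *: p| * `|p| <= e by rewrite -ler_pdivlMr.
  have : 0 <= a * `|p| ^+ 2 by rewrite mulr_ge0 ?sqr_ge0.
  lra.
set k := _ / _; apply/eqP; rewrite -subr_eq0 -normr_le0; apply/ler_addgt0Pr => e e0.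
rewrite add0r; have [a a0] := dp e e0; apply: le_trans.
rewrite -(@ler_pXn2r _ 2) ?nnegrE //.
rewrite (_ : d - a *: p = (d - k *: p) + (k - a) *: p); last by lmod.
rewrite (normD_sqr (d - k *: p)) ipZr ipBl ipZl ipxx [k * _]mulfVK // subrr !mulr0 addr0.
by rewrite lerDl sqr_ge0.
Qed.

Lemma halfspace_normal p d : p != 0 -> (forall v, 0 < ip p v -> 0 <= ip v d) ->
  exists2 a, 0 <= a & d = a *: p.
Proof.
move=> p0 pd; have np2 : 0 < `|p| ^+ 2 by rewrite exprn_gt0 ?normr_gt0.
have ipd : 0 <= ip p d by apply: pd; rewrite ipxx.
exists (ip p d / `|p| ^+ 2); first by rewrite divr_ge0 ?(ltW np2).
set k := _ / _; set w := d - k *: p.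
have pw : ip p w = 0 by rewrite ipBr ipZr ipxx mulfVK ?gt_eqF // subrr.
have wd : ip w d = `|w| ^+ 2.
  have dE : d = w + k *: p by rewrite /w; lmod.
  by rewrite [in LHS]dE ipDr ipZr ipxx (ipC w p) pw mulr0 addr0.
apply/eqP; rewrite -subr_eq0 -/w -normr_eq0 -sqrf_eq0 eq_le sqr_ge0 andbT.
apply/ler_addgt0Pr => e e0; rewrite add0r.
have e1 : 0 < e / (ip p d + 1) by rewrite divr_gt0 // ltr_wpDl.
have := pd (e / (ip p d + 1) *: p - w).
rewrite ipBr ipZr ipxx pw subr0 mulr_gt0 // ipBl ipZl wd subr_ge0 => /(_ isT) /le_trans; apply.
by rewrite mulrAC ler_pdivrMr ?ltr_wpDl // ler_pM2l // lerDl.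
Qed.

(* The condition on [p] keeps the coefficient [a] under control: [a <= |d| / c]. *)
Definition near_ray c eps p : set X :=
  [set d | exists a q, [/\ 0 <= a, `|q - p| <= eps, a * c <= a * `|q| & d = a *: q]].

Lemma near_ray0 c eps p : 0 <= eps -> near_ray c eps p 0.
Proof. by move=> eps0; exists 0, p; rewrite subrr normr0 !mul0r scale0r. Qed.

Lemma near_ray_ip_ge c eps p d : near_ray c eps p d -> c * `|d| <= ip p d + eps * `|d|.
Proof.
move=> [a [q [a0 qp ca ->]]]; rewrite normrZ ger0_norm // ipZr.
have -> : p = q - (q - p) by lmod.
have qq : a * (c * `|q|) <= a * `|q| ^+ 2.
  by rewrite expr2 mulrA (mulrA a) ler_wpM2r.
have qpq : a * ip (q - p) q <= a * (eps * `|q|).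
  by rewrite ler_wpM2l // (le_trans (ip_le _ _)) // ler_wpM2r.
by rewrite ipBl ipxx; lra.
Qed.

Lemma near_ray_dist c eps1 eps2 p1 p2 d1 d2 k : 0 < c -> c <= `|p1| ->
  near_ray c eps1 p1 d1 -> near_ray c eps2 p2 d2 -> `|d1| <= k -> `|d2| <= k ->
  c * `|d1 - d2| <= `|ip p1 d1 - ip p2 d2| + k * (3 * `|p1 - p2| + 2 * (eps1 + eps2)).
Proof.
move=> c0 cp1 [a1 [q1 [a10 q1p ca1 E1]]] [a2 [q2 [a20 q2p ca2 E2]]] d1k d2k.
have ack a q d : 0 <= a -> a * c <= a * `|q| -> d = a *: q -> `|d| <= k -> c * a <= k.
  by move=> a0 ca ->; rewrite normrZ ger0_norm // [c * a]mulrC; exact: le_trans.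
pose r := a1 *: (q1 - p1) - a2 *: (q2 - p1).
have dE : d1 - d2 = (a1 - a2) *: p1 + r by rewrite E1 E2 /r; lmod.
have rk : c * `|r| <= k * (`|p1 - p2| + (eps1 + eps2)).
  have k1 : c * a1 * `|q1 - p1| <= k * eps1.
    by rewrite ler_pM // ?mulr_ge0 ?(ltW c0) //; exact: (ack _ q1 d1).
  have k2 : c * a2 * `|q2 - p1| <= k * (eps2 + `|p1 - p2|).
    rewrite ler_pM // ?mulr_ge0 ?(ltW c0) //; first exact: (ack _ q2 d2).
    have -> : q2 - p1 = (q2 - p2) - (p1 - p2) by lmod.
    by rewrite (le_trans (ler_normB _ _)) // lerD2r.
  have : c * `|r| <= c * (a1 * `|q1 - p1| + a2 * `|q2 - p1|).
    by rewrite ler_pM2l // (le_trans (ler_normB _ _)) // !normrZ !ger0_norm.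
  lra.
have along : c * `|d1 - d2| <= `|ip p1 (d1 - d2)| + 2 * (c * `|r|).
  have : `|p1| * `|d1 - d2| <= `|p1| * (`|a1 - a2| * `|p1| + `|r|).
    by rewrite ler_wpM2l // {1}dE -normrZ; exact: ler_normD.
  have : `|a1 - a2| * `|p1| ^+ 2 <= `|ip p1 (d1 - d2)| + `|p1| * `|r|.
    have -> : `|a1 - a2| * `|p1| ^+ 2 = `|ip p1 (d1 - d2) - ip p1 r|.
      rewrite dE ipDr ipZr ipxx addrK normrM; congr (_ * _).
      by rewrite ger0_norm // sqr_ge0.
    by rewrite (le_trans (ler_normB _ _)) // lerD2l cauchy_schwarz.
  have [small|/ltW large] := leP `|d1 - d2| (2 * `|r|).
    have : c * `|d1 - d2| <= c * (2 * `|r|) by rewrite ler_pM2l.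
    have := normr_ge0 (ip p1 (d1 - d2)); lra.
  have : c * (`|d1 - d2| - 2 * `|r|) <= `|p1| * (`|d1 - d2| - 2 * `|r|).
    by rewrite ler_wpM2r ?subr_ge0.
  rewrite expr2; lra.
have : `|ip p1 (d1 - d2)| <= `|ip p1 d1 - ip p2 d2| + `|p1 - p2| * k.
  have -> : ip p1 (d1 - d2) = (ip p1 d1 - ip p2 d2) - ip (p1 - p2) d2.
    by rewrite ipBr ipBl; ring.
  rewrite (le_trans (ler_normB _ _)) // lerD2l (le_trans (cauchy_schwarz _ _)) //.
  by rewrite ler_wpM2l.
lra.
Qed.

Lemma near_ray_closed c p d : 0 < c -> p != 0 ->
  (forall e, 0 < e -> exists p' d' eps,
     [/\ eps <= e, `|p' - p| <= e, `|d' - d| <= e & near_ray c eps p' d']) ->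
  exists2 a, 0 <= a & d = a *: p.
Proof.
move=> c0 p0 lim; apply: ray_closed => // e e0.
pose K := 1 + 2 * (`|d| + 1) / c.
have K0 : 0 < K by rewrite ltr_wpDr // divr_ge0 ?mulr_ge0 ?addr_ge0 // ltW.
pose e1 := Num.min 1 (e / K).
have e10 : 0 < e1 by rewrite lt_min ltr01 divr_gt0.
have e11 : e1 <= 1 by rewrite ge_min lexx.
have e1K : e1 * K <= e by rewrite -ler_pdivlMr // ge_min lexx orbT.
have [p' [d' [eps [eps_e p'p d'd [a [q [a0 qp' ca E]]]]]]] := lim e1 e10.
have ac : a <= (`|d| + 1) / c.
  rewrite ler_pdivlMr // (le_trans ca) //.
  have -> : a * `|q| = `|d'| by rewrite E normrZ ger0_norm.
  have := ler_normD (d' - d) d; rewrite subrK; lra.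
have aq : a * `|q - p| <= (`|d| + 1) / c * (2 * e1).
  apply: ler_pM => //; have -> : q - p = (q - p') + (p' - p) by lmod.
  by rewrite (le_trans (ler_normD _ _)) //; lra.
exists a => //; have -> : d - a *: p = a *: (q - p) - (d' - d) by rewrite E; lmod.
rewrite (le_trans (ler_normB _ _)) // normrZ ger0_norm // (le_trans _ e1K) // /K.
lra.
Qed.

End hilbert.

Definition straddle {R : realType} (a b t : R) : set_system (R * R) :=
  within [set p | [/\ a <= p.1, p.1 <= t, t <= p.2 & p.2 <= b]] (nbhs (t, t)).

Section straddle.
Context {R : realType}.
Implicit Types (V : normedModType R) (a b s t e K : R).

Global Instance straddle_filter a b t : Filter (straddle a b t).
Proof. exact: within_filter. Qed.

Lemma straddleP a b t :
  \forall p \near straddle a b t, [/\ a <= p.1, p.1 <= t, t <= p.2 & p.2 <= b].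
Proof. exact: withinT. Qed.

Lemma near_straddle a b t (A : set R) : nbhs t A ->
  \forall p \near straddle a b t, A p.1 /\ A p.2.
Proof. by move=> tA; apply: cvg_within; exists (A, A). Qed.

Lemma near_straddle_itv a b t (A : set R) : nbhs t A ->
  \forall p \near straddle a b t, `[p.1, p.2]%classic `<=` A.
Proof.
move=> /nbhs_ballP[r /= r0 tA]; have := near_straddle a b (nbhsx_ballx t _ r0).
move: (straddleP a b t); apply: filterS2 => -[x y] [/= _ xt ty _] [tx yt] z.
rewrite /= in_itv /= => /andP[xz zy]; apply: tA.
move: tx yt; rewrite /ball /= !ltr_distl => /andP[? ?] /andP[? ?].
by apply/andP; split; lra.
Qed.

Lemma is_derive1_straddle V (f : R -> V) a b t d e : is_derive t 1 f d -> 0 < e ->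
  \forall p \near straddle a b t, `|f p.2 - f p.1 - (p.2 - p.1) *: d| <= e * (p.2 - p.1).
Proof.
move=> /is_derive1P fd /fd /(near_straddle a b); move: (straddleP a b t).
apply: filterS2 => -[x y] [/= _ xt ty _] [fx fy].
have -> : f y - f x - (y - x) *: d
    = (f y - f t - (y - t) *: d) - (f x - f t - (x - t) *: d) by lmod.
rewrite (le_trans (ler_normB _ _)) //.
move: fx fy; rewrite distrC (ger0_norm (_ : 0 <= y - t)) ?subr_ge0 //.
by rewrite [`|x - t|]distrC (ger0_norm (_ : 0 <= t - x)) ?subr_ge0 //; lra.
Qed.

Lemma is_derive1_straddle_norm V (f : R -> V) a b t d e : is_derive t 1 f d -> 0 < e ->
  \forall p \near straddle a b t, `|f p.2 - f p.1| <= (`|d| + e) * (p.2 - p.1).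
Proof.
move=> fd e0; have := is_derive1_straddle a b fd e0.
move: (straddleP a b t); apply: filterS2 => -[x y] [/= _ xt ty _] fxy.
rewrite -[f y - f x](subrK ((y - x) *: d)) (le_trans (ler_normD _ _)) //.
by rewrite normrZ (ger0_norm (_ : 0 <= y - x)) ?subr_ge0 ?(le_trans xt) //; lra.
Qed.

Lemma locally_nonincreasing a b (F : R -> R) : a <= b ->
  (forall t, a <= t <= b -> \forall p \near straddle a b t, F p.2 <= F p.1) -> F b <= F a.
Proof.
move=> ab locF; pose S := [set s | a <= s <= b /\ F s <= F a].
have Sa : S a by split => //; rewrite lexx.
have supS : has_sup S by split; [exists a | exists b => s [/andP[_ ->]]].
have le_sup s : S s -> s <= sup S by move=> Ss; apply: ub_le_sup => //; case: supS.
have a_sup : a <= sup S by exact: le_sup.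
have sup_b : sup S <= b by apply: ge_sup; [exists a | move=> s [/andP[_ ->]]].
have := locF (sup S); rewrite a_sup sup_b => /(_ isT).
rewrite /straddle near_withinE => /nbhs_ballP[r /= r0 Fr].
have [s [/andP[as_ sb] Fsa] rs] := sup_adherent r0 supS.
have s_sup : s <= sup S by apply: le_sup; split => //; rewrite as_ sb.
have reach y : sup S <= y -> y <= b -> y < sup S + r -> S y.
  move=> sy yb yr; split; first by rewrite yb (le_trans a_sup).
  apply: le_trans Fsa; apply: (Fr (s, y)) => //.
  by split; rewrite /ball /= ltr_distl; apply/andP; split; lra.
have [bs|sb'] := leP b (sup S).
  by have [|//] := reach b sup_b (lexx b); lra.
have /le_sup : S (Num.min b (sup S + r / 2)).
  by apply: reach; rewrite ?le_min ?ge_min ?gt_min ?lexx //;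
    [apply/andP; split|apply/orP; right]; lra.
by rewrite ge_min => /orP[]; lra.
Qed.

(* The mean value inequality with one exceptional function [chi], which takes
   care of the points where the derivative is not controlled. *)
Lemma mean_value_ineq_except V (f : R -> V) (Psi chi : R -> R) (N : set R) a b : a <= b ->
  (forall x y, a <= x -> x <= y -> y <= b -> Psi x <= Psi y /\ chi x <= chi y) ->
  (forall t, a <= t <= b -> N t ->
     \forall p \near straddle a b t, `|f p.2 - f p.1| <= chi p.2 - chi p.1) ->
  (forall t e, a <= t <= b -> ~ N t -> 0 < e ->
     \forall p \near straddle a b t, `|f p.2 - f p.1| <= Psi p.2 - Psi p.1 + e * (p.2 - p.1)) ->
  `|f b - f a| <= Psi b - Psi a + (chi b - chi a).
Proof.
move=> ab mono fN fNc; apply/ler_addgt0Pr => e e0.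
pose k := e / (b - a + 1); have k0 : 0 < k by rewrite divr_gt0 // ltr_wpDl // subr_ge0.
have kab : k * (b - a) <= e.
  by rewrite /k mulrAC ler_pdivrMr ?ltr_wpDl ?subr_ge0 // ler_pM2l // lerDl.
suff : `|f b - f a| - Psi b - chi b - k * b <= `|f a - f a| - Psi a - chi a - k * a.
  by rewrite subrr normr0; lra.
apply: (@locally_nonincreasing a b (fun t => `|f t - f a| - Psi t - chi t - k * t)) => //.
move=> t tab.
suff : \forall p \near straddle a b t,
    `|f p.2 - f p.1| <= Psi p.2 - Psi p.1 + (chi p.2 - chi p.1) + k * (p.2 - p.1).
  apply: filterS => -[x y] /= fxy.
  have := ler_normD (f y - f x) (f x - f a); rewrite addrA subrK; lra.
have [tN|tN] := pselect (N t).
  move: (straddleP a b t) (fN t tab tN); apply: filterS2 => -[x y] [/= ax xt ty yb].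
  have xy := le_trans xt ty; have [Pxy _] := mono x y ax xy yb.
  have : k * x <= k * y by rewrite ler_pM2l.
  lra.
move: (straddleP a b t) (fNc t k tab tN k0); apply: filterS2 => -[x y] [/= ax xt ty yb].
by have [_ cxy] := mono x y ax (le_trans xt ty) yb; lra.
Qed.

Lemma mean_value_ineq V (f : R -> V) a b K : a <= b ->
  (forall t, a <= t <= b -> exists2 d, is_derive t 1 f d & `|d| <= K) ->
  `|f b - f a| <= K * (b - a).
Proof.
move=> ab fK; have K0 : 0 <= K.
  by have [|d _] := fK a; [rewrite lexx | exact: le_trans].
have := @mean_value_ineq_except V f (fun t => K * t) (cst 0) set0 a b ab.
rewrite /= subrr addr0 mulrBr; apply=> [x y _ xy _|//|t e tab _ e0].
  by rewrite ler_wpM2l.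
have [d fd dK] := fK t tab; have := is_derive1_straddle_norm a b fd e0.
move: (straddleP a b t); apply: filterS2 => -[x y] [/= _ xt ty _] /le_trans; apply.
have : `|d| * (y - x) <= K * (y - x) by rewrite ler_wpM2r // subr_ge0 (le_trans xt).
lra.
Qed.

End straddle.

Section segments.
Context {R : realType} {V W : normedModType R}.
Variables (F : V -> W) (x h : V) (d : R -> W).
Hypothesis Fd : forall s : R, 0 <= s <= 1 -> is_derive s 1 (fun s => F (x + s *: h)) (d s).

Lemma segment_mean_value_ineq K : (forall s : R, 0 <= s <= 1 -> `|d s| <= K) ->
  `|F (x + h) - F x| <= K.
Proof.
move=> dK; have := @mean_value_ineq R W (fun s => F (x + s *: h)) 0 1 K ler01.
rewrite scale1r scale0r addr0 subr0 mulr1; apply=> s s01.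
by exists (d s); [exact: Fd | exact: dK].
Qed.

Lemma segment_taylor (v : W) K : (forall s : R, 0 <= s <= 1 -> `|d s - v| <= K) ->
  `|F (x + h) - F x - v| <= K.
Proof.
move=> dvK.
have := @mean_value_ineq R W (fun s => F (x + s *: h) - s *: v) 0 1 K ler01.
rewrite !scale1r !scale0r addr0 !subr0 mulr1 [_ - F x]addrAC; apply=> s s01.
exists (d s - v); last exact: dvK.
have := is_derive1Zl v (is_derive_id s 1); rewrite scale1r => sv.
exact: is_deriveB (Fd s01) sv.
Qed.

End segments.

(** * Primitives of integrable functions *)

Global Instance lebesgue_ae_filter (R : realType) :
  Filter (nbhs (almost_everywhere (@lebesgue_measure R))).
Proof. exact: (ae_filter_ringOfSetsType (@lebesgue_measure R)). Qed.

Section primitive.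
Context {R : realType}.
Local Notation mu := (@lebesgue_measure R).
Implicit Types (f h phi psi : R -> R) (D : set R) (s t e k : R).

Definition integrableT f := mu.-integrable setT (EFin \o f).

Lemma integrableT_on f D : measurable D -> integrableT f -> mu.-integrable D (EFin \o f).
Proof. by move=> mD If; apply: integrableS If. Qed.

Lemma integrable_patch f D : measurable D -> mu.-integrable D (EFin \o f) -> integrableT (f \_ D).
Proof.
move=> mD If; rewrite /integrableT (_ : EFin \o (f \_ D) = (EFin \o f) \_ D).
  exact: (@integrable_mkcond _ _ _ mu D (EFin \o f) mD).1 If.
by apply/funext => x; rewrite /patch /=; case: ifP.
Qed.

Lemma integrableTB f h : integrableT f -> integrableT h -> integrableT (fun x => f x - h x).
Proof.
move=> If Ih; rewrite /integrableT (_ : EFin \o _ = (EFin \o f) \- (EFin \o h))%E //.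
exact: integrableB.
Qed.

Definition primitive f t : R := \int[mu]_(x in `]-oo, t]) f x.

Lemma primitive_increment f s t : integrableT f -> s <= t ->
  primitive f t - primitive f s = \int[mu]_(x in `]s, t]) f x.
Proof. by move=> If st; rewrite /primitive Rintegral_itvB //; exact: integrableT_on. Qed.

Lemma primitive_increment_le f h s t : integrableT f -> integrableT h ->
  (forall x, f x <= h x) -> s <= t ->
  primitive f t - primitive f s <= primitive h t - primitive h s.
Proof.
by move=> If Ih fh st; rewrite !primitive_increment // le_Rintegral //; exact: integrableT_on.
Qed.

Lemma primitiveZ k f t : integrableT f -> primitive (fun x => k * f x) t = k * primitive f t.
Proof. by move=> If; rewrite /primitive RintegralZl //; exact: integrableT_on. Qed.

Lemma primitiveB f h t : integrableT f -> integrableT h ->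
  primitive (fun x => f x - h x) t = primitive f t - primitive h t.
Proof. by move=> If Ih; rewrite /primitive RintegralB //; exact: integrableT_on. Qed.

Lemma primitive_is_derive f : integrableT f ->
  {ae mu, forall t : R, is_derive t 1 (primitive f) (f t)}.
Proof.
move=> If; have Ify t : mu.-integrable `]-oo, t] (EFin \o f) by exact: integrableT_on.
have locf : locally_integrable [set: R] f by apply: open_integrable_locally => //; exact: openT.
apply: filterS (FTC1Ny Ify locf) => t [+ <-]; rewrite derive1E; exact: derivableP.
Qed.

Definition density phi := integrableT phi /\ forall x, 0 <= phi x.

Lemma densityD phi psi : density phi -> density psi -> density (fun x => phi x + psi x).
Proof.
move=> [Iphi phi0] [Ipsi psi0]; split=> [|x]; last by rewrite addr_ge0.
rewrite /integrableT (_ : EFin \o _ = (EFin \o phi) \+ (EFin \o psi))%E //.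
exact: integrableD.
Qed.

Lemma densityZ k phi : 0 <= k -> density phi -> density (fun x => k * phi x).
Proof.
move=> k0 [Iphi phi0]; split=> [|x]; last by rewrite mulr_ge0.
rewrite /integrableT (_ : EFin \o _ = fun x => (k%:E * (EFin \o phi) x)%E) //.
exact: integrableZl.
Qed.

Lemma primitive_nondecreasing phi : density phi -> nondecreasing (primitive phi).
Proof. by move=> [Iphi phi0] s t st; rewrite -subr_ge0 primitive_increment // Rintegral_ge0. Qed.

Lemma density_small phi e : density phi -> 0 < e ->
  exists2 d, 0 < d & forall A, measurable A -> (mu A < d%:E)%E -> \int[mu]_(x in A) phi x < e.
Proof.
move=> [Iphi phi0] e0; have [d [d0 small]] := integral_normr_continuous Iphi e0.
exists d => // A mA /(small A mA); rewrite (_ : (fun x => _) = phi) //.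
by apply/funext => x; rewrite ger0_norm.
Qed.

Lemma lebesgue_measure_ocitv s t : s <= t -> mu `]s, t]%classic = (t - s)%:E.
Proof.
rewrite lebesgue_measure_itv /= lte_fin le_eqVlt => /predU1P[->|->//].
by rewrite ltxx subrr.
Qed.

Lemma primitive_uniform_continuous phi e : density phi -> 0 < e ->
  exists2 d, 0 < d & forall s t, s <= t -> t - s < d -> primitive phi t - primitive phi s < e.
Proof.
move=> dphi /(density_small dphi)[d d0 small]; exists d => // s t st std.
rewrite primitive_increment //; last by case: dphi.
by apply: small; [exact: measurable_itv | rewrite lebesgue_measure_ocitv].
Qed.

Lemma primitive_continuous phi : density phi -> continuous (primitive phi).
Proof.
move=> dphi t; apply/cvgrPdist_lt => e /(primitive_uniform_continuous dphi)[d d0 small].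
apply/nbhs_ballP; exists d => // s; rewrite /ball /= ltr_distl => /andP[sd ds].
have [st|/ltW ts] := leP s t; [|rewrite distrC];
  by rewrite ger0_norm ?subr_ge0 ?primitive_nondecreasing // small //; lra.
Qed.

Lemma Rintegral_ae_ge0 f D : measurable D -> integrableT f ->
  {ae mu, forall t, D t -> 0 <= f t} -> 0 <= \int[mu]_(x in D) f x.
Proof.
move=> mD If f0; pose f' x := Num.max (f x) 0.
have mf : measurable_fun [set: measurableTypeR R] f by case/integrableP: If => /measurable_EFinP.
rewrite /Rintegral (@ae_eq_integral _ _ _ mu D (EFin \o f')) //.
- by apply/fine_ge0/integral_ge0 => x _; rewrite lee_fin le_max lexx orbT.
- by apply/measurable_funTS/measurable_EFinP.
- by apply/measurable_funTS/measurable_EFinP/measurable_maxr.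
by apply: filterS f0 => x fx Dx; rewrite /= /f' max_l // fx.
Qed.

Lemma le_lebesgue_measure (A B : set R) : measurable A -> measurable B ->
  A `<=` B -> (mu A <= mu B)%E.
Proof. by move=> mA mB AB; apply: le_measure => //; rewrite inE. Qed.

Lemma negligible_open_cover (N : set R) e : mu.-negligible N -> 0 < e ->
  exists U : set R, [/\ open U, N `<=` U & (mu U < e%:E)%E].
Proof.
move=> /negligible_outer_measure N0 e0; have e2 : 0 < e / 2 by rewrite divr_gt0.
have [U [oU NU mU]] := outer_measure_open_le N e2; exists U; split => //.
by rewrite (le_lt_trans mU) // N0 add0e lte_fin; lra.
Qed.

Lemma ae_exists_itv (P : R -> Prop) s t : {ae mu, forall x, P x} -> s < t ->
  exists2 x, s < x < t & P x.
Proof.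
move=> [N [mN N0 NP]] st; apply: contrapT => no.
have : (mu `]s, t[%classic <= mu N)%E.
  apply: le_lebesgue_measure => // x /=; rewrite in_itv /= => sxt; apply: NP => Px.
  by apply: no; exists x.
by rewrite [leRHS]N0 lebesgue_measure_itv /= lte_fin st -EFinB lee_fin leNgt subr_gt0 st.
Qed.

Lemma lebesgue_ae_neq s : {ae mu, forall t : R, t != s}.
Proof.
exists [set s]; split; [exact: measurable_set1 | exact: lebesgue_measure_set1 |].
by move=> t /negP; rewrite negbK => /eqP.
Qed.

End primitive.

(** * Absolute continuity *)

Section null_variation.
Context {R : realType} {V : normedModType R}.
Local Notation mu := (@lebesgue_measure R).
Implicit Types (f : R -> V) (N U : set R) (a b s t x y e : R).

(* Luzin's condition (N), in the form used for the mean value inequality: the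
   variation of [f] on a null set is controlled by functions [chi] of
   arbitrarily small total increase. *)
Definition null_variation a b f := forall N e, mu.-negligible N -> 0 < e ->
  exists chi : R -> R,
   [/\ forall x y, a <= x -> x <= y -> y <= b -> chi x <= chi y,
       chi b - chi a <= e &
       forall t, a <= t <= b -> N t ->
         \forall p \near straddle a b t, `|f p.2 - f p.1| <= chi p.2 - chi p.1].

Lemma null_variation_increment_le f psi a b : a <= b -> density psi -> null_variation a b f ->
  {ae mu, forall t : R, a < t < b -> exists2 d, is_derive t 1 f d & `|d| <= psi t} ->
  `|f b - f a| <= primitive psi b - primitive psi a.
Proof.
move=> ab dpsi nvf fpsi; apply/ler_addgt0Pr => e e0.
have [B [mB B0 fB]] : {ae mu, forall t : R,
    (a < t < b -> exists2 d, is_derive t 1 f d & `|d| <= psi t) /\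
    is_derive t 1 (primitive psi) (psi t)}.
  by apply: filterI fpsi (primitive_is_derive _); case: dpsi.
pose N := B `|` [set a; b].
have nN : mu.-negligible N.
  apply: negligibleU; first by exists B; split.
  by apply: negligibleU; [exists [set a] | exists [set b]]; split => //;
    exact: lebesgue_measure_set1.
have [chi [chi_mono chi_e chiN]] := nvf N e nN e0.
suff : `|f b - f a| <= primitive psi b - primitive psi a + (chi b - chi a) by lra.
apply: (mean_value_ineq_except ab _ chiN) => [|t e' /andP[at_ tb] /not_orP[Bt]].
  by move=> x y ax xy yb; split; [exact: primitive_nondecreasing | exact: chi_mono].
move=> /not_orP[ta /= tb'] e'0.
have tab : a < t < b.
  by rewrite !lt_neqAle at_ tb !andbT eq_sym; apply/andP; split; apply/eqP.
have [/(_ tab)[d fd dpsi'] psit] : (a < t < b -> exists2 d, is_derive t 1 f d & `|d| <= psi t) /\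
    is_derive t 1 (primitive psi) (psi t) by apply: contrapT => /fB.
have e2 : 0 < e' / 2 by rewrite divr_gt0.
near=> p; have [_ /= pt tp _] : [/\ a <= p.1, p.1 <= t, t <= p.2 & p.2 <= b].
  by near: p; exact: straddleP.
have fp : `|f p.2 - f p.1| <= (`|d| + e' / 2) * (p.2 - p.1).
  by near: p; exact: is_derive1_straddle_norm.
have : `|primitive psi p.2 - primitive psi p.1 - (p.2 - p.1) *: psi t| <= e' / 2 * (p.2 - p.1).
  by near: p; exact: is_derive1_straddle.
have : `|d| * (p.2 - p.1) <= psi t * (p.2 - p.1) by rewrite ler_wpM2r // subr_ge0 (le_trans pt).
by rewrite ler_norml /GRing.scale /= => dp /andP[psip _]; lra.
Unshelve. all: by end_near.
Qed.

Lemma null_measure_ge_lebesgue N e : mu.-negligible N -> 0 < e ->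
  exists nu : {measure set measurableTypeR R -> \bar R}, (nu setT <= e%:E)%E /\
    forall (k : nat) t, N t -> exists2 O : set R, nbhs t O &
      forall A : set R, measurable A -> A `<=` O -> (k%:R%:E * mu A <= nu A)%E.
Proof.
move=> nN e0; pose dn (n : nat) := e / (2 ^ n.+1)%N%:R.
have dn0 n : 0 < dn n by rewrite divr_gt0 // ltr0n expn_gt0.
have /choice[U UP] n : exists U, [/\ open U, N `<=` U & (mu U < (dn n)%:E)%E].
  exact: negligible_open_cover.
have mU n : measurable (U n) by apply: measurable_realfun.open_measurable; case: (UP n).
exists (mseries (fun n => mrestr mu (mU n)) 0); split.
  apply: (@le_trans _ _ (\sum_(n <oo) (dn n)%:E)%E); last first.
    exact: (epsilon_trick0 xpredT (ltW e0)).
  apply: lee_nneseries => [n _ _|n _]; first exact: measure_ge0.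
  have [_ _ /ltW] := UP n; apply: le_trans; apply: le_lebesgue_measure => //.
  exact: measurableI.
move=> k t Nt.
exists [set s | forall n, (n < k)%N -> U n s].
  elim: k => [|k IH]; first by apply: (@filterS _ (nbhs t) _ setT) => [s _ n|]; last exact: filterT.
  have Ut : nbhs t (U k) by apply: open_nbhs_nbhs; have [oU NU _] := UP k; split => //; exact: NU.
  apply: filterS2 IH Ut => s Us Uk n; rewrite ltnS leq_eqVlt => /predU1P[->//|]; exact: Us.
move=> A mA AU; apply: (@le_trans _ _ (\sum_(0 <= n < k) mrestr mu (mU n) A)%E); last first.
  by apply: nneseries_lim_ge => n _ _; exact: measure_ge0.
rewrite big_mkord (eq_bigr (fun=> mu A)) => [|n _].
  by rewrite mule_natl big_const_ord iter_addr addr0.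
by rewrite /mrestr (setIidl _) // => z /AU; apply.
Qed.

Lemma derivable_null_variation f a b : a <= b ->
  (forall t, a <= t <= b -> derivable f t 1) -> null_variation a b f.
Proof.
move=> ab derf N e nN e0; have [nu [nu_e nuN]] := null_measure_ge_lebesgue nN e0.
have mitv x y : measurable (`]x, y]%classic : set R) by exact: measurable_itv.
have nu_le A : measurable A -> (nu A <= e%:E)%E.
  by move=> mA; apply: le_trans nu_e; rewrite le_measure ?inE.
have nu_fin A : measurable A -> nu A \is a fin_num.
  by move=> mA; rewrite ge0_fin_numE // (le_lt_trans (nu_le A mA)) // ltry.
pose chi t := fine (nu `]a, t]%classic).
have chiB x y : a <= x -> x <= y -> chi y - chi x = fine (nu `]x, y]%classic).
  move=> ax xy; rewrite /chi (@itv_bndbnd_setU _ _ _ (BRight x)) ?bnd_simp //.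
  rewrite measureU ?fineD ?nu_fin ?[_ + _ - _]addrAC ?subrr ?add0r //; try exact: mitv.
  by rewrite -subset0 => z [] /=; rewrite !in_itv /= => /andP[_ zx] /andP[/lt_geF]; rewrite zx.
exists chi; split.
- by move=> x y ax xy _; rewrite -subr_ge0 chiB // fine_ge0.
- by rewrite /chi set_itvoc0 measure0 subr0 -lee_fin fineK ?nu_fin // nu_le.
move=> t tab Nt; have [d fd] : exists d, is_derive t 1 f d.
  by exists ('D_1 f t); apply/derivableP/derf.
have [A tA nuA] := nuN (Num.truncn (`|d| + 1)).+1 t Nt.
near=> p; have [/= ap pt tp _] : [/\ a <= p.1, p.1 <= t, t <= p.2 & p.2 <= b].
  by near: p; exact: straddleP.
have pA : `[p.1, p.2]%classic `<=` A by near: p; exact: near_straddle_itv.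
have fp : `|f p.2 - f p.1| <= (`|d| + 1) * (p.2 - p.1).
  by near: p; exact: is_derive1_straddle_norm.
have p12 := le_trans pt tp; rewrite chiB // (le_trans fp) // -lee_fin fineK ?nu_fin //.
apply: le_trans (nuA `]p.1, p.2]%classic _ _); [|exact: mitv|]; last first.
  exact: subset_trans (@subset_itv_oc_cc _ _ _ _) pA.
rewrite lebesgue_measure_ocitv // -EFinM lee_fin ler_wpM2r ?subr_ge0 //.
by rewrite ltW // truncnS_gt.
Unshelve. all: by end_near.
Qed.

End null_variation.

Section ordered_families.
Context {R : realType}.
Local Notation mu := (@lebesgue_measure R).
Implicit Types (x y : nat -> R) (n : nat).

Definition ordered_family x y n :=
  (forall i, (i < n)%N -> x i <= y i) /\ (forall i j, (i < j < n)%N -> y i <= x j).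

Lemma ordered_familyW x y n : ordered_family x y n.+1 -> ordered_family x y n.
Proof.
move=> [xy yx]; split=> [i /ltnW/xy//|i j /andP[ij jn]].
by apply: yx; rewrite ij ltnW.
Qed.

Definition family_union x y n : set R := \big[setU/set0]_(i < n) `]x i, y i]%classic.

Lemma measurable_family_union x y n : measurable (family_union x y n).
Proof. by apply: bigsetU_measurable => i _; exact: measurable_itv. Qed.

Lemma family_union_disjoint x y n : ordered_family x y n.+1 ->
  family_union x y n `&` `]x n, y n] = set0.
Proof.
move=> [_ yx]; rewrite -subset0 => z [].
rewrite /family_union -(bigcup_mkord n (fun i => `]x i, y i]%classic)) => -[i /= ni].
rewrite !in_itv /= => /andP[_ zy] /andP[xz _].
by have := yx i n; rewrite ni ltnSn => /(_ isT); lra.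
Qed.

Lemma measure_family_union x y n : ordered_family x y n ->
  mu (family_union x y n) = (\sum_(i < n) (y i - x i))%:E.
Proof.
elim: n => [|n IH] xy; first by rewrite /family_union !big_ord0 measure0.
transitivity (mu (family_union x y n) + mu `]x n, y n]%classic)%E.
  rewrite /family_union big_ord_recr /=; apply: measureU.
  - exact: measurable_family_union.
  - exact: measurable_itv.
  - exact: family_union_disjoint.
rewrite IH; last exact: ordered_familyW.
by rewrite big_ord_recr EFinD lebesgue_measure_ocitv //; case: xy => + _; exact.
Qed.

Lemma Rintegral_family_union f x y n : integrableT f -> ordered_family x y n ->
  \int[mu]_(t in family_union x y n) f t = \sum_(i < n) (primitive f (y i) - primitive f (x i)).
Proof.
move=> If; elim: n => [|n IH] xy; first by rewrite /family_union !big_ord0 Rintegral_set0.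
rewrite {1}/family_union big_ord_recr /= -/(family_union x y n) Rintegral_setU.
- rewrite IH; last exact: ordered_familyW.
  by rewrite big_ord_recr primitive_increment //; case: xy => + _; exact.
- exact: measurable_family_union.
- exact: measurable_itv.
- by apply: integrableT_on => //; apply: measurableU => //; exact: measurable_family_union.
- by apply/eqP; exact: family_union_disjoint.
Qed.

End ordered_families.

Section absolute_continuity.
Context {R : realType} {V : normedModType R}.
Local Notation mu := (@lebesgue_measure R).
Implicit Types (f : R -> V) (U : set R) (a b s t e T : R).

Lemma primitive_abs_cont T f phi : density phi ->
  (forall s t, 0 <= s -> s <= t -> t <= T -> `|f t - f s| <= primitive phi t - primitive phi s) ->
  abs_cont T f.
Proof.
move=> dphi fphi e /(density_small dphi)[d d0 small]; exists d => // n x y xyT yx sum_d.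
have xy : ordered_family x y n by split=> // i /xyT[_ []].
have := small _ (measurable_family_union x y n).
rewrite measure_family_union // lte_fin => /(_ sum_d).
rewrite Rintegral_family_union //; last by case: dphi.
apply: le_lt_trans; apply: ler_sum => i _.
by have [? [? ?]] := xyT i (ltn_ord i); exact: fphi.
Qed.

Definition variations f U a t : set R :=
  [set v | exists n x y, [/\ ordered_family x y n,
     forall i, (i < n)%N -> a <= x i /\ y i <= t,
     forall i, (i < n)%N -> `[x i, y i]%classic `<=` U &
     v = \sum_(i < n) `|f (y i) - f (x i)|]].

Lemma variations0 f U a t : variations f U a t 0.
Proof.
exists 0%N, (fun=> 0), (fun=> 0).
by split; rewrite ?big_ord0 //; split=> // i j; rewrite ltn0 andbF.
Qed.

Lemma variationsW f U a s t : s <= t -> variations f U a s `<=` variations f U a t.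
Proof.
move=> st v [n [x [y [xy ax xyU ->]]]]; exists n, x, y; split => // i /ax[? ys].
by split => //; exact: le_trans st.
Qed.

Lemma variations_rcons f U a s t v : a <= s -> s <= t -> `[s, t]%classic `<=` U ->
  variations f U a s v -> variations f U a t (v + `|f t - f s|).
Proof.
move=> as_ st stU [n [x [y [[xy yx] axs xyU ->]]]].
exists n.+1, (fun i => if (i < n)%N then x i else s), (fun i => if (i < n)%N then y i else t).
have caseS (P : nat -> Prop) : (forall i, (i < n)%N -> P i) -> P n ->
    forall i, (i < n.+1)%N -> P i.
  by move=> Pi Pn i; rewrite ltnS leq_eqVlt => /predU1P[->//|]; exact: Pi.
split; first split.
- by apply: caseS => [i ni|]; rewrite ?ni ?ltnn // xy.
- move=> i j /andP[ij]; rewrite ltnS leq_eqVlt => /predU1P[jn|jn].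
    by rewrite -jn ij ltnn; have [] := axs i; rewrite -?jn.
  by rewrite (ltn_trans ij jn) jn yx // ij.
- apply: caseS => [i ni|]; rewrite ?ni ?ltnn //.
  by have [? ys] := axs i ni; split => //; exact: le_trans st.
- by apply: caseS => [i ni|]; rewrite ?ni ?ltnn //; exact: xyU.
rewrite big_ord_recr /= ltnn; congr (_ + _).
by apply: eq_bigr => i _; rewrite ltn_ord.
Qed.

Lemma abs_cont_variations_le T f e : abs_cont T f -> 0 < e ->
  exists2 d, 0 < d & forall U a t, open U -> (mu U < d%:E)%E -> 0 <= a -> t <= T ->
    ubound (variations f U a t) e.
Proof.
move=> acf /acf[d d0 fe]; exists d => // U a t oU mU a0 tT _ [n [x [y [[xy yx] axy xyU ->]]]].
apply/ltW/fe => //.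
  by move=> i ni; have [ax yt] := axy i ni; split; [lra | split; [exact: xy | lra]].
rewrite -lte_fin -measure_family_union //; apply: le_lt_trans mU.
apply: le_lebesgue_measure; first exact: measurable_family_union.
  exact: measurable_realfun.open_measurable.
rewrite /family_union -(bigcup_mkord n (fun i => `]x i, y i]%classic)) => z [i /= ni].
by move=> /subset_itv_oc_cc; exact: xyU.
Qed.

Lemma abs_cont_null_variation T f a b : 0 <= a -> a <= b -> b <= T ->
  abs_cont T f -> null_variation a b f.
Proof.
move=> a0 ab bT acf N e nN e0.
have [d d0 var_le] := abs_cont_variations_le acf e0.
have [U [oU NU mU]] := negligible_open_cover nN d0.
pose chi t := sup (variations f U a t).
have has_supV t : t <= b -> has_sup (variations f U a t).
  move=> tb; split; [by exists 0; exact: variations0 | exists e].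
  by apply: var_le => //; exact: le_trans bT.
have le_chi t v : t <= b -> variations f U a t v -> v <= chi t.
  by move=> tb Vv; apply: ub_le_sup => //; case: (has_supV t tb).
have chi_le t c : ubound (variations f U a t) c -> chi t <= c.
  by move=> Vc; apply: ge_sup => //; exists 0; exact: variations0.
exists chi; split.
- move=> x y ax xy yb; apply: chi_le => v /(variationsW xy); exact: le_chi.
- have : chi b <= e by apply/chi_le/var_le.
  by have := le_chi a 0 ab (variations0 _ _ _ _); lra.
move=> t tab Nt; have Ut : nbhs t U by apply: open_nbhs_nbhs; split => //; exact: NU.
near=> p; have [/= ap pt tp pb] : [/\ a <= p.1, p.1 <= t, t <= p.2 & p.2 <= b].
  by near: p; exact: straddleP.
have pU : `[p.1, p.2]%classic `<=` U by near: p; exact: near_straddle_itv.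
rewrite lerBrDr -lerBrDl; apply: chi_le => v Vv; rewrite lerBrDl addrC.
by apply: le_chi => //; apply: variations_rcons => //; exact: le_trans tp.
Unshelve. all: by end_near.
Qed.

End absolute_continuity.

Lemma limn_einf_le (R : realType) (u : nat -> \bar R) (C : \bar R) :
  (forall n, u n <= C)%E -> (limn_einf u <= C)%E.
Proof.
move=> uC; rewrite limn_einf_lim; apply: lime_le; first exact: is_cvg_einfs.
by near=> n; apply: le_trans (uC n); apply: ereal_inf_lbound; exists n => //=.
Unshelve. all: by end_near.
Qed.

Lemma limn_einf_ge0 (R : realType) (u : nat -> \bar R) :
  (forall n, 0 <= u n)%E -> (0 <= limn_einf u)%E.
Proof.
move=> u0; rewrite limn_einf_lim; apply: lime_ge; first exact: is_cvg_einfs.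
by near=> n; apply: le_ereal_inf_tmp => _ [k _ <-].
Unshelve. all: by end_near.
Qed.

Lemma measurable_fun_limn_einf d (T : measurableType d) (R : realType) (D : set T)
    (f : nat -> T -> \bar R) : (forall n, measurable_fun D (f n)) ->
  measurable_fun D (fun x => limn_einf (f ^~ x)).
Proof.
move=> mf; rewrite (_ : (fun x => _) = -%E \o (fun x => limn_esup ((fun n => -%E \o f n) ^~ x))).
  apply: measurableT_comp; first exact: oppe_measurable.
  apply: measurable_fun_limn_esup => n; exact: (measurableT_comp (@oppe_measurable R setT) (mf n)).
apply/funext => x /=; rewrite -limn_einfN; congr limn_einf.
by apply/funext => n /=; rewrite oppeK.
Qed.

Lemma limn_einf_lt_frequently (R : realType) (u : nat -> \bar R) (e : R) :
  (limn_einf u < e%:E)%E -> forall n0, exists2 n, (n0 <= n)%N & (u n < e%:E)%E.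
Proof.
move=> ue n0; apply: contrapT => no; move: ue; rewrite ltNge => /negP; apply.
rewrite limn_einf_lim; apply: lime_ge; first exact: is_cvg_einfs.
exists n0 => // m /= n0m; apply: le_ereal_inf_tmp => _ [n /= mn <-].
by rewrite leNgt; apply/negP => une; apply: no; exists n => //; exact: leq_trans mn.
Qed.

Lemma ae_limn_einf_eq0 d (T : measurableType d) (R : realType)
    (mu : {measure set T -> \bar R}) (D : set T) (f : (T -> \bar R)^nat) : measurable D ->
  (forall n, measurable_fun D (f n)) -> (forall n t, 0 <= f n t)%E ->
  (\int[mu]_(t in D) f n t)%E @[n --> \oo] --> 0%E ->
  {ae mu, forall t, D t -> limn_einf (f ^~ t) = 0%E}.
Proof.
move=> mD mf f0 int_f.
have int_liminf : (\int[mu]_(t in D) limn_einf (f ^~ t) = 0)%E.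
  apply/eqP; rewrite eq_le; apply/andP; split; last first.
    by apply: integral_ge0 => t _; exact: limn_einf_ge0.
  apply: (le_trans (fatou mu mD mf (fun n t _ => f0 n t))).
  by have /cvg_limn_einf_sup[-> _] := int_f.
have [+ _] := ae_eq_integral_abs mu mD (measurable_fun_limn_einf mf).
apply; rewrite -[RHS]int_liminf; apply: eq_integral => t _.
by rewrite gee0_abs //; exact: limn_einf_ge0.
Qed.

Section difference_quotients.
Context {R : realType} {V : normedModType R}.
Local Notation mu := (@lebesgue_measure R).
Variables (T : R) (f : R -> V).
Hypothesis T_gt0 : 0 < T.
Implicit Types (n k m : nat) (t : R).

Definition node n k : R := k%:R * (T / n%:R).

Lemma nodeS n k : node n k.+1 - node n k = T / n%:R.
Proof. by rewrite /node -mulrBl -natrB // subSnn mul1r. Qed.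

Lemma node_last n : (0 < n)%N -> node n n = T.
Proof. by move=> n0; rewrite /node mulrCA divff ?mulr1 // pnatr_eq0 -lt0n. Qed.

Lemma node_le n j k : (j <= k)%N -> node n j <= node n k.
Proof. by move=> jk; rewrite ler_wpM2r ?ler_nat // divr_ge0 // ltW. Qed.

Lemma node_floor n t : (0 < n)%N -> 0 <= t < T ->
  exists2 k, (k < n)%N & node n k <= t < node n k.+1.
Proof.
move=> n0 /andP[t0 tT]; have h0 : 0 < T / n%:R by rewrite divr_gt0 // ltr0n.
have := truncn_itv (divr_ge0 t0 (ltW h0)); rewrite ler_pdivlMr // ltr_pdivrMr //.
set k := Num.truncn _ => /andP[kt tk]; exists k; last by rewrite kt.
rewrite ltnNge; apply/negP => /(node_le n); rewrite node_last // /node => Tk.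
by have := le_lt_trans (le_trans Tk kt) tT; rewrite ltxx.
Qed.

Definition quotient n k := `|f (node n k.+1) - f (node n k)| / (T / n%:R).

Definition quotient_step n t : R :=
  \sum_(k < n) quotient n k * \1_(`[node n k, node n k.+1[) t.

Lemma quotient_ge0 n k : 0 <= quotient n k.
Proof. by rewrite !divr_ge0 // ltW. Qed.

Lemma quotient_stepE n k t : (k < n)%N -> node n k <= t < node n k.+1 ->
  quotient_step n t = quotient n k.
Proof.
move=> kn /andP[kt tk]; rewrite /quotient_step (bigD1 (Ordinal kn)) //= big1 => [|j jk].
  by rewrite indicE mem_set ?mulr1 ?addr0 //= in_itv /= kt.
rewrite indicE memNset ?mulr0 //= in_itv /= => /andP[jt tj].
have : (j != k :> nat) by [].
by rewrite neq_ltn => /orP[/(node_le n)|/(node_le n)]; lra.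
Qed.

Lemma quotient_step_ge0 n t : 0 <= quotient_step n t.
Proof. by apply: sumr_ge0 => k _; rewrite mulr_ge0 // quotient_ge0. Qed.

Lemma measurable_quotient_step n : measurable_fun [set: measurableTypeR R] (quotient_step n).
Proof.
by apply: measurable_sum => k; apply: measurable_funM.
Qed.

Lemma integral_quotient_step n : (0 < n)%N ->
  (\int[mu]_t (quotient_step n t)%:E = (\sum_(k < n) `|f (node n k.+1) - f (node n k)|)%:E)%E.
Proof.
move=> n0; have h0 : 0 < T / n%:R by rewrite divr_gt0 // ltr0n.
under eq_integral do rewrite -sumEFin.
rewrite ge0_integral_sum // => [|k|k t _]; last 2 first.
- by apply/measurable_EFinP/measurable_funM => //; exact: measurable_indic.
- by rewrite lee_fin mulr_ge0 // quotient_ge0.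
rewrite -sumEFin; apply: eq_bigr => k _; under eq_integral do rewrite EFinM.
rewrite ge0_integralZl //; last 2 first.
- by apply/measurable_EFinP; exact: measurable_indic.
- by rewrite lee_fin quotient_ge0.
rewrite integral_indic // setIT [X in (_ * X)%E](_ : _ = (T / n%:R)%:E).
  by rewrite -EFinM mulfVK // gt_eqF.
rewrite -[LHS]/(mu `[node n k, node n k.+1[%classic) lebesgue_measure_itv /=.
by rewrite lte_fin -subr_gt0 nodeS h0 -EFinB nodeS.
Qed.

Lemma quotient_step_cvg (N : nat -> nat) t d : (forall m, (m < N m)%N) -> 0 < t < T ->
  is_derive t 1 f d -> quotient_step (N m) t @[m --> \oo] --> `|d|.
Proof.
move=> ltN /andP[t0 tT] fd; apply/cvgrPdist_le => e e0.
have := is_derive1_straddle 0 T fd e0; rewrite /straddle near_withinE.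
move=> /nbhs_ballP[r /= r0 fr].
have Tr : 0 < r / T by rewrite divr_gt0.
near=> m; have Nm : (0 < N m)%N by exact: leq_ltn_trans (ltN m).
have h0 : 0 < T / (N m)%:R by rewrite divr_gt0 // ltr0n.
have hr : T / (N m)%:R < r.
  rewrite mulrC -ltr_pdivlMr // (@le_lt_trans _ _ m.+1%:R^-1) //.
    by rewrite lef_pV2 ?posrE ?ltr0n // ler_nat.
  by near: m; exact: (near_infty_natSinv_lt (PosNum Tr)).
have [|k kN kt] := @node_floor (N m) t Nm; first by rewrite ltW.
rewrite (quotient_stepE kN kt) /quotient; have /andP[kt1 kt2] := kt.
have hE := nodeS (N m) k; set h := T / _ in h0 hr hE *.
have Df : `|f (node (N m) k.+1) - f (node (N m) k) - h *: d| <= e * h.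
  rewrite -hE; apply: (fr (node (N m) k, node (N m) k.+1)); last first.
    split => /=; [by rewrite mulr_ge0 ?divr_ge0 // ltW | exact: kt1 | exact: ltW |].
    by rewrite -(node_last Nm); exact: node_le.
  by split; rewrite /ball /= ltr_distl; apply/andP; split; lra.
rewrite -(ler_pM2r h0) -[X in `|_ - _| * X](gtr0_norm h0) -normrM mulrBl mulfVK ?gt_eqF //.
rewrite (_ : `|d| * h = `|h *: d|); last by rewrite normrZ gtr0_norm // mulrC.
by rewrite distrC (le_trans (ler_dist_dist _ _)).
Unshelve. all: by end_near.
Qed.

Lemma abs_cont_quotient_sum_le : abs_cont T f -> exists2 n, (0 < n)%N &
  forall m, \sum_(k < n * m.+1) `|f (node (n * m.+1) k.+1) - f (node (n * m.+1) k)| <= n%:R.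
Proof.
move=> /(_ 1 ltr01)[d d0 fd]; pose n := (Num.truncn (T / d)).+1.
have nd : T / n%:R < d.
  by rewrite ltr_pdivrMr ?ltr0n // mulrC -ltr_pdivrMr //; exact: truncnS_gt.
exists n => // m; pose M := (n * m.+1)%N.
suff block j : (j <= n)%N ->
    \sum_(k < j * m.+1) `|f (node M k.+1) - f (node M k)| <= j%:R by exact: block.
elim: j => [|j IH] jn; first by rewrite mul0n big_ord0.
rewrite mulSnr big_split_ord /= -[j.+1%:R]natr1; apply: lerD; first exact/IH/ltnW.
apply/ltW; apply: (fd _ (fun i => node M (j * m.+1 + i)%N) (fun i => node M (j * m.+1 + i).+1)).
- move=> i im; split; first by rewrite mulr_ge0 // divr_ge0 // ltW.
  split; first exact: node_le.
  rewrite -(@node_last M) ?muln_gt0 //; apply: node_le.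
  by rewrite (leq_trans _ (leq_mul jn (leqnn m.+1))) // mulSnr -addnS leq_add2l.
- by move=> i k /andP[ik km]; apply: node_le; rewrite -addnS leq_add2l.
rewrite (eq_bigr (fun=> T / M%:R)) => [|i _]; last exact: nodeS.
rewrite sumr_const card_ord (_ : _ *+ _ = T / n%:R) // -[LHS]mulr_natr natrM invfM mulrA.
by rewrite mulfVK // pnatr_eq0.
Qed.

End difference_quotients.

(* The derivative of [f] is dominated, by Fatou's lemma, by the lower limit of
   step functions of difference quotients, whose integrals are bounded because
   [f] has bounded variation. *)
Lemma W11_dominated (R : realType) (V : normedModType R) (T : R) (f : R -> V) :
  0 < T -> W11 T f -> exists2 phi : R -> R, density phi &
    forall s t, 0 <= s -> s <= t -> t <= T -> `|f t - f s| <= primitive phi t - primitive phi s.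
Proof.
move=> T0 [acf derf]; have [n n0 sum_le] := abs_cont_quotient_sum_le T0 acf.
pose F m t : \bar R := (quotient_step T f (n * m.+1) t)%:E.
have F0 m t : (0 <= F m t)%E by rewrite lee_fin quotient_step_ge0.
have mF m : measurable_fun [set: measurableTypeR R] (F m).
  by apply/measurable_EFinP; exact: measurable_quotient_step.
pose psi t := limn_einf (F ^~ t).
have psi0 t : (0 <= psi t)%E by apply: limn_einf_ge0 => m; exact: F0.
have mpsi : measurable_fun [set: measurableTypeR R] psi by exact: measurable_fun_limn_einf.
have Ipsi : (\int[lebesgue_measure]_t psi t <= n%:R%:E)%E.
  apply: le_trans (fatou _ measurableT mF (fun m t _ => F0 m t)) _.
  apply: limn_einf_le => m; rewrite integral_quotient_step ?muln_gt0 ?n0 // lee_fin.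
  exact: sum_le.
have dphi : density (fine \o psi).
  split=> [|t]; last by rewrite fine_ge0.
  have mphi : measurable_fun [set: measurableTypeR R] (EFin \o (fine \o psi)).
    by apply/measurable_EFinP; apply: measurableT_comp => //; exact: fine_measurable.
  apply/integrableP; split => //; apply: le_lt_trans (ltry n%:R); apply: le_trans Ipsi.
  apply: ge0_le_integral => //; first by apply: measurableT_comp.
  by move=> t _ /=; rewrite ger0_norm ?fine_ge0 //; case: (psi t) (psi0 t).
exists (fine \o psi) => // s t s0 st tT; apply: null_variation_increment_le => //.
  exact: abs_cont_null_variation acf.
apply: filterS derf => r derf /andP[sr rt].
have rT : 0 < r < T by rewrite (le_lt_trans s0 sr) (lt_le_trans rt tT).
have fr : is_derive r 1 f ('D_1 f r) by apply/derivableP/derf; rewrite /= in_itv.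
exists ('D_1 f r) => //; rewrite /psi /=.
suff -> : limn_einf (F ^~ r) = (`|'D_1 f r|)%:E by [].
apply: (fun cvgF => (cvg_limn_einf_sup cvgF).1).
apply: cvg_EFin; first by near=> m.
apply: (quotient_step_cvg T0 _ rT fr) => m.
by rewrite mulnC leq_pmulr.
Unshelve. all: by end_near.
Qed.

(** * Functions dominated by a primitive *)

Section stieltjes_density.
Context {R : realType}.
Local Notation mu := (@lebesgue_measure R).
Variables (F : cumulative R R) (h : R -> R).
Hypothesis dh : density h.
Hypothesis Fh : forall s t, s <= t -> F t - F s <= primitive h t - primitive h s.

Lemma stieltjes_itv (f : cumulative R R) (s t : R) : s <= t ->
  lebesgue_stieltjes_measure f `]s, t]%classic = (f t - f s)%:E.
Proof.
move=> st; rewrite /lebesgue_stieltjes_measure /= /measure_extension /=.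
by rewrite measurable_mu_extE /=; [exact: wlength_itv_bnd | exact: is_ocitv].
Qed.

(* The measures of [F] and of its complement [primitive h - F] add up to the
   measure with density [h]. *)
Lemma stieltjes_le_density A : measurable A ->
  (lebesgue_stieltjes_measure F A <= \int[mu]_(x in A) (h x)%:E)%E.
Proof.
have [Ih h0] := dh.
have Gnd : nondecreasing (fun x => primitive h x - F x).
  by move=> s t /Fh; lra.
have Hrc x : primitive h @ at_right x --> primitive h x.
  by apply: cvg_within_filter; exact: primitive_continuous.
have Grc x : (fun x => primitive h x - F x) @ at_right x --> primitive h x - F x.
  by apply: cvgB (Hrc x) _; exact: cumulative_is_right_continuous.
pose G : cumulative R R := HB.pack (fun x => primitive h x - F x)
  (isCumulative.Build R _ R (fun x => primitive h x - F x) Gnd Grc).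
pose H : cumulative R R := HB.pack (primitive h)
  (isCumulative.Build R _ R (primitive h) (primitive_nondecreasing dh) Hrc).
have nu0 (B : set (measurableTypeR R)) : (0 <= induced_charge Ih B)%E.
  by apply: integral_ge0 => x _; rewrite lee_fin.
pose nu := measure_of_charge (induced_charge Ih) nu0.
pose nF := lebesgue_stieltjes_measure F; pose nG := lebesgue_stieltjes_measure G.
have addE B : measure_add nF nG B = (nF B + nG B)%E by exact: measure_addE.
have HE : forall B, measurable B -> lebesgue_stieltjes_measure H B = measure_add nF nG B.
  apply: lebesgue_stieltjes_measure_unique => B /ocitvP[->|[[s t] /= st ->]].
    by rewrite !measure0.
  apply: etrans (esym (addE _)).
  by rewrite /nF /nG !stieltjes_itv ?ltW // -EFinD; congr EFin; rewrite /=; ring.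
have nuE : forall B, measurable B -> lebesgue_stieltjes_measure H B = nu B.
  apply: lebesgue_stieltjes_measure_unique => B /ocitvP[->|[[s t] /= st ->]].
    by rewrite !measure0.
  rewrite stieltjes_itv ?ltW //= primitive_increment ?ltW // /Rintegral fineK //.
  by apply: integrable_fin_num => //; exact: integrableT_on.
move=> mA; rewrite -[leRHS]/(nu A) -nuE // HE // [leRHS]addE; exact: leeDl.
Qed.

Lemma stieltjes_density : exists2 rho, density rho &
  forall s t, s <= t -> F t - F s = primitive rho t - primitive rho s.
Proof.
have [Ih h0] := dh; pose n := lebesgue_stieltjes_measure F.
have fin_n : fin_num_fun n.
  move=> A mA; rewrite ge0_fin_numE //; apply: le_lt_trans (stieltjes_le_density mA) _.
  rewrite -ge0_fin_numE; first by apply: integrable_fin_num => //; exact: integrableT_on.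
  by apply: integral_ge0 => x _; rewrite lee_fin.
pose nf : {finite_measure set (measurableTypeR R) -> \bar R} :=
  HB.pack n (@Measure_isFinite.Build _ _ _ n fin_n).
have dom : nf `<< mu.
  apply/null_content_dominatesP => A mA A0; apply/eqP; rewrite eq_le measure_ge0 andbT.
  rewrite (le_trans (stieltjes_le_density mA)) // null_set_integral //.
  by apply/measurable_funTS; case/integrableP: Ih.
have [r [r0 r_fin Ir nrE]] := radon_nikodym_sigma_finite dom.
have rE : EFin \o (fine \o r) = r by apply/funext => x /=; rewrite fineK.
exists (fine \o r); first by split; [rewrite /integrableT rE | move=> x; exact: fine_ge0].
move=> s t st; have Irho : integrableT (fine \o r) by rewrite /integrableT rE.
rewrite primitive_increment //; apply: EFin_inj; rewrite -stieltjes_itv //.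
rewrite -[LHS]/(nf `]s, t]%classic) nrE // /Rintegral fineK.
  by rewrite -{1}rE.
by apply: integrable_fin_num => //; exact: integrableT_on.
Qed.

End stieltjes_density.

Definition lipschitz_wrt {R : realType} {V : normedModType R} (M : R -> R) (a b k : R)
    (f : R -> V) :=
  forall s t, a <= s -> s <= t -> t <= b -> `|f t - f s| <= k * (M t - M s).

Section lipschitz_wrt.
Context {R : realType}.
Implicit Types (V : normedModType R) (M phi psi : R -> R) (a b s t k : R).

Lemma lipschitz_wrt_sub M a b s t k V (f : R -> V) : a <= s -> t <= b ->
  lipschitz_wrt M a b k f -> lipschitz_wrt M s t k f.
Proof. by move=> as_ tb fk x y sx xy yt; apply: fk => //; lra. Qed.

Lemma lipschitz_wrtD M a b k l V (f h : R -> V) : lipschitz_wrt M a b k f ->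
  lipschitz_wrt M a b l h -> lipschitz_wrt M a b (k + l) (fun t => f t + h t).
Proof.
move=> fk hl s t as_ st tb; have := fk s t as_ st tb; have := hl s t as_ st tb.
rewrite opprD addrACA mulrDl => hst fst.
by rewrite (le_trans (ler_normD _ _)) // lerD.
Qed.

Lemma lipschitz_wrtN M a b k V (f : R -> V) : lipschitz_wrt M a b k f ->
  lipschitz_wrt M a b k (fun t => - f t).
Proof. by move=> fk s t as_ st tb; rewrite -opprD normrN fk. Qed.

Lemma lipschitz_wrtB M a b k l V (f h : R -> V) : lipschitz_wrt M a b k f ->
  lipschitz_wrt M a b l h -> lipschitz_wrt M a b (k + l) (fun t => f t - h t).
Proof. by move=> fk /lipschitz_wrtN; exact: lipschitz_wrtD. Qed.

Lemma lipschitz_wrtZ M a b k c V (f : R -> V) : 0 <= c -> lipschitz_wrt M a b k f ->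
  lipschitz_wrt M a b (c * k) (fun t => c *: f t).
Proof.
by move=> c0 fk s t as_ st tb; rewrite -scalerBr normrZ ger0_norm // -mulrA ler_wpM2l // fk.
Qed.

Lemma lipschitz_wrt_norm M a b k V (f : R -> V) : lipschitz_wrt M a b k f ->
  lipschitz_wrt M a b k (fun t => `|f t|).
Proof. by move=> fk s t as_ st tb; rewrite (le_trans (ler_dist_dist _ _)) // fk. Qed.

Lemma lipschitz_wrt_cst M a b V (v : V) : lipschitz_wrt M a b 0 (fun=> v).
Proof. by move=> s t _ _ _; rewrite subrr normr0 mul0r. Qed.

Lemma lipschitz_wrtM M a b k l A B (f h : R -> R) :
  (forall t, a <= t <= b -> `|f t| <= A /\ `|h t| <= B) ->
  lipschitz_wrt M a b k f -> lipschitz_wrt M a b l h ->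
  lipschitz_wrt M a b (A * l + B * k) (fun t => f t * h t).
Proof.
move=> fhAB fk hl s t as_ st tb.
have [fA _] : `|f t| <= A /\ `|h t| <= B by apply: fhAB; rewrite tb (le_trans as_).
have [_ hB] : `|f s| <= A /\ `|h s| <= B by apply: fhAB; rewrite as_ (le_trans st).
have -> : f t * h t - f s * h s = f t * (h t - h s) + h s * (f t - f s) by ring.
rewrite (le_trans (ler_normD _ _)) // !normrM mulrDl -!mulrA.
by rewrite lerD // ler_pM // ?hl ?fk.
Qed.

Section lipschitz_wrt_primitive.
Variables (phi : R -> R) (a b : R).
Hypothesis dphi : density phi.
Hypothesis ab : a <= b.
Local Notation mu := (@lebesgue_measure R).
Local Notation M := (primitive phi).

Let M_le s t : s <= t -> M s <= M t.
Proof. exact: primitive_nondecreasing. Qed.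

Let clamp t := Num.max a (Num.min t b).

Let clamp_id t : a <= t <= b -> clamp t = t.
Proof. by move=> /andP[ta tb]; rewrite /clamp (min_idPl tb) (max_idPr ta). Qed.

Let lipschitz_wrt_clamp k V (f : R -> V) : 0 <= k -> lipschitz_wrt M a b k f ->
  forall s t, s <= t -> `|f (clamp t) - f (clamp s)| <= k * (M t - M s).
Proof.
move=> k0 fk s t st.
have aC x : a <= clamp x by rewrite /clamp le_max lexx.
have Cb x : clamp x <= b by rewrite /clamp ge_max ab ge_min lexx orbT.
have Cst : clamp s <= clamp t by rewrite /clamp le_max2 // le_min2.
have [->|ne] := eqVneq (clamp s) (clamp t).
  by rewrite subrr normr0 mulr_ge0 // subr_ge0 M_le.
have at_ : a <= t.
  rewrite leNgt; apply: contra_neqN ne => ta.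
  by rewrite /clamp !max_l // ge_min ltW // (le_lt_trans st).
have sb : s <= b.
  rewrite leNgt; apply: contra_neqN ne => bs.
  by rewrite /clamp !min_r // ltW // (lt_le_trans bs).
apply: le_trans (fk _ _ (aC s) Cst (Cb t)) _; rewrite ler_wpM2l // lerB // M_le //.
  by rewrite /clamp ge_max at_ ge_min lexx.
by rewrite /clamp le_max le_min lexx sb orbT.
Qed.

Lemma lipschitz_wrt_continuous k V (f : R -> V) : 0 <= k -> lipschitz_wrt M a b k f ->
  {within `[a, b]%classic, continuous f}.
Proof.
move=> k0 f_lip; apply/subspace_continuousP => t /=; rewrite in_itv /= => /andP[at_ tb].
apply/cvgrPdist_le => e e0; have k1 : 0 < k + 1 by rewrite ltr_wpDl.
have /cvgrPdist_le /(_ _ (divr_gt0 e0 k1)) Mt := @primitive_continuous _ _ dphi t.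
rewrite near_withinE; apply: filterS Mt => s; rewrite ler_pdivlMr // => Mst /=.
rewrite in_itv /= => /andP[as_ sb]; apply: le_trans Mst.
have [st|/ltW ts] := leP s t.
  rewrite (le_trans (f_lip _ _ as_ st tb)) // mulrC ger0_norm ?subr_ge0 ?M_le //.
  by rewrite ler_wpM2l ?lerDl ?subr_ge0 ?M_le.
rewrite distrC (le_trans (f_lip _ _ at_ ts sb)) // mulrC distrC ger0_norm ?subr_ge0 ?M_le //.
by rewrite ler_wpM2l ?lerDl ?subr_ge0 ?M_le.
Qed.

Lemma lipschitz_wrt_primitive k (f : R -> R) : 0 <= k -> lipschitz_wrt M a b k f ->
  exists2 rho, integrableT rho &
    forall s t, a <= s -> s <= t -> t <= b -> f t - f s = primitive rho t - primitive rho s.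
Proof.
move=> k0 fk; have fC := lipschitz_wrt_clamp k0 fk; have [Iphi phi0] := dphi.
have k20 : 0 <= k + k by exact: addr_ge0.
pose F t := k * M t + f (clamp t).
have F_inc s t : s <= t -> 0 <= F t - F s <= (k + k) * (M t - M s).
  by move=> st; have := fC s t st; rewrite ler_norml /F => /andP[? ?]; apply/andP; split; lra.
have F_nd : nondecreasing F by move=> s t /F_inc; rewrite subr_ge0 => /andP[].
have F_rc x : F @ at_right x --> F x.
  apply/cvgrPdist_lt => e e0.
  have : (fun t => (k + k) * M t) @ x --> (k + k) * M x.
    by apply: cvgM; [exact: cvg_cst | exact: primitive_continuous].
  move=> /cvgrPdist_lt/(_ e e0) Mx; near=> t.
  have xt : x <= t by near: t; exact: nbhs_right_ge.
  have /andP[F0 FM] := F_inc x t xt; rewrite distrC ger0_norm // (le_lt_trans FM) //.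
  rewrite mulrBr (le_lt_trans (ler_norm _)) // distrC.
  by near: t; exact: cvg_within Mx.
pose cF : cumulative R R := HB.pack F (isCumulative.Build R _ R F F_nd F_rc).
have dh : density (fun x => (k + k) * phi x) by exact: densityZ.
have [|rho [Irho _] Frho] := @stieltjes_density R cF _ dh.
  by move=> s t /F_inc/andP[_]; rewrite /= !primitiveZ // mulrBr.
have Ikphi : integrableT (fun x => k * phi x) by have [] := densityZ k0 dphi.
exists (fun x => rho x - k * phi x); first exact: integrableTB.
move=> s t as_ st tb; rewrite !primitiveB // !primitiveZ //.
have := Frho s t st; rewrite /= /F !clamp_id; [lra | |].
  by rewrite as_ (le_trans st).
by rewrite tb (le_trans as_).
Unshelve. all: by end_near.
Qed.

Lemma primitive_shift_is_derive (f rho : R -> R) : integrableT rho ->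
  (forall s t, a <= s -> s <= t -> t <= b -> f t - f s = primitive rho t - primitive rho s) ->
  {ae mu, forall t : R, a < t < b -> is_derive t 1 f (rho t)}.
Proof.
move=> Irho frho; apply: filterS (primitive_is_derive Irho) => t rhot /andP[at_ tb].
have : is_derive t 1 (fun s => f a - primitive rho a + primitive rho s) (rho t).
  by have := is_deriveD (is_derive_cst (f a - primitive rho a) t 1) rhot; rewrite add0r.
apply: near_eq_is_derive; near=> s; have : s \in `]a, b[.
  by near: s; apply: near_in_itvoo; rewrite in_itv /= at_.
rewrite in_itv => /andP[as_ sb]; have := frho a s (lexx a) (ltW as_) (ltW sb); rewrite /=; lra.
Unshelve. all: by end_near.
Qed.

Lemma lipschitz_wrt_derivable k (f : R -> R) : 0 <= k -> lipschitz_wrt M a b k f ->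
  {ae mu, forall t : R, a < t < b -> derivable f t 1}.
Proof.
move=> k0 fk; have [rho Irho frho] := lipschitz_wrt_primitive k0 fk.
by apply: filterS (primitive_shift_is_derive Irho frho) => t ft /ft[].
Qed.

Lemma lipschitz_wrt_nondecreasing k (f : R -> R) : 0 <= k -> lipschitz_wrt M a b k f ->
  {ae mu, forall t : R, a < t < b -> forall d, is_derive t 1 f d -> 0 <= d} -> f a <= f b.
Proof.
move=> k0 fk fge0; have [rho Irho frho] := lipschitz_wrt_primitive k0 fk.
rewrite -subr_ge0 frho // primitive_increment // -Rintegral_itv_bndo_bndc; last first.
  exact: integrableT_on.
apply: Rintegral_ae_ge0 => //; apply: filterS2 fge0 (primitive_shift_is_derive Irho frho).
by move=> t fge0 frhot /=; rewrite in_itv => tab; exact/fge0/frhot.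
Qed.

Lemma lipschitz_wrt_norm_le k l V (f : R -> V) (h : R -> R) : 0 <= k -> 0 <= l ->
  lipschitz_wrt M a b k f -> lipschitz_wrt M a b l h ->
  {ae mu, forall t : R, a < t < b ->
     exists d d', [/\ is_derive t 1 f d, is_derive t 1 h d' & `|d| <= d']} ->
  `|f b - f a| <= h b - h a.
Proof.
move=> k0 l0 fk hl fh.
suff : h a - `|f a - f a| <= h b - `|f b - f a| by rewrite subrr normr0; lra.
have := lipschitz_wrt_norm (lipschitz_wrtB fk (@lipschitz_wrt_cst M a b _ (f a))).
rewrite addr0 => nk.
apply: (lipschitz_wrt_nondecreasing (addr_ge0 l0 k0) (lipschitz_wrtB hl nk)).
apply: filterS2 fh (lipschitz_wrt_derivable k0 nk) => t fht nt tab e.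
have [d [d' [fd hd' dd']]] := fht tab; move/derivableP : (nt tab) => n'.
move=> /(is_derive1_unique (is_deriveB hd' n')) <-.
rewrite subr_ge0; apply: le_trans dd'; apply: le_trans (ler_norm _) _; rewrite -[d]subr0.
apply: (is_derive1_norm_le n' (is_deriveB fd (is_derive_cst (f a) t 1))).
by near=> s; exact: ler_dist_dist.
Unshelve. all: by end_near.
Qed.

Lemma lipschitz_wrt_expRN K : 0 <= K ->
  lipschitz_wrt M a b K (fun t => expR (- (K * (M t - M a)))).
Proof.
move=> K0 s t as_ st tb; pose X r := expR (- (K * (M r - M a))).
have KM0 x y : x <= y -> 0 <= K * (M y - M x) by move=> xy; rewrite mulr_ge0 // subr_ge0 M_le.
have XE : X t = X s * expR (- (K * (M t - M s))) by rewrite /X -expRD; congr expR; ring.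
rewrite -/(X t) -/(X s) distrC XE -[X in `|X - _|]mulr1 -mulrBr normrM -[leRHS]mul1r.
have expN_le1 x y : x <= y -> expR (- (K * (M y - M x))) <= 1.
  by move=> xy; rewrite expR_le1 oppr_le0 KM0.
rewrite ler_pM //; first by rewrite gtr0_norm ?expR_gt0 // expN_le1.
rewrite ger0_norm ?subr_ge0 ?expN_le1 //.
by have := expR_ge1Dx (- (K * (M t - M s))); lra.
Qed.

Lemma is_derive_expRN K t d : is_derive t 1 M d ->
  is_derive t 1 (fun s => expR (- (K * (M s - M a)))) (- (K * d) * expR (- (K * (M t - M a)))).
Proof.
move=> Md; have KM := is_deriveN (is_deriveZ K (is_deriveB Md (is_derive_cst (M a) t 1))).
by have := is_derive1_comp (is_derive_expR _) KM; rewrite subr0 mulrC.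
Qed.

Lemma gronwall k K E (F : R -> R) : 0 <= k -> 0 <= K -> 0 <= E ->
  lipschitz_wrt M a b k F -> F a = 0 ->
  {ae mu, forall t : R, a < t < b -> forall d, is_derive t 1 F d -> d <= phi t * (K * F t + E)} ->
  F b <= expR (K * (M b - M a)) * (E * (M b - M a)).
Proof.
move=> k0 K0 E0 Fk Fa dF; have [Iphi phi0] := dphi.
pose X t := expR (- (K * (M t - M a))).
have X_le1 t : a <= t -> X t <= 1.
  by move=> at_; rewrite expR_le1 oppr_le0 mulr_ge0 // subr_ge0 M_le.
have FB t : a <= t <= b -> `|X t| <= 1 /\ `|F t| <= k * (M b - M a).
  move=> /andP[at_ tb]; rewrite gtr0_norm ?expR_gt0 // X_le1 //; split => //.
  have := Fk a t (lexx a) at_ tb; rewrite Fa subr0 => /le_trans; apply.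
  by rewrite ler_wpM2l // lerD2r M_le.
have XF := lipschitz_wrtM FB (lipschitz_wrt_expRN K0) Fk.
have EM : lipschitz_wrt M a b E (fun t => E * M t).
  by move=> s t _ st _; rewrite -mulrBr ger0_norm // mulr_ge0 // subr_ge0 M_le.
have decr : E * M a - X a * F a <= E * M b - X b * F b.
  apply: (lipschitz_wrt_nondecreasing _ (lipschitz_wrtB EM XF)).
    by rewrite !addr_ge0 ?mulr_ge0 // subr_ge0 M_le.
  apply: filterS3 dF (lipschitz_wrt_derivable k0 Fk) (primitive_is_derive Iphi).
  move=> t dF derF Mt tab d; have /andP[/ltW at_ _] := tab.
  have Ft := derivableP (derF tab); have := dF tab _ Ft; set l := 'D_1 F t in Ft * => l_le.
  have XFt := is_deriveM (is_derive_expRN K Mt) Ft.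
  move=> /(is_derive1_unique (is_deriveB (is_deriveZ E Mt) XFt)) <-.
  have : X t * l <= X t * (phi t * (K * F t + E)) by rewrite ler_pM2l // expR_gt0.
  have : X t * (phi t * E) <= phi t * E by rewrite ler_piMl ?mulr_ge0 ?X_le1.
  by rewrite /GRing.scale /= -/(X t); clear; lra.
have XbE : expR (K * (M b - M a)) * X b = 1 by rewrite /X -expRD subrr expR0.
rewrite -[F b]mul1r -XbE -mulrA ler_pM2l ?expR_gt0 //.
by move: decr; rewrite Fa mulr0; lra.
Qed.

End lipschitz_wrt_primitive.
End lipschitz_wrt.

Section small_derivatives.
Context {R : realType}.
Local Notation mu := (@lebesgue_measure R).
Variables (phi : R -> R) (a b : R) (h : nat -> R -> R) (k : nat -> R).
Hypothesis dphi : density phi.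
Hypothesis ab : a <= b.
Hypothesis k_ge0 : forall n, 0 <= k n.
Hypothesis hk : forall n, lipschitz_wrt (primitive phi) a b (k n) (h n).
Hypothesis h_nondecreasing : forall n s t, a <= s -> s <= t -> t <= b -> h n s <= h n t.
Hypothesis h_total : (h n b - h n a) @[n --> \oo] --> (0 : R).

(* The densities of the [h n] are nonnegative with integrals tending to 0, so
   that their lower limit vanishes a.e. by Fatou's lemma. *)
Lemma ae_frequently_small_derivative :
  {ae mu, forall t : R, a < t < b -> forall e n0, 0 < e ->
     exists n, (n0 <= n)%N /\ exists2 d, is_derive t 1 (h n) d & 0 <= d <= e}.
Proof.
have /choice[rho rhoP] n : exists rho, integrableT rho /\
    forall s t, a <= s -> s <= t -> t <= b -> h n t - h n s = primitive rho t - primitive rho s.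
  by have [rho] := lipschitz_wrt_primitive dphi ab (k_ge0 n) (hk n); exists rho.
have h_der : {ae mu, forall (t : R) n, a < t < b -> is_derive t 1 (h n) (rho n t)}.
  apply/ae_foralln => n; have [Irho rhoE] := rhoP n.
  exact: primitive_shift_is_derive Irho rhoE.
have rho_ge0 n t : (forall n, a < t < b -> is_derive t 1 (h n) (rho n t)) -> a < t < b ->
    0 <= rho n t.
  move=> ht abt; apply: (is_derive1_ge0 (ht n abt)); have /andP[at_ tb] := abt.
  near=> s; have ts : t < s by near: s; exact: nbhs_right_gt.
  apply: h_nondecreasing; [exact: ltW|exact: ltW|].
  by apply: ltW; near: s; exact: nbhs_right_lt.
pose D := `]a, b[%classic : set R; pose f n t := (Num.max (rho n t) 0)%:E.
have mf n : measurable_fun D (f n).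
  have [/integrableP[/measurable_EFinP mrho _] _] := rhoP n.
  exact/measurable_funTS/measurable_EFinP/measurable_maxr.
have f0 n t : (0 <= f n t)%E by rewrite lee_fin le_max lexx orbT.
have int_f n : (\int[mu]_(t in D) f n t = (h n b - h n a)%:E)%E.
  have [Irho rhoE] := rhoP n.
  rewrite rhoE // primitive_increment // -Rintegral_itv_bndo_bndc; last exact: integrableT_on.
  rewrite /Rintegral fineK; last by apply: integrable_fin_num => //; exact: integrableT_on.
  apply: ae_eq_integral; [exact: measurable_itv|exact: mf| |].
    by have := integrableT_on (measurable_itv `]a, b[) Irho; case/integrableP.
  apply: filterS h_der => t ht Dt; rewrite /f /= max_l //; apply: (rho_ge0 _ _ ht).
  by move: Dt; rewrite /D /= in_itv.
have int_f0 : (\int[mu]_(t in D) f n t)%E @[n --> \oo] --> 0%E.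
  by rewrite (funext int_f); apply: cvg_EFin h_total; exact: nearW.
have ae_liminf := ae_limn_einf_eq0 (mu := mu) (measurable_itv `]a, b[) mf f0 int_f0.
apply: filterS2 h_der ae_liminf => t ht f_liminf abt e n0 e0.
have Dt : D t by rewrite /D /= in_itv.
have liminf_lt : (limn_einf (f ^~ t) < e%:E)%E by rewrite f_liminf // lte_fin.
have [n n0n fn] := limn_einf_lt_frequently liminf_lt n0.
exists n; split=> //; exists (rho n t); first exact: ht.
by rewrite rho_ge0 //=; move: fn; rewrite lte_fin gt_max => /andP[/ltW].
Unshelve. all: by end_near.
Qed.
End small_derivatives.

Lemma derivable1_approx (R : realType) (X : completeNormedModType R) (f : R -> X) (t : R) :
  (forall e, 0 < e -> exists d, \forall s \near t, `|f s - f t - (s - t) *: d| <= e * `|s - t|) ->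
  derivable f t 1.
Proof.
move=> approx; apply/cauchy_cvgP; apply/cauchy_exP => e e0.
have e2 : 0 < e / 2 by rewrite divr_gt0.
have [d fd] := approx _ e2; exists d; rewrite -ball_normE.
suff : \forall h \near 0^', `|d - h^-1 *: ((f \o shift t) (h *: 1) - f t)| < e by [].
rewrite near_withinE; move: fd => /nbhs_ballP[r /= r0 fd]; apply/nbhs_ballP; exists r => // h.
rewrite /ball /= sub0r normrN => hr h0; rewrite /= [h *: 1]mulr1.
have := fd (h + t); rewrite /ball /= distrC addrK => /(_ hr) fdh.
have -> : d - h^-1 *: (f (h + t) - f t) = - (h^-1 *: (f (h + t) - f t - h *: d)).
  by rewrite [in RHS]scalerBr scalerA mulVf // scale1r opprB.
rewrite normrN normrZ normfV (@le_lt_trans _ _ (e / 2)) ?ltr_pdivrMr //; last first.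
  by rewrite ltr_pMr // ltrDl.
by rewrite ler_pdivrMl ?normr_gt0 // mulrC.
Qed.

Lemma cauchy_rate_limit (R : realType) (X : completeNormedModType R) (u : nat -> X)
    (C : R) (eps : nat -> R) : eps n @[n --> \oo] --> (0 : R) ->
  (forall n m, `|u n - u m| <= C * (eps n + eps m)) -> exists l, forall n, `|u n - l| <= C * eps n.
Proof.
move=> eps0 u_cauchy.
have Ceps n : C * (eps n + eps m) @[m --> \oo] --> C * eps n.
  rewrite -[X in _ --> C * X]addr0.
  by apply: cvgMl_tmp; apply: cvgD; [exact: cvg_cst | exact: eps0].
have u_cvg : cvgn u.
  apply/cauchy_cvgP; apply/cauchy_exP => e e0.
  have : C * eps n @[n --> \oo] --> (0 : R) by rewrite -[X in _ --> X](mulr0 C); exact: cvgMl_tmp.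
  move=> /cvgr_lt /(_ (e / 2)); rewrite divr_gt0 // => /(_ isT) [N _ Ceps_lt].
  exists (u N), N => // n /= Nn; rewrite -ball_normE /= (le_lt_trans (u_cauchy N n)) //.
  have := Ceps_lt N (leqnn N); have := Ceps_lt n Nn; rewrite /=; lra.
exists (limn u) => n; apply: (ler_cvg_to _ (Ceps n)).
  by apply: cvg_norm; apply: cvgB; [exact: cvg_cst | exact: u_cvg].
by near=> m; exact: u_cauchy.
Unshelve. all: by end_near.
Qed.

(** * Prox-regularity of sublevel sets *)

Section level_set.
Context {R : realType} {X : normedModType R}.
Variables (ip : X -> X -> R) (F : X -> R) (gr : X -> X) (C : R).
Hypothesis hX : hilbert_inner ip.
Hypothesis C_gt0 : 0 < C.
Hypothesis F_line : forall x h (s : R),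
  is_derive s 1 (fun s => F (x + s *: h)) (ip (gr (x + s *: h)) h).
Hypothesis gr_lip : forall x y, `|gr x - gr y| <= C * `|x - y|.
Implicit Types (x y z d h v p e : X) (r s a rho eta : R).

Lemma level_taylor x h : `|F (x + h) - F x - ip (gr x) h| <= C * `|h| ^+ 2.
Proof.
apply: (segment_taylor (fun s _ => F_line x h s)) => s /andP[s0 s1].
rewrite -(ipBl hX) (le_trans (cauchy_schwarz hX _ _)) // expr2 mulrA ler_wpM2r //.
rewrite (le_trans (gr_lip _ _)) // ler_pM2l // addrC addKr normrZ ger0_norm //.
by rewrite ler_piMl.
Qed.

Let F_line0 x h : is_derive (0 : R) 1 (fun s => F (x + s *: h)) (ip (gr x) h).
Proof. by have := F_line x h 0; rewrite scale0r addr0. Qed.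

Lemma descent_direction x h : ip (gr x) h < 0 ->
  \forall s \near (0 : R)^'+, F (x + s *: h) <= F x.
Proof.
move=> gh; have gh0 : 0 < - ip (gr x) h by rewrite oppr_gt0.
have /is_derive1P /(_ _ gh0) Fs := F_line0 x h.
near=> s; have s0 : 0 < s by near: s; exact: nbhs_right_gt.
have : `|F (x + s *: h) - F (x + (0 : R) *: h) - (s - 0) *: ip (gr x) h|
    <= - ip (gr x) h * `|s - 0|.
  by near: s; exact: cvg_within Fs.
rewrite scale0r addr0 subr0 (gtr0_norm s0) /GRing.scale /= ler_norml => /andP[_]; lra.
Unshelve. all: by end_near.
Qed.

Lemma level_set_bdry x : F x = 1 -> gr x != 0 -> bdry [set y | F y <= 1] x.
Proof.
move=> Fx gr0; split; first by apply: subset_closure; rewrite /= Fx.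
have dN : is_derive (0 : R) 1 (fun s : R => - F (x + s *: gr x)) (- ip (gr x) (gr x)).
  by apply: is_deriveN; exact: F_line0.
move=> x_int; have : 0 <= - ip (gr x) (gr x).
  apply: (is_derive1_ge0 dN).
  rewrite scale0r addr0 Fx; near=> s; rewrite lerN2; near: s.
  have : x + s *: gr x @[s --> (0 : R)^'+] --> x.
    rewrite -[X in _ --> X](addr0 x) -[X in _ --> _ + X](scale0r (gr x)).
    apply: cvgD; first exact: cvg_cst.
    by apply: cvgZr_tmp; apply: cvg_within; exact: cvg_id.
  by move/(_ _ x_int).
by rewrite (ipxx hX) oppr_ge0 leNgt exprn_gt0 ?normr_gt0.
Unshelve. all: by end_near.
Qed.

Definition proximal_normal r x d :=
  forall z, F z <= 1 -> 0 <= ip (x - z) d + `|d| / (2 * r) * `|x - z| ^+ 2.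

Lemma proximal_normal_feasible r x d v : 0 < r -> proximal_normal r x d ->
  (\forall s \near (0 : R)^'+, F (x - s *: v) <= 1) -> 0 <= ip v d.
Proof.
move=> r0 nd Fv; rewrite -oppr_le0; apply/ler_addgt0Pr => e e0; rewrite add0r.
set k := `|d| / (2 * r) * `|v| ^+ 2.
have k0 : 0 <= k by rewrite mulr_ge0 ?sqr_ge0 // divr_ge0 ?mulr_ge0 // ltW.
near (0 : R)^'+ => s; have s0 : 0 < s by near: s; exact: nbhs_right_gt.
have sk : s * (k + 1) <= e.
  rewrite -ler_pdivlMr ?ltr_wpDl //; near: s; apply: nbhs_right_le.
  by rewrite divr_gt0 ?ltr_wpDl.
have /nd : F (x - s *: v) <= 1 by near: s.
have -> : x - (x - s *: v) = s *: v by lmod.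
rewrite (ipZl hX) normrZ (gtr0_norm s0) exprMn.
have -> : s * ip v d + `|d| / (2 * r) * (s ^+ 2 * `|v| ^+ 2) = s * (ip v d + s * k).
  by rewrite /k; ring.
rewrite pmulr_rge0 //; lra.
Unshelve. all: by end_near.
Qed.

Lemma proximal_normal_interior r x d : 0 < r -> F x < 1 -> proximal_normal r x d -> d = 0.
Proof.
move=> r0 Fx nd; have : 0 <= ip (- d) d.
  apply: (proximal_normal_feasible r0 nd).
  have : F (x + s *: d) @[s --> (0 : R)] --> F x.
    have := is_derive1_continuous (F_line0 x d).
    by rewrite /prop_for /continuous_at /= scale0r addr0.
  move=> /cvgr_lt /(_ 1 Fx) Fs; apply: cvg_within; apply: filterS Fs => s /ltW.
  by rewrite scalerN opprK.
by rewrite (ipNl hX) (ipxx hX) oppr_ge0 le_eqVlt ltNge sqr_ge0 orbF sqrf_eq0 normr_eq0 => /eqP.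
Qed.

Lemma proximal_normal_ray r x d : 0 < r -> F x = 1 -> gr x != 0 ->
  proximal_normal r x d -> exists2 a, 0 <= a & d = a *: gr x.
Proof.
move=> r0 Fx gr0 nd; apply: (halfspace_normal hX gr0) => v gv.
apply: (proximal_normal_feasible r0 nd).
have /descent_direction : ip (gr x) (- v) < 0 by rewrite (ipNr hX) oppr_lt0.
by rewrite Fx; apply: filterS => s; rewrite scalerN.
Qed.

Section prox_regularity.
Variables (c lam : R).
Hypothesis c_gt0 : 0 < c.
Hypothesis lam_gt0 : 0 < lam.
Hypothesis gr_ge : forall x, F x = 1 -> c <= `|gr x|.
Hypothesis gr_hypomonotone : forall x y, F x = 1 -> F y = 1 ->
  - lam * `|x - y| ^+ 2 <= ip (gr x - gr y) (x - y).

Definition unit_normal x := `|gr x|^-1 *: gr x.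

Lemma gradE x : F x = 1 -> gr x = `|gr x| *: unit_normal x.
Proof.
move=> /gr_ge cg; rewrite scalerA divff ?scale1r // gt_eqF //; exact: lt_le_trans cg.
Qed.

Lemma norm_unit_normal x : F x = 1 -> `|unit_normal x| = 1.
Proof.
move=> /gr_ge cg; rewrite normrZ normfV normr_id mulVf // gt_eqF //; exact: lt_le_trans cg.
Qed.

Let unit_dist_sqr (u v : X) : `|u| = 1 -> `|v| = 1 -> `|u - v| ^+ 2 = 2 - 2 * ip u v.
Proof. by move=> u1 v1; rewrite (normB_sqr hX) u1 v1; ring. Qed.

(* Moving [y] in the direction [u - n], where [n] is the unit normal at [y] and
   [u] the unit vector from [y] to [p], stays in the sublevel set and would come
   too close to [p] unless these two unit vectors almost coincide. *)
Lemma almost_nearest_direction y p rho eta s : F y = 1 -> 0 < s -> s * (2 * C) <= c ->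
  2 * s <= rho -> (forall v, F v <= 1 -> rho <= `|v - p|) ->
  `|p - y| ^+ 2 <= rho ^+ 2 + eta ->
  s * rho * `| `|p - y|^-1 *: (p - y) - unit_normal y| ^+ 2 <= 2 * eta.
Proof.
move=> Fy s0 sc sr far; set w := p - y => wr.
have rw : rho <= `|w| by rewrite distrC far // Fy.
have w0 : 0 < `|w| by apply: lt_le_trans rw; lra.
pose u := `|w|^-1 *: w; set n := unit_normal y.
have n1 : `|n| = 1 by exact: norm_unit_normal.
have u1 : `|u| = 1 by rewrite normrZ normfV normr_id mulVf ?gt_eqF.
have wE : w = `|w| *: u by rewrite scalerA divff ?scale1r ?gt_eqF.
rewrite -/u; set V := `|u - n| ^+ 2.
have VE : V = 2 - 2 * ip u n by exact: unit_dist_sqr.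
have V0 : 0 <= V by exact: sqr_ge0.
have h2 : `|s *: (u - n)| ^+ 2 = s ^+ 2 * V by rewrite normrZ exprMn gtr0_norm.
have Fh : F (y + s *: (u - n)) <= 1.
  have := level_taylor y (s *: (u - n)); rewrite Fy h2 {1}(gradE Fy) ler_norml => /andP[_].
  rewrite (ipZl hX) (ipZr hX) (ipBr hX) (ipxx hX) n1 (ipC hX n u).
  have : c * (s * V) <= `|gr y| * (s * V) by rewrite ler_wpM2r ?gr_ge // mulr_ge0 // ltW.
  have : s * (2 * C) * (s * V) <= c * (s * V) by rewrite ler_wpM2r // mulr_ge0 // ltW.
  have -> : ip u n = 1 - V / 2 by rewrite VE; field.
  lra.
have : rho ^+ 2 <= `|w - s *: (u - n)| ^+ 2.
  have -> : w - s *: (u - n) = - (y + s *: (u - n) - p) by rewrite /w; lmod.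
  by rewrite normrN ler_pXn2r ?nnegrE ?far //; lra.
rewrite (normB_sqr hX) h2 [in X in ip X _]wE (ipZl hX) (ipZr hX) (ipBr hX) (ipxx hX) u1.
have -> : ip u n = 1 - V / 2 by rewrite VE; field.
have : s * V * (rho - s) <= s * V * (`|w| - s) by rewrite ler_wpM2l ?mulr_ge0 ?lerD2r // ltW.
have : 0 <= s * V * (rho - 2 * s) by rewrite !mulr_ge0 ?subr_ge0 // ltW.
by rewrite expr1n; lra.
Qed.

Lemma almost_nearest_normal y p rho eta s : F y = 1 -> 0 < s -> s * (2 * C) <= c ->
  2 * s <= rho -> eta <= rho ^+ 2 -> (forall v, F v <= 1 -> rho <= `|v - p|) ->
  `|p - y| ^+ 2 <= rho ^+ 2 + eta ->
  `|p - y - rho *: unit_normal y| ^+ 2 <= eta * (1 + 4 * rho / s).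
Proof.
move=> Fy s0 sc sr eta_r far; have := almost_nearest_direction Fy s0 sc sr far.
set w := p - y => dir wr; have {dir} := dir _ wr.
have r0 : 0 < rho by lra.
have rw : rho <= `|w| by rewrite distrC far // Fy.
have w0 : 0 < `|w| by exact: lt_le_trans rw.
have w2 : `|w| <= 2 * rho.
  by rewrite -(@ler_pXn2r _ 2) ?nnegrE ?mulr_ge0 ?(ltW r0) //; have := sqr_ge0 rho; lra.
have n1 := norm_unit_normal Fy; set n := unit_normal y in n1 *.
set V := `|_ - n| ^+ 2 => dir.
have -> : `|w - rho *: n| ^+ 2 = (`|w| - rho) ^+ 2 + rho * `|w| * V.
  have -> : V = 2 - 2 * (`|w|^-1 * ip w n).
    by rewrite /V unit_dist_sqr ?(ipZl hX) // normrZ normfV normr_id mulVf ?gt_eqF.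
  rewrite (normB_sqr hX) (ipZr hX) normrZ n1 (gtr0_norm r0).
  by field; rewrite gt_eqF.
have : (`|w| - rho) ^+ 2 <= eta.
  have : 0 <= rho * (`|w| - rho) by rewrite mulr_ge0 ?subr_ge0 // ltW.
  lra.
have : rho * `|w| * V <= eta * (4 * rho / s).
  have V_le : V <= 2 * eta / (s * rho) by rewrite ler_pdivlMr ?mulr_gt0 // mulrC.
  have -> : eta * (4 * rho / s) = rho * (2 * rho) * (2 * eta / (s * rho)).
    by field; rewrite !gt_eqF.
  by apply: ler_pM; rewrite ?mulr_ge0 ?sqr_ge0 ?ler_pM2l // ltW.
lra.
Qed.

(* If both boundary points were at distance exactly [rho] from a common center
   lying on their normals, hypomonotonicity would force [c / rho <= lam]. *)
Lemma almost_common_center x y rho e : F x = 1 -> F y = 1 -> 0 < rho ->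
  x - y = e - rho *: (unit_normal x - unit_normal y) ->
  (c / rho - lam) * `|x - y| ^+ 2 <= `|e| * `|x - y| * (C + 2 * c / rho).
Proof.
move=> Fx Fy r0 xyE.
have n1 := norm_unit_normal Fx; have n'1 := norm_unit_normal Fy.
have gE := gradE Fx; have g'E := gradE Fy.
move: (unit_normal x) (unit_normal y) xyE n1 n'1 gE g'E => n n' xyE n1 n'1 gE g'E.
set D := `|x - y|; set V := `|n - n'| ^+ 2.
have VE : V = 2 - 2 * ip n n' by exact: unit_dist_sqr.
have mono : - lam * D ^+ 2 <= C * D * `|e| - rho * c * V.
  rewrite (le_trans (gr_hypomonotone Fx Fy)) // xyE (ipBr hX) (ipZr hX).
  apply: lerB.
    by rewrite (le_trans (ip_le hX _ _)) // ler_wpM2r // gr_lip.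
  rewrite -mulrA ler_pM2l //; have -> : ip (gr x - gr y) (n - n') = (`|gr x| + `|gr y|) / 2 * V.
    by rewrite {1}gE {1}g'E !(ipE hX) !(ipxx hX) n1 n'1 (ipC hX n' n) VE; field.
  by rewrite ler_wpM2r ?sqr_ge0 //; have := gr_ge Fx; have := gr_ge Fy; lra.
have curv : D ^+ 2 - 2 * (`|e| * D) <= rho ^+ 2 * V.
  have -> : rho ^+ 2 * V = `|e - (x - y)| ^+ 2.
    have -> : e - (x - y) = rho *: (n - n') by rewrite xyE; lmod.
    by rewrite normrZ exprMn gtr0_norm.
  rewrite (normB_sqr hX e (x - y)) -/D; have := ip_le hX e (x - y); rewrite -/D.
  have := sqr_ge0 `|e|; lra.
have : c / rho * (D ^+ 2 - 2 * (`|e| * D)) <= c / rho * (rho ^+ 2 * V).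
  by rewrite ler_pM2l // divr_gt0.
have -> : c / rho * (rho ^+ 2 * V) = rho * c * V by field; rewrite gt_eqF.
move: mono; lra.
Qed.

Definition exterior_ball x rho :=
  forall v, F v <= 1 -> 2 * rho * ip (unit_normal x) (v - x) <= `|v - x| ^+ 2.

Lemma dist_center_sqr x v rho : F x = 1 ->
  `|v - (x + rho *: unit_normal x)| ^+ 2
    = `|v - x| ^+ 2 - 2 * rho * ip (unit_normal x) (v - x) + rho ^+ 2.
Proof.
move=> /norm_unit_normal n1.
have -> : v - (x + rho *: unit_normal x) = (v - x) - rho *: unit_normal x by lmod.
rewrite (normB_sqr hX (v - x)) (ipZr hX) normrZ n1 mulr1.
by rewrite (ipC hX (v - x)) real_normK ?num_real //; ring.
Qed.

Lemma exterior_ball_far x v rho : F x = 1 -> 0 < rho -> exterior_ball x rho -> F v <= 1 ->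
  rho <= `|v - (x + rho *: unit_normal x)|.
Proof.
move=> Fx r0 ball_x /ball_x bv; rewrite -(@ler_pXn2r _ 2) ?nnegrE ?(ltW r0) //.
by rewrite dist_center_sqr //; lra.
Qed.

Lemma exterior_ballW x rho rho' : 0 <= rho' -> rho' <= rho ->
  exterior_ball x rho -> exterior_ball x rho'.
Proof.
move=> r0 rr ball_x v Fv; have [neg|/ltW pos] := leP (ip (unit_normal x) (v - x)) 0.
  by rewrite (@le_trans _ _ 0) ?sqr_ge0 // mulr_ge0_le0 // mulr_ge0.
by apply: le_trans (ball_x v Fv); rewrite ler_wpM2r // ler_pM2l.
Qed.

Lemma exterior_ball_small x : F x = 1 -> exterior_ball x (c / (2 * C)).
Proof.
move=> Fx v Fv; set i := ip _ _.
have gi : `|gr x| * i <= C * `|v - x| ^+ 2.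
  have := level_taylor x (v - x); rewrite subrKC Fx {1}(gradE Fx) (ipZl hX) -/i.
  by rewrite ler_norml => /andP[+ _]; lra.
have -> : 2 * (c / (2 * C)) * i = c * i / C by field; rewrite gt_eqF.
rewrite ler_pdivrMr // [_ * C]mulrC.
have [neg|pos] := leP i 0; last by apply: le_trans gi; rewrite ler_pM2r ?gr_ge.
by rewrite (@le_trans _ _ 0) ?mulr_ge0 ?sqr_ge0 ?(ltW C_gt0) // mulr_ge0_le0 // ltW.
Qed.

Lemma level_crossing y p : F y <= 1 -> 1 < F p ->
  exists2 y', F y' = 1 & `|p - y'| + `|y' - y| = `|p - y|.
Proof.
move=> Fy Fp.
have [||s s01 Fs] := @IVT _ (fun s : R => F (y + s *: (p - y))) 0 1 1 ler01.
- by apply: continuous_subspaceT => s; exact: is_derive1_continuous (F_line y (p - y) s).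
- by rewrite scale0r addr0 scale1r subrKC ge_min Fy le_max (ltW Fp) orbT.
exists (y + s *: (p - y)) => //; move: s01; rewrite in_itv /= => /andP[s0 s1].
have -> : p - (y + s *: (p - y)) = (1 - s) *: (p - y) by lmod.
have -> : y + s *: (p - y) - y = s *: (p - y) by lmod.
by rewrite !normrZ !ger0_norm ?subr_ge0 // -mulrDl subrK mul1r.
Qed.

Lemma boundary_contact_gap x y rho eta s : F x = 1 -> F y = 1 -> 0 < rho -> lam * rho < c ->
  exterior_ball x rho -> 0 < s -> s * (2 * C) <= c -> 2 * s <= rho -> eta <= rho ^+ 2 ->
  x != y -> `|x + rho *: unit_normal x - y| ^+ 2 <= rho ^+ 2 + eta ->
  (c / rho - lam) ^+ 2 * `|x - y| ^+ 2
    <= eta * ((1 + 4 * rho / s) * (C + 2 * c / rho) ^+ 2).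
Proof.
move=> Fx Fy r0 lamr ball_x s0 sc sr eta_r xy near_p.
have far v := @exterior_ball_far x v rho Fx r0 ball_x.
have := almost_nearest_normal Fy s0 sc sr eta_r far near_p.
set e := _ - rho *: unit_normal y => e_small.
have xyE : x - y = e - rho *: (unit_normal x - unit_normal y) by rewrite /e; lmod.
have D0 : 0 < `|x - y| by rewrite normr_gt0 subr_eq0.
have K0 : 0 <= C + 2 * c / rho by rewrite addr_ge0 ?divr_ge0 ?mulr_ge0 // ltW.
have gap : (c / rho - lam) * `|x - y| <= `|e| * (C + 2 * c / rho).
  rewrite -(ler_pM2r D0) -[leLHS]mulrA -expr2 [leRHS]mulrAC; exact: almost_common_center.
rewrite mulrA -exprMn; apply: le_trans (_ : _ <= (`|e| * (C + 2 * c / rho)) ^+ 2) _.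
  rewrite ler_pXn2r ?nnegrE // mulr_ge0 // subr_ge0 ler_pdivlMr //; exact: ltW.
by rewrite exprMn ler_wpM2r ?sqr_ge0.
Qed.

Lemma near_contact_boundary x v rho eta : F x = 1 -> 0 < rho -> exterior_ball x rho ->
  F v <= 1 -> 0 <= eta -> eta <= 1 / 16 -> `|v - x| <= 4 * rho ->
  `|x + rho *: unit_normal x - v| ^+ 2 <= rho ^+ 2 + eta * `|v - x| ^+ 2 ->
  exists y, [/\ F y = 1, `|v - x| <= 2 * `|x - y| &
    `|x + rho *: unit_normal x - y| ^+ 2 <= rho ^+ 2 + eta * `|v - x| ^+ 2].
Proof.
move=> Fx r0 ball_x Fv eta0 eta16; set D := `|v - x|; set p := x + _ => D4 near_v.
have Fp : 1 < F p.
  rewrite ltNge; apply/negP => /(exterior_ball_far Fx r0 ball_x).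
  by rewrite subrr normr0 leNgt r0.
have [y Fy pyv] := level_crossing Fv Fp.
have py : rho <= `|p - y| by rewrite distrC (exterior_ball_far Fx r0 ball_x) ?Fy.
have pv : `|p - y| <= `|p - v| by rewrite -pyv lerDl.
have rv : rho <= `|p - v| by exact: le_trans pv.
exists y; split=> //; last first.
  by apply: le_trans near_v; rewrite ler_pXn2r ?nnegrE.
have yv : `|y - v| <= D / 4.
  rewrite -(ler_pM2l r0).
  have : rho * (`|p - v| - rho) <= `|p - v| * (`|p - v| - rho).
    by rewrite ler_wpM2r // subr_ge0.
  have : 0 <= rho * (`|p - y| - rho) by rewrite mulr_ge0 ?subr_ge0 // ltW.
  have : 0 <= rho * (`|p - v| - rho) by rewrite mulr_ge0 ?subr_ge0 // ltW.
  have : eta * D ^+ 2 <= 1 / 16 * (D * (4 * rho)).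
    by rewrite ler_pM ?sqr_ge0 // expr2 ler_wpM2l // normr_ge0.
  rewrite -pyv in near_v *; lra.
have := ler_normD (x - y) (y - v); rewrite addrA subrK [`|x - v|]distrC -/D.
have : 0 <= D by exact: normr_ge0.
lra.
Qed.

Lemma boundary_contact_excluded rho : 0 < rho -> lam * rho < c ->
  exists eta, [/\ 0 < eta, eta <= 1 / 16 &
    forall x y k, F x = 1 -> F y = 1 -> exterior_ball x rho ->
      0 < k -> k <= 4 * rho -> k <= 2 * `|x - y| ->
      rho ^+ 2 + eta * k ^+ 2 < `|x + rho *: unit_normal x - y| ^+ 2].
Proof.
move=> r0 lamr; pose s := Num.min (c / (2 * C)) (rho / 2).
have s0 : 0 < s by rewrite lt_min !divr_gt0 ?mulr_gt0.
have sc : s * (2 * C) <= c by rewrite -ler_pdivlMr ?mulr_gt0 // ge_min lexx.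
have sr : 2 * s <= rho by rewrite mulrC -ler_pdivlMr // ge_min lexx orbT.
pose A := c / rho - lam; pose K := (1 + 4 * rho / s) * (C + 2 * c / rho) ^+ 2.
have A0 : 0 < A by rewrite subr_gt0 ltr_pdivlMr.
have K0 : 0 < K by rewrite mulr_gt0 ?exprn_gt0 // addr_gt0 // !divr_gt0 // mulr_gt0.
have [eta [eta0 eta16 etaK]] : exists eta, [/\ 0 < eta, eta <= 1 / 16 & eta * (8 * K) <= A ^+ 2].
  exists (Num.min (1 / 16) (A ^+ 2 / (8 * K))); split.
  - by rewrite lt_min !divr_gt0 ?exprn_gt0 // mulr_gt0.
  - by rewrite ge_min lexx.
  - by rewrite -ler_pdivlMr ?ge_min ?lexx ?orbT // mulr_gt0.
exists eta; split=> // x y k Fx Fy ball_x k0 k4 ky; rewrite ltNge; apply/negP => near_y.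
have y0 : 0 < `|x - y| by lra.
have k_y : k ^+ 2 <= 4 * `|x - y| ^+ 2.
  have -> : 4 * `|x - y| ^+ 2 = (2 * `|x - y|) ^+ 2 by ring.
  by rewrite ler_pXn2r ?nnegrE // ltW // mulr_gt0.
have k_rho : eta * k ^+ 2 <= rho ^+ 2.
  have -> : rho ^+ 2 = 1 / 16 * (4 * rho) ^+ 2 by field.
  by rewrite ler_pM ?sqr_ge0 ?ler_pXn2r ?nnegrE ?mulr_ge0 // ltW.
have xy : x != y by rewrite -subr_eq0 -normr_gt0.
have := boundary_contact_gap Fx Fy r0 lamr ball_x s0 sc sr k_rho xy near_y.
rewrite -/A -/K.
have : eta * k ^+ 2 * K <= eta * (4 * `|x - y| ^+ 2) * K by rewrite ler_pM2r // ler_pM2l.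
have : eta * (8 * K) * `|x - y| ^+ 2 <= A ^+ 2 * `|x - y| ^+ 2.
  by rewrite ler_pM2r // exprn_gt0.
have : 0 < A ^+ 2 * `|x - y| ^+ 2 by rewrite mulr_gt0 ?exprn_gt0.
lra.
Qed.

Lemma exterior_ball_extend x rho : F x = 1 -> 0 < rho -> lam * rho < c ->
  exterior_ball x rho -> exists2 rho', rho < rho' & exterior_ball x rho'.
Proof.
move=> Fx r0 lamr ball_x; have [eta [eta0 eta16 excluded]] := boundary_contact_excluded r0 lamr.
exists (rho * (1 + eta)); first by rewrite ltr_pMr // ltrDl.
move=> v Fv; rewrite leNgt; apply/negP; set i := ip _ _; set D := `|v - x| => contact.
have near_v : `|x + rho *: unit_normal x - v| ^+ 2 <= rho ^+ 2 + eta * D ^+ 2.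
  have : eta * (2 * rho * i) <= eta * D ^+ 2 by rewrite ler_pM2l // ball_x.
  by rewrite distrC dist_center_sqr // -/i -/D; lra.
have iD : 2 * (rho * (1 + eta)) * i <= 4 * rho * D.
  have : rho * (1 + eta) * i <= rho * (1 + eta) * D.
    rewrite ler_pM2l ?mulr_gt0 ?addr_gt0 // (le_trans (ip_le hX _ _)) //.
    by rewrite norm_unit_normal // mul1r.
  have : rho * (1 + eta) * D <= rho * 2 * D.
    by rewrite ler_wpM2r ?normr_ge0 // ler_pM2l //; lra.
  lra.
have D0 : 0 < D.
  rewrite lt_neqAle normr_ge0 andbT; apply/eqP => D0.
  by move: contact; rewrite -D0 expr0n /= ltNge (le_trans iD) // -D0 mulr0.
have D4 : D <= 4 * rho by rewrite -(ler_pM2r D0) -expr2; apply: le_trans iD; exact: ltW.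
have [y [Fy Dy]] := near_contact_boundary Fx r0 ball_x Fv (ltW eta0) eta16 D4 near_v.
by rewrite leNgt excluded.
Qed.

Lemma exterior_ball_max x : F x = 1 -> exterior_ball x (c / lam).
Proof.
move=> Fx; apply: contrapT => no_ball.
pose S := [set rho | exterior_ball x rho].
have S_le : ubound S (c / lam).
  move=> rho ball_x; rewrite leNgt; apply/negP => /ltW rc; apply: no_ball.
  by apply: exterior_ballW rc ball_x; rewrite divr_ge0 // ltW.
have S_small : S (c / (2 * C)) by exact: exterior_ball_small.
have supS : has_sup S by split; [exists (c / (2 * C)) | exists (c / lam)].
have sup0 : 0 < sup S.
  have : c / (2 * C) <= sup S by apply: ub_le_sup => //; case: supS.
  by apply: lt_le_trans; rewrite divr_gt0 // mulr_gt0.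
have ball_sup : exterior_ball x (sup S).
  move=> v Fv; have [neg|pos] := leP (ip (unit_normal x) (v - x)) 0.
    by rewrite (@le_trans _ _ 0) ?sqr_ge0 // mulr_ge0_le0 // mulr_ge0 // ltW.
  rewrite mulrAC -ler_pdivlMl ?mulr_gt0 //; apply: ge_sup; first by case: supS.
  move=> rho ball_x; rewrite ler_pdivlMl ?mulr_gt0 // mulrAC; exact: ball_x.
have : sup S <= c / lam by apply: ge_sup => //; case: supS.
rewrite le_eqVlt => /predU1P[supE|sup_lt]; first by apply: no_ball; rewrite -supE.
have [|rho' lt_rho' ball'] := @exterior_ball_extend x (sup S) Fx sup0 _ ball_sup.
  by rewrite mulrC -ltr_pdivlMr.
by have := ub_le_sup _ ball'; rewrite leNgt lt_rho' => /(_ supS.2).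
Qed.

Lemma gradient_proximal_normal x a : F x = 1 -> 0 <= a ->
  proximal_normal (c / lam) x (a *: gr x).
Proof.
move=> Fx a0 z Fz; have := exterior_ball_max Fx Fz.
rewrite -(opprB x z) normrN (ipNr hX) (ipC hX) => ball_z.
have gr_ip : ip (x - z) (gr x) = `|gr x| * ip (x - z) (unit_normal x).
  by rewrite {1}(gradE Fx) (ipZr hX).
rewrite (ipZr hX) gr_ip normrZ ger0_norm //.
have -> : a * (`|gr x| * ip (x - z) (unit_normal x))
    + a * `|gr x| / (2 * (c / lam)) * `|x - z| ^+ 2
  = a * `|gr x| * lam / (2 * c) * (2 * (c / lam) * ip (x - z) (unit_normal x) + `|x - z| ^+ 2).
  by field; rewrite !gt_eqF.
rewrite mulr_ge0 ?divr_ge0 ?mulr_ge0 ?(ltW c_gt0) ?(ltW lam_gt0) //.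
by move: ball_z; lra.
Qed.

End prox_regularity.
End level_set.

(** * Sweeping processes driven by level functions *)

(* [ratchet t] is the smallest displacement that keeps [psi s] below 1 for all
   [s] up to [t]. *)
Section ratchet.
Context {R : realType}.
Variables (psi : R -> R -> R) (M : R -> R) (a b xmax sigma k l : R).
Hypothesis sigma_gt0 : 0 < sigma.
Hypothesis k_ge0 : 0 <= k.
Hypothesis l_gt0 : 0 < l.
Hypothesis xmax_ge0 : 0 <= xmax.
Hypothesis M_nondecreasing : nondecreasing M.
Hypothesis psi_decrease : forall t x y, a <= t <= b -> 0 <= x -> x <= y -> y <= xmax ->
  psi t y <= psi t x - sigma * (y - x).
Hypothesis psi_time : forall s t x, a <= s -> s <= t -> t <= b ->
  psi t x <= psi s x + k * (M t - M s).
Hypothesis psi_lip : forall t x y, a <= t <= b -> psi t x <= psi t y + l * `|x - y|.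
Hypothesis psi_start : psi a 0 <= 1.
Hypothesis short_time : k * (M b - M a) <= sigma * xmax.
Implicit Types (s t x y : R).

Definition admissible t : set R :=
  [set x | 0 <= x <= xmax /\ forall s, a <= s <= t -> psi s x <= 1].

Definition ratchet t := inf (admissible t).

Lemma psi_decreaseW t x y : a <= t <= b -> 0 <= x -> x <= y -> y <= xmax -> psi t y <= psi t x.
Proof.
move=> tab x0 xy yx; apply: le_trans (psi_decrease tab x0 xy yx) _.
by rewrite gerBl mulr_ge0 ?subr_ge0 // ltW.
Qed.

Lemma admissible_xmax t : t <= b -> admissible t xmax.
Proof.
move=> tb; split=> [|s /andP[as_ st]]; first by rewrite xmax_ge0 lexx.
have sb := le_trans st tb; have sab : a <= s <= b by rewrite as_ sb.
have := psi_decrease sab (lexx 0) xmax_ge0 (lexx _).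
have := psi_time 0 (lexx a) as_ sb.
have : k * (M s - M a) <= k * (M b - M a) by rewrite ler_wpM2l // lerD2r; exact: M_nondecreasing.
by move: psi_start short_time; lra.
Qed.

Lemma has_inf_admissible t : t <= b -> has_inf (admissible t).
Proof.
by move=> tb; split; [exists xmax; exact: admissible_xmax | exists 0 => x [/andP[]]].
Qed.

Lemma ratchet_le t x : t <= b -> admissible t x -> ratchet t <= x.
Proof. by move=> tb xt; apply: ge_inf => //; case: (has_inf_admissible tb). Qed.

Lemma ratchet_bounds t : t <= b -> 0 <= ratchet t <= xmax.
Proof.
move=> tb; rewrite ratchet_le ?andbT //; last exact: admissible_xmax.
by apply: lb_le_inf; [case: (has_inf_admissible tb) | move=> x [/andP[]]].
Qed.

Lemma psi_ratchet_le s t : a <= s -> s <= t -> t <= b -> psi s (ratchet t) <= 1.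
Proof.
move=> as_ st tb; apply/ler_addgt0Pr => e e0.
have [x tx xe] := inf_adherent (divr_gt0 e0 l_gt0) (has_inf_admissible tb).
have sab : a <= s <= b by rewrite as_ (le_trans st).
have := psi_lip (ratchet t) x sab; have [_ /(_ s)] := tx; rewrite as_ st => /(_ isT).
have rx : ratchet t <= x by exact: ratchet_le.
rewrite distrC ger0_norm ?subr_ge0 //.
have : l * (x - ratchet t) <= e by rewrite -ler_pdivlMl // mulrC lerBlDl ltW.
lra.
Qed.

Lemma ratchet_start : a <= b -> ratchet a = 0.
Proof.
move=> ab; apply/eqP; rewrite eq_le; have /andP[-> _] := ratchet_bounds ab; rewrite andbT.
by apply: ratchet_le => //; split=> [|s /le_anti <-//]; rewrite lexx xmax_ge0.
Qed.

Lemma ratchet_nondecreasing s t : s <= t -> t <= b -> ratchet s <= ratchet t.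
Proof.
move=> st tb; apply: ratchet_le; first exact: le_trans tb.
split=> [|r /andP[ar rs]]; first exact: ratchet_bounds.
by apply: psi_ratchet_le => //; exact: le_trans st.
Qed.

Lemma admissible_ratchetD s t x : a <= s -> s <= t -> t <= b -> 0 <= x -> ratchet s + x <= xmax ->
  psi s (ratchet s) + k * (M t - M s) <= 1 + sigma * x -> admissible t (ratchet s + x).
Proof.
move=> as_ st tb x0 rx small; have sb := le_trans st tb.
have /andP[r0 _] := ratchet_bounds sb.
split=> [|r /andP[ar rt]]; first by rewrite addr_ge0.
have rb := le_trans rt tb; have rab : a <= r <= b by rewrite ar rb.
have rxx : ratchet s <= ratchet s + x by rewrite lerDl.
have [rs|/ltW sr] := leP r s.
  by apply: le_trans (psi_decreaseW rab r0 rxx rx) _; exact: psi_ratchet_le.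
have := psi_decrease rab r0 rxx rx; have := psi_time (ratchet s) as_ sr rb.
have : k * (M r - M s) <= k * (M t - M s) by rewrite ler_wpM2l // lerD2r; exact: M_nondecreasing.
lra.
Qed.

Lemma ratchet_increment_le s t : a <= s -> s <= t -> t <= b ->
  ratchet t - ratchet s <= k / sigma * (M t - M s).
Proof.
move=> as_ st tb; have sb := le_trans st tb; rewrite lerBlDl; set x := _ * _.
have sx : sigma * x = k * (M t - M s) by rewrite /x; field; rewrite gt_eqF.
have x0 : 0 <= x by rewrite mulr_ge0 ?divr_ge0 ?subr_ge0 ?M_nondecreasing // ltW.
have [rx|/ltW] := leP (ratchet s + x) xmax; last first.
  by apply: le_trans; have /andP[] := ratchet_bounds tb.
apply: ratchet_le => //; apply: admissible_ratchetD => //; rewrite sx lerD2r.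
exact: psi_ratchet_le.
Qed.

Lemma ratchet_idle t : a <= t -> t < b -> {for t, continuous M} -> psi t (ratchet t) < 1 ->
  \forall s \near t^'+, ratchet s = ratchet t.
Proof.
move=> at_ tb /cvgr_lt Mt idle.
have gap : M t < M t + (1 - psi t (ratchet t)) / (k + 1).
  by rewrite ltrDl divr_gt0 ?subr_gt0 // ltr_wpDl.
near=> s; have ts : t <= s by apply: ltW; near: s; exact: nbhs_right_gt.
have sb : s <= b by apply: ltW; near: s; exact: nbhs_right_lt.
have Ms : M s < M t + (1 - psi t (ratchet t)) / (k + 1).
  by near: s; exact: cvg_within (Mt _ gap).
apply/eqP; rewrite eq_le (ratchet_nondecreasing ts sb) andbT -[leRHS]addr0.
apply: ratchet_le => //; apply: admissible_ratchetD => //; rewrite ?addr0.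
  by have /andP[] := ratchet_bounds (ltW tb).
have : (M s - M t) * (k + 1) <= 1 - psi t (ratchet t).
  by rewrite -ler_pdivlMr ?ltr_wpDl // lerBlDl ltW.
have : M t <= M s by exact: M_nondecreasing.
lra.
Unshelve. all: by end_near.
Qed.

Lemma exists_ratchet : a <= b -> continuous M -> exists r : R -> R,
  [/\ r a = 0, forall t, t <= b -> 0 <= r t <= xmax,
      forall s t, a <= s -> s <= t -> t <= b -> 0 <= r t - r s <= k / sigma * (M t - M s),
      forall t, a <= t <= b -> psi t (r t) <= 1 &
      forall t, a <= t < b -> psi t (r t) < 1 -> \forall s \near t^'+, r s = r t].
Proof.
move=> ab Mc; exists ratchet; split.
- exact: ratchet_start.
- exact: ratchet_bounds.
- by move=> s t as_ st tb; rewrite subr_ge0 ratchet_nondecreasing // ratchet_increment_le.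
- by move=> t /andP[at_ tb]; exact: psi_ratchet_le.
- by move=> t /andP[at_ tb] idle; apply: ratchet_idle => //; exact: Mc.
Qed.

End ratchet.

Section sweeping.
Context {R : realType} {X : completeNormedModType R}.
Local Notation mu := (@lebesgue_measure R).
Variables (ip : X -> X -> R) (T c delta Cl Cn Cq Cd kap : R) (phi : R -> R).
Variables (level : R -> X -> R) (normal : R -> X -> X) (drift : R -> X -> X -> R).
Local Notation M := (primitive phi).
Hypothesis hX : hilbert_inner ip.
Hypothesis T_gt0 : 0 < T.
Hypothesis c_gt0 : 0 < c.
Hypothesis delta_lt1 : delta < 1.
Hypothesis Cl_ge0 : 0 <= Cl.
Hypothesis Cn_ge0 : 0 <= Cn.
Hypothesis Cq_ge0 : 0 <= Cq.
Hypothesis Cd_ge0 : 0 <= Cd.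
Hypothesis kap_ge0 : 0 <= kap.
Hypothesis dphi : density phi.
Hypothesis level_lip : forall s t x y, 0 <= s -> s <= t -> t <= T ->
  `|level t x - level s y| <= Cl * (`|x - y| + (M t - M s)).
Hypothesis normal_lip : forall s t x y, 0 <= s -> s <= t -> t <= T ->
  `|normal t x - normal s y| <= Cn * (`|x - y| + (M t - M s)).
Hypothesis normal_ge : forall t x, 0 <= t <= T -> level t x = 1 -> c <= `|normal t x|.
Implicit Types (s t a b eps : R) (x y : R -> X) (v d : X).

Definition level_chain t := forall x d, is_derive t 1 x d ->
  is_derive t 1 (fun s => level s (x s)) (drift t (x t) d - ip (normal t (x t)) d).

Definition drift_lip t := forall v1 v2 d1 d2, `|d1| <= kap * phi t -> `|d2| <= kap * phi t ->
  `|drift t v1 d1 - drift t v2 d2| <= delta * c * `|d1 - d2| + Cd * phi t * `|v1 - v2|.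

Hypothesis ae_chain_lip : {ae mu, forall t : R, 0 < t < T -> level_chain t /\ drift_lip t}.

Definition velocity_rule eps t v d :=
  (level t v < 1 -> d = 0) /\ (level t v = 1 -> near_ray c eps (normal t v) d).

Definition sweeping eps a b x :=
  [/\ lipschitz_wrt M a b kap x, (forall t, a <= t <= b -> level t (x t) <= 1) &
      {ae mu, forall t : R, a < t < b ->
         exists2 d, is_derive t 1 x d & velocity_rule eps t (x t) d}].

Let M_le s t : s <= t -> M s <= M t. Proof. exact: primitive_nondecreasing. Qed.

Lemma level_along_lip a b k x : 0 <= a -> b <= T -> lipschitz_wrt M a b k x ->
  lipschitz_wrt M a b (Cl * (k + 1)) (fun t => level t (x t)).
Proof.
move=> a0 bT x_lip s t as_ st tb; apply: le_trans (level_lip _ _ _ st _) _.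
- exact: le_trans as_.
- exact: le_trans bT.
by rewrite -mulrA ler_wpM2l // mulrDl mul1r lerD2r x_lip.
Qed.

Lemma lipschitz_wrt_velocity_le a b k x t d : 0 <= k -> a < t < b -> lipschitz_wrt M a b k x ->
  is_derive t 1 x d -> is_derive t 1 M (phi t) -> `|d| <= k * phi t.
Proof.
move=> k0 /andP[at_ tb] x_lip xd Md.
have kM : is_derive t 1 (fun s => k * M s) (k * phi t) by exact: is_deriveZ.
have -> : k * phi t = `|k * phi t| by rewrite ger0_norm // mulr_ge0 // dphi.2.
apply: (is_derive1_norm_le xd kM); near=> s.
have ts : t <= s by apply: ltW; near: s; exact: nbhs_right_gt.
rewrite -mulrBr ger0_norm ?mulr_ge0 ?subr_ge0 ?M_le //; apply: x_lip => //; first exact: ltW.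
by apply: ltW; near: s; exact: nbhs_right_lt.
Unshelve. all: by end_near.
Qed.

Lemma active_drift x t d : 0 < t < T -> level_chain t ->
  (forall s, 0 <= s <= T -> level s (x s) <= 1) -> level t (x t) = 1 ->
  is_derive t 1 x d -> drift t (x t) d = ip (normal t (x t)) d.
Proof.
move=> /andP[t0 tT] chain x_le x1 /chain /is_deriveN dN.
apply/eqP; rewrite -subr_eq0 -oppr_eq0; apply/eqP; apply: (is_derive1_min dN).
near=> s; rewrite /= lerN2 x1 x_le //; apply/andP; split; apply: ltW; near: s.
  exact: lt_nbhsr.
exact: lt_nbhsl.
Unshelve. all: by end_near.
Qed.

Definition level_gap x y t := `|level t (x t) - level t (y t)|.

Lemma level_gapC x y t : level_gap x y t = level_gap y x t.
Proof. exact: distrC. Qed.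

Lemma is_derive_level_diff x y t d1 d2 : level_chain t ->
  is_derive t 1 x d1 -> is_derive t 1 y d2 ->
  is_derive t 1 (fun s => level s (x s) - level s (y s))
    ((drift t (x t) d1 - ip (normal t (x t)) d1) - (drift t (y t) d2 - ip (normal t (y t)) d2)).
Proof. by move=> chain /chain xd /chain yd; exact: is_deriveB. Qed.

Lemma active_free_gap eps eps' x y t d1 d2 l : 0 < t < T -> level_chain t ->
  (forall s, 0 <= s <= T -> level s (x s) <= 1) -> level t (x t) = 1 -> level t (y t) < 1 ->
  is_derive t 1 x d1 -> is_derive t 1 y d2 -> is_derive t 1 (level_gap x y) l ->
  velocity_rule eps t (x t) d1 -> velocity_rule eps' t (y t) d2 ->
  c * `|d1 - d2| + l <= drift t (x t) d1 - drift t (y t) d2 + eps * `|d1 - d2|.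
Proof.
move=> tT chain x_le x1 y1 xd yd gapd [_ /(_ x1) d1_ray] [/(_ y1) d2_eq0 _].
have diffd := is_derive_level_diff chain xd yd.
have gapE : \forall s \near t, level s (x s) - level s (y s) = level_gap x y s.
  have diff_gt0 : 0 < level t (x t) - level t (y t) by rewrite x1 subr_gt0.
  have /cvgr_gt /(_ 0 diff_gt0) := is_derive1_continuous diffd.
  by apply: filterS => s s0; rewrite /level_gap gtr0_norm.
rewrite (is_derive1_unique gapd (near_eq_is_derive gapE diffd)).
rewrite (active_drift tT chain x_le x1 xd) d2_eq0 (ip0r hX) !subr0.
by have := near_ray_ip_ge hX d1_ray; lra.
Qed.

Lemma velocity_gap_le eps1 eps2 x y t d1 d2 l : 0 < t < T -> level_chain t ->
  (forall s, 0 <= s <= T -> level s (x s) <= 1) ->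
  (forall s, 0 <= s <= T -> level s (y s) <= 1) ->
  is_derive t 1 x d1 -> is_derive t 1 y d2 -> is_derive t 1 (level_gap x y) l ->
  velocity_rule eps1 t (x t) d1 -> velocity_rule eps2 t (y t) d2 ->
  0 <= eps1 -> 0 <= eps2 -> `|d1| <= kap * phi t -> `|d2| <= kap * phi t ->
  c * `|d1 - d2| + l <= `|drift t (x t) d1 - drift t (y t) d2|
    + kap * phi t * (3 * `|normal t (x t) - normal t (y t)| + 2 * (eps1 + eps2)).
Proof.
move=> tT chain x_le y_le xd yd gapd xr yr eps1_0 eps2_0 d1k d2k.
have t0T : 0 <= t <= T by case/andP: tT => t0 tT; rewrite !ltW.
have k0 : 0 <= kap * phi t by exact: le_trans d1k.
have n0 : 0 <= kap * phi t * (3 * `|normal t (x t) - normal t (y t)|).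
  by rewrite !mulr_ge0 // dphi.2.
have e1k : eps1 * `|d1 - d2| <= eps1 * (2 * (kap * phi t)).
  by rewrite ler_wpM2l // (le_trans (ler_normB _ _)) //; lra.
have e2k : eps2 * `|d1 - d2| <= eps2 * (2 * (kap * phi t)).
  by rewrite ler_wpM2l // (le_trans (ler_normB _ _)) //; lra.
have [ek1 ek2] : 0 <= eps1 * (kap * phi t) /\ 0 <= eps2 * (kap * phi t) by split; rewrite mulr_ge0.
have := x_le t t0T; rewrite le_eqVlt => /predU1P[x1|x_lt1];
  have := y_le t t0T; rewrite le_eqVlt => /predU1P[y1|y_lt1].
- have -> : l = 0.
    by apply: (is_derive1_min gapd); near=> s; rewrite /level_gap x1 y1 subrr normr0.
  rewrite addr0 (active_drift tT chain x_le x1 xd) (active_drift tT chain y_le y1 yd).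
  by apply: (near_ray_dist hX) => //; [exact: normal_ge | exact: xr.2 | exact: yr.2].
- have := active_free_gap tT chain x_le x1 y_lt1 xd yd gapd xr yr.
  have := ler_norm (drift t (x t) d1 - drift t (y t) d2); lra.
- have gapd' : is_derive t 1 (level_gap y x) l.
    by apply: near_eq_is_derive gapd; near=> s; exact: level_gapC.
  have := active_free_gap tT chain y_le y1 x_lt1 yd xd gapd' yr xr.
  rewrite [`|d2 - d1|]distrC [`|drift _ _ _ - _|]distrC.
  have := ler_norm (drift t (y t) d2 - drift t (x t) d1); lra.
- have lE : `|l| <= `|drift t (x t) d1 - drift t (y t) d2|.
    have := is_derive_level_diff chain xd yd.
    rewrite (xr.1 x_lt1) (yr.1 y_lt1) !(ip0r hX) !subr0 => diffd.
    by apply: (is_derive1_norm_le gapd diffd); near=> s; exact: ler_dist_dist.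
  by have := ler_norm l; rewrite (xr.1 x_lt1) (yr.1 y_lt1) !subrr normr0 in lE *; lra.
Unshelve. all: by end_near.
Qed.

Section comparison.
Variables (eps1 eps2 : R) (x y : R -> X).
Hypothesis eps1_ge0 : 0 <= eps1.
Hypothesis eps2_ge0 : 0 <= eps2.
Hypothesis x_sweeping : sweeping eps1 0 T x.
Hypothesis y_sweeping : sweeping eps2 0 T y.
Hypothesis same_start : x 0 = y 0.

Let m := (1 - delta) * c.
Let K := Cd + 3 * (kap * Cn).
Let E := 2 * kap * (eps1 + eps2).
Let L := Cl * (kap + 1) + Cl * (kap + 1).

Let m_gt0 : 0 < m. Proof. by rewrite mulr_gt0 // subr_gt0. Qed.
Let K_ge0 : 0 <= K. Proof. by rewrite addr_ge0 // !mulr_ge0. Qed.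
Let E_ge0 : 0 <= E. Proof. by rewrite !mulr_ge0 // addr_ge0. Qed.
Let L_ge0 : 0 <= L. Proof. by rewrite !(addr_ge0, mulr_ge0). Qed.

Lemma diff_lip : lipschitz_wrt M 0 T (kap + kap) (fun t => x t - y t).
Proof. by case: x_sweeping y_sweeping => [xl _ _] [yl _ _]; exact: lipschitz_wrtB. Qed.

Lemma level_gap_lip : lipschitz_wrt M 0 T L (level_gap x y).
Proof.
case: x_sweeping y_sweeping => [xl _ _] [yl _ _].
by apply/lipschitz_wrt_norm/lipschitz_wrtB; apply: level_along_lip.
Qed.

Lemma ae_velocity_gap : {ae mu, forall t : R, 0 < t < T -> exists d l,
  [/\ is_derive t 1 (fun s => x s - y s) d, is_derive t 1 (level_gap x y) l &
      m * `|d| + l <= phi t * (K * `|x t - y t| + E)]}.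
Proof.
have [xl x_le x_rule] := x_sweeping; have [yl y_le y_rule] := y_sweeping.
have gap_der : {ae mu, forall t : R, 0 < t < T -> derivable (level_gap x y) t 1}.
  by apply: lipschitz_wrt_derivable level_gap_lip => //; exact: ltW.
apply: filterS3 (filterI x_rule y_rule) (filterI gap_der (primitive_is_derive dphi.1)) ae_chain_lip.
move=> t [xt yt] [gt Mt] rt tT; have [chain dl] := rt tT.
have [d1 xd xr] := xt tT; have [d2 yd yr] := yt tT.
have gapd : is_derive t 1 (level_gap x y) ('D_1 (level_gap x y) t) by exact/derivableP/gt.
exists (d1 - d2), ('D_1 (level_gap x y) t); split=> //; first exact: is_deriveB.
have d1k := lipschitz_wrt_velocity_le kap_ge0 tT xl xd Mt.
have d2k := lipschitz_wrt_velocity_le kap_ge0 tT yl yd Mt.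
have := velocity_gap_le tT chain x_le y_le xd yd gapd xr yr eps1_ge0 eps2_ge0 d1k d2k.
have := dl (x t) (y t) d1 d2 d1k d2k.
have : kap * phi t * `|normal t (x t) - normal t (y t)| <= kap * phi t * (Cn * `|x t - y t|).
  have /andP[/ltW t0 /ltW tT'] := tT; rewrite ler_wpM2l ?mulr_ge0 ?dphi.2 //.
  by have := normal_lip (x t) (y t) t0 (lexx t) tT'; rewrite subrr addr0.
by rewrite /m /K /E; lra.
Qed.

Lemma sweeping_dist_le t : 0 <= t <= T ->
  m * `|x t - y t| <= expR (K / m * (M T - M 0)) * (E * (M T - M 0)).
Proof.
move=> /andP[t0 tT]; pose F s := m * `|x s - y s| + level_gap x y s.
have F_lip : lipschitz_wrt M 0 t (m * (kap + kap) + L) F.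
  apply: lipschitz_wrt_sub (lexx 0) tT _; apply: lipschitz_wrtD level_gap_lip.
  by apply: (lipschitz_wrtZ (ltW m_gt0)); exact/lipschitz_wrt_norm/diff_lip.
have F0 : F 0 = 0 by rewrite /F /level_gap same_start !subrr !normr0 mulr0 addr0.
have gap0 s : 0 <= level_gap x y s by exact: normr_ge0.
have F_ge s : m * `|x s - y s| <= F s by rewrite lerDl.
have dist_der : {ae mu, forall s : R, 0 < s < T -> derivable (fun s => `|x s - y s|) s 1}.
  apply: lipschitz_wrt_derivable (lipschitz_wrt_norm diff_lip) => //; first exact: ltW.
  exact: addr_ge0.
have Km0 : 0 <= K / m by rewrite divr_ge0 // ltW.
have k0 : 0 <= m * (kap + kap) + L.
  by rewrite addr_ge0 // mulr_ge0 ?addr_ge0 // ltW.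
apply: le_trans (F_ge t) _; apply: le_trans (gronwall dphi t0 k0 Km0 E_ge0 F_lip F0 _) _.
  apply: filterS2 ae_velocity_gap dist_der => s vel dist /andP[s0 st] F' Fd.
  have sT : 0 < s < T by rewrite s0 (lt_le_trans st).
  have [d [l [xyd gapd le_vel]]] := vel sT; have distd := derivableP (dist sT).
  have dist_le : 'D_1 (fun s => `|x s - y s|) s <= `|d|.
    apply: le_trans (ler_norm _) _; apply: (is_derive1_norm_le distd xyd).
    by near=> r; exact: ler_dist_dist.
  have FE : is_derive s 1 F (m * 'D_1 (fun s => `|x s - y s|) s + l).
    by apply: is_deriveD => //; exact: is_deriveZ.
  rewrite (is_derive1_unique Fd FE).
  have : phi s * (K / m * (m * `|x s - y s|)) <= phi s * (K / m * F s).
    by rewrite ler_wpM2l ?dphi.2 // ler_wpM2l.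
  have -> : K / m * (m * `|x s - y s|) = K * `|x s - y s| by field; rewrite gt_eqF.
  have : m * 'D_1 (fun s => `|x s - y s|) s <= m * `|d| by rewrite ler_pM2l.
  lra.
have MtT : M t - M 0 <= M T - M 0 by rewrite lerD2r M_le.
have Mt0 : 0 <= M t - M 0 by rewrite subr_ge0 M_le.
apply: ler_pM; [exact: expR_ge0 | exact: mulr_ge0 | |exact: ler_wpM2l].
by rewrite ler_expR; exact: ler_wpM2l.
Unshelve. all: by end_near.
Qed.

Lemma sweeping_diff_variation D s t : (forall t, 0 <= t <= T -> `|x t - y t| <= D) ->
  0 <= s -> s <= t -> t <= T ->
  m * `|x t - y t - (x s - y s)|
    <= (K * D + E) * (M t - M s) - (level_gap x y t - level_gap x y s).
Proof.
move=> xy_le s0 st tT.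
have sub k (V : normedModType R) (f : R -> V) : lipschitz_wrt M 0 T k f -> lipschitz_wrt M s t k f.
  exact: lipschitz_wrt_sub.
pose h r := (K * D + E) * M r - level_gap x y r.
have -> : (K * D + E) * (M t - M s) - (level_gap x y t - level_gap x y s) = h t - h s.
  by rewrite /h; ring.
have D0 : 0 <= D by apply: le_trans (xy_le 0 _); rewrite // lexx ltW.
have KDE : 0 <= K * D + E by rewrite addr_ge0 // mulr_ge0.
have h_lip : lipschitz_wrt M s t (K * D + E + L) h.
  apply: lipschitz_wrtB (sub _ _ _ level_gap_lip) => r r' sr rr' r't.
  by rewrite -mulrBr ger0_norm // mulr_ge0 // subr_ge0 M_le.
have diff_lipZ := lipschitz_wrtZ (ltW m_gt0) (sub _ _ _ diff_lip).
rewrite -(gtr0_norm m_gt0) -normrZ scalerBr.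
apply: (lipschitz_wrt_norm_le dphi st _ _ diff_lipZ h_lip).
- by rewrite mulr_ge0 ?addr_ge0 // ltW.
- by rewrite addr_ge0.
apply: filterS2 ae_velocity_gap (primitive_is_derive dphi.1) => r vel Mr /andP[sr rt].
have rT : 0 < r < T by rewrite (le_lt_trans s0 sr) (lt_le_trans rt tT).
have [d [l [xyd gapd le_vel]]] := vel rT.
exists (m *: d), ((K * D + E) * phi r - l); split; first exact: is_deriveZ.
  by apply: is_deriveB => //; exact: is_deriveZ.
rewrite normrZ gtr0_norm //.
have : phi r * (K * `|x r - y r|) <= phi r * (K * D).
  by have /andP[? ?] := rT; rewrite ler_wpM2l ?dphi.2 // ler_wpM2l // xy_le // !ltW.
lra.
Qed.

End comparison.

Lemma sweeping_comparison : exists2 C, 0 <= C & forall eps1 eps2 x y,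
  0 <= eps1 -> 0 <= eps2 -> sweeping eps1 0 T x -> sweeping eps2 0 T y -> x 0 = y 0 ->
  (forall t, 0 <= t <= T -> `|x t - y t| <= C * (eps1 + eps2)) /\
  (forall s t, 0 <= s -> s <= t -> t <= T ->
     (1 - delta) * c * `|x t - y t - (x s - y s)|
       <= C * (eps1 + eps2) * (M t - M s) - (level_gap x y t - level_gap x y s)).
Proof.
set m := (1 - delta) * c; have m0 : 0 < m by rewrite mulr_gt0 // subr_gt0.
pose K := Cd + 3 * (kap * Cn); have K0 : 0 <= K by rewrite addr_ge0 // !mulr_ge0.
have MT0 : 0 <= M T - M 0 by rewrite subr_ge0 M_le // ltW.
pose C := expR (K / m * (M T - M 0)) * (2 * kap * (M T - M 0)) / m.
have C0 : 0 <= C.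
  by apply: divr_ge0 (ltW m0); rewrite mulr_ge0 ?expR_ge0 // mulr_ge0 // mulr_ge0.
exists (C + (K * C + 2 * kap)); first by rewrite addr_ge0 // addr_ge0 // mulr_ge0.
move=> eps1 eps2 x y e1 e2 xs ys xy0; have e0 : 0 <= eps1 + eps2 by exact: addr_ge0.
have xyC t : 0 <= t <= T -> `|x t - y t| <= C * (eps1 + eps2).
  move=> tT; have := sweeping_dist_le e1 e2 xs ys xy0 tT.
  rewrite -ler_pdivlMl // => /le_trans; apply; rewrite /C le_eqVlt; apply/orP; left; apply/eqP.
  by rewrite -/m -/K; ring.
split=> [t tT|s t s0 st tT].
  apply: le_trans (xyC t tT) _; rewrite ler_wpM2r // lerDl.
  by apply: addr_ge0; exact: mulr_ge0.
apply: le_trans (sweeping_diff_variation e1 e2 xs ys xyC s0 st tT) _.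
rewrite lerD2r ler_wpM2r ?subr_ge0 ?M_le // -/K.
have : 0 <= C * (eps1 + eps2) by rewrite mulr_ge0.
lra.
Qed.

Let sigma := (1 - delta) * c / 2.
Hypothesis step_rate_le : Cl / sigma <= kap.
Hypothesis level_decrease : forall t v d, 0 <= t <= T ->
  level t (v + d) <= level t v - ip (normal t v) d + delta * c * `|d| + Cq * `|d| ^+ 2.

Let sigma_gt0 : 0 < sigma. Proof. by rewrite divr_gt0 // mulr_gt0 // subr_gt0. Qed.

Lemma unit_descent t v p (r eta : R) : 0 <= t <= T -> c <= `|p| -> `|normal t v - p| <= eta ->
  0 <= r -> eta + Cq * r <= sigma -> level t (v + r *: (`|p|^-1 *: p)) <= level t v - sigma * r.
Proof.
move=> tT cp p_close r0 small; have p0 : 0 < `|p| by exact: lt_le_trans cp.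
set N := _ *: p; have N1 : `|N| = 1 by rewrite normrZ normfV normr_id mulVf ?gt_eqF.
have pN : ip p N = `|p| by rewrite (ipZr hX) (ipxx hX) expr2 mulKf // gt_eqF.
apply: le_trans (level_decrease v (r *: N) tT) _.
rewrite (ipZr hX) normrZ N1 mulr1 ger0_norm //.
have : r * (c - eta) <= r * ip (normal t v) N.
  rewrite ler_wpM2l //; have := ip_geN hX (normal t v - p) N.
  by rewrite N1 mulr1 (ipBl hX) pN; lra.
have : r * (eta + Cq * r) <= r * sigma by rewrite ler_wpM2l.
have : r * c = r * (delta * c) + 2 * (r * sigma) by rewrite /sigma; field.
lra.
Qed.

Lemma normal_dist_le s t v w o : 0 <= s <= T -> 0 <= t <= T -> `|M t - M s| <= o ->
  `|normal t v - normal s w| <= Cn * (`|v - w| + o).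
Proof.
wlog st : s t v w / s <= t => [close|/andP[s0 _] /andP[_ tT] Mo].
  have [|/ltW ts] := leP s t; first exact: close.
  by move=> sT tT; rewrite distrC => Mo; rewrite distrC [`|v - w|]distrC; exact: close.
apply: le_trans (normal_lip v w s0 st tT) _; rewrite ler_wpM2l // lerD2l.
by move: Mo; rewrite ger0_norm // subr_ge0 M_le.
Qed.

Section catching_up.
Variables (eps a b tau xmax : R) (v : X).
Hypothesis a_ge0 : 0 <= a.
Hypothesis b_le : b <= T.
Hypothesis tau_ab : a <= tau <= b.
Hypothesis xmax_ge0 : 0 <= xmax.
Hypothesis level_a : level a v <= 1.
Hypothesis level_tau : level tau v = 1.
Hypothesis M_xmax : M b - M a <= xmax.
Hypothesis M_sigma : Cl * (M b - M a) <= sigma * xmax.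
Hypothesis xmax_sigma : 2 * Cn * xmax + Cq * xmax <= sigma.
Hypothesis xmax_eps : 2 * Cn * xmax <= eps.

Let p := normal tau v.
Let N := `|p|^-1 *: p.
Let psi t (r : R) := level t (v + r *: N).

Let ab : a <= b. Proof. by case/andP: tau_ab => /le_trans; apply. Qed.

Let in0T t : a <= t <= b -> 0 <= t <= T.
Proof. by move=> /andP[at_ tb]; rewrite (le_trans a_ge0) // (le_trans tb). Qed.

Let p_ge : c <= `|p|. Proof. by apply: normal_ge => //; exact: in0T. Qed.
Let p_gt0 : 0 < `|p|. Proof. exact: lt_le_trans p_ge. Qed.

Let N1 : `|N| = 1. Proof. by rewrite normrZ normfV normr_id mulVf ?gt_eqF. Qed.

Let normal_close t (y : R) : a <= t <= b -> 0 <= y <= xmax ->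
  `|normal t (v + y *: N) - p| <= 2 * Cn * xmax.
Proof.
move=> tab /andP[y0 yx]; have /andP[at_ tb] := tab; have /andP[atau taub] := tau_ab.
have Mt : `|M t - M tau| <= xmax.
  have := M_le at_; have := M_le tb; have := M_le atau; have := M_le taub.
  by rewrite ler_norml => *; apply/andP; split; move: M_xmax; lra.
apply: le_trans (normal_dist_le _ _ (in0T tau_ab) (in0T tab) Mt) _.
have -> : v + y *: N - v = y *: N by lmod.
rewrite normrZ N1 mulr1 ger0_norm // (_ : 2 * Cn * xmax = Cn * (xmax + xmax)); last by ring.
by rewrite ler_wpM2l // lerD2r.
Qed.

Let psi_decrease t (y z : R) : a <= t <= b -> 0 <= y -> y <= z -> z <= xmax ->
  psi t z <= psi t y - sigma * (z - y).
Proof.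
move=> tab y0 yz zx; rewrite /psi.
have -> : v + z *: N = v + y *: N + (z - y) *: N by lmod.
have yx : 0 <= y <= xmax by rewrite y0 (le_trans yz).
apply: (unit_descent (in0T tab) p_ge (normal_close tab yx)); first by rewrite subr_ge0.
apply: le_trans xmax_sigma; rewrite lerD2l ler_wpM2l //; lra.
Qed.

Let psi_time s t (y : R) : a <= s -> s <= t -> t <= b -> psi t y <= psi s y + Cl * (M t - M s).
Proof.
move=> as_ st tb; have s0 := le_trans a_ge0 as_; have tT := le_trans tb b_le.
have := level_lip (v + y *: N) (v + y *: N) s0 st tT.
by rewrite subrr normr0 add0r ler_norml => /andP[_]; rewrite /psi; lra.
Qed.

Let psi_lip t (y z : R) : a <= t <= b -> psi t y <= psi t z + (Cl + 1) * `|y - z|.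
Proof.
move=> /in0T /andP[t0 tT]; have := level_lip (v + y *: N) (v + z *: N) t0 (lexx t) tT.
have -> : v + y *: N - (v + z *: N) = (y - z) *: N by lmod.
rewrite subrr addr0 normrZ N1 mulr1 ler_norml => /andP[_]; rewrite /psi.
have := normr_ge0 (y - z); lra.
Qed.

Let velocity_along_normal (r : R -> R) t (d : R) : a < t < b -> is_derive t 1 r d ->
  (forall s, t <= s -> s <= b -> r t <= r s) -> 0 <= r t <= xmax ->
  (psi t (r t) < 1 -> \forall s \near t^'+, r s = r t) ->
  velocity_rule eps t (v + r t *: N) (d *: N).
Proof.
move=> /andP[at_ tb] rd r_mono r_bd idle; split=> [/idle r_cst|active].
  have -> : d = 0; last by rewrite scale0r.
  apply/eqP; rewrite -normr_le0 -[leRHS](normr0 R).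
  apply: (is_derive1_norm_le rd (is_derive_cst (0 : R) t 1)).
  by apply: filterS r_cst => s ->; rewrite !subrr.
have d0 : 0 <= d.
  apply: (is_derive1_ge0 rd); near=> s; apply: r_mono; apply: ltW; near: s.
    exact: nbhs_right_gt.
  exact: nbhs_right_lt.
exists (d / `|p|), p; split.
- by rewrite divr_ge0.
- by rewrite distrC (le_trans _ xmax_eps) // normal_close ?(ltW at_) ?(ltW tb).
- by rewrite ler_wpM2l // divr_ge0.
- by rewrite scalerA.
Unshelve. all: by end_near.
Qed.

Lemma sweeping_along_normal : exists2 x, x a = v & sweeping eps a b x.
Proof.
have Cl1 : 0 < Cl + 1 by rewrite ltr_wpDl.
have psi_a : psi a 0 <= 1 by rewrite /psi scale0r addr0.
have Clsig : 0 <= Cl / sigma by rewrite divr_ge0 // ltW.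
have [r [ra r_bd r_inc psi_r r_idle]] := exists_ratchet sigma_gt0 Cl_ge0 Cl1 xmax_ge0
  (primitive_nondecreasing dphi) psi_decrease psi_time psi_lip psi_a M_sigma ab
  (primitive_continuous dphi).
have r_lip : lipschitz_wrt M a b (Cl / sigma) r.
  by move=> s t as_ st tb; have /andP[? ?] := r_inc s t as_ st tb; rewrite ger0_norm.
exists (fun t => v + r t *: N); first by rewrite ra scale0r addr0.
split=> [s t as_ st tb||].
- have -> : v + r t *: N - (v + r s *: N) = (r t - r s) *: N by lmod.
  by rewrite normrZ N1 mulr1 (le_trans (r_lip _ _ as_ st tb)) // ler_wpM2r // subr_ge0 M_le.
- exact: psi_r.
apply: filterS (lipschitz_wrt_derivable dphi ab Clsig r_lip) => t rd tab.
have /andP[/ltW at_ /ltW tb] := tab.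
have rD : is_derive t 1 r ('D_1 r t) by exact/derivableP/rd.
exists ('D_1 r t *: N).
  by have := is_deriveD (is_derive_cst v t 1) (is_derive1Zl N rD); rewrite add0r.
apply: velocity_along_normal => // [s ts sb||]; last 2 first.
- exact: r_bd.
- by apply: r_idle; rewrite at_ /=; case/andP: tab.
by have /andP[+ _] := r_inc t s at_ ts sb; rewrite subr_ge0.
Qed.

End catching_up.

Lemma level_crossing_time a b t v : 0 <= a -> a <= t <= b -> b <= T -> level a v <= 1 ->
  1 <= level t v -> exists2 tau, a <= tau <= b & level tau v = 1.
Proof.
move=> a0 /andP[at_ tb] bT va tv.
have v_lip : lipschitz_wrt M a t Cl (fun s => level s v).
  move=> r s ar rs st; have := level_lip v v (le_trans a0 ar) rs (le_trans st (le_trans tb bT)).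
  by rewrite subrr normr0 add0r.
have [|tau] := IVT at_ (lipschitz_wrt_continuous dphi Cl_ge0 v_lip) (v := 1).
  by rewrite ge_min va le_max tv orbT.
rewrite in_itv /= => /andP[atau taut] tau1; exists tau => //.
by rewrite atau (le_trans taut).
Qed.

Lemma sweeping_cst eps a b v : (forall t, a <= t <= b -> level t v <= 1) ->
  (forall t, a < t < b -> level t v < 1) -> sweeping eps a b (fun=> v).
Proof.
move=> v_le v_lt; split=> //.
  by move=> s t _ st _; rewrite subrr normr0 mulr_ge0 // subr_ge0 M_le.
apply: (filterS _ (lebesgue_ae_neq 0)) => t _ /v_lt tv.
by exists 0; [exact: is_derive_cst | split=> // tv1; rewrite tv1 ltxx in tv].
Qed.

Lemma catching_up eps : 0 < eps -> exists2 o, 0 < o & forall a b v,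
  0 <= a -> a <= b -> b <= T -> M b - M a <= o -> level a v <= 1 ->
  exists2 x, x a = v & sweeping eps a b x.
Proof.
move=> eps0; have D0 : 0 < 2 * Cn + Cq + 1 by rewrite ltr_wpDl // addr_ge0 // mulr_ge0.
pose xmax := Num.min sigma eps / (2 * Cn + Cq + 1).
have xmax0 : 0 < xmax by rewrite divr_gt0 // lt_min sigma_gt0.
have xmaxE : (2 * Cn + Cq + 1) * xmax = Num.min sigma eps by rewrite mulrC mulfVK ?gt_eqF.
have xsigma : (2 * Cn + Cq + 1) * xmax <= sigma by rewrite xmaxE ge_min lexx.
have xeps : (2 * Cn + Cq + 1) * xmax <= eps by rewrite xmaxE ge_min lexx orbT.
have Cn0 : 0 <= Cn * xmax by rewrite mulr_ge0 // ltW.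
have Cq0 : 0 <= Cq * xmax by rewrite mulr_ge0 // ltW.
have Cl1 : 0 < Cl + 1 by rewrite ltr_wpDl.
exists (Num.min xmax (sigma * xmax / (Cl + 1))).
  by rewrite lt_min xmax0 divr_gt0 // mulr_gt0.
move=> a b v a0 ab bT; rewrite le_min => /andP[Mx]; rewrite ler_pdivlMr // => Msig va.
have Mab : 0 <= M b - M a by rewrite subr_ge0 M_le.
have [[t tab tv]|free] := pselect (exists2 t, a <= t <= b & 1 <= level t v).
  have [tau tau_ab v1] := level_crossing_time a0 tab bT va tv.
  apply: (sweeping_along_normal a0 bT tau_ab (ltW xmax0) va v1 Mx); lra.
have v_lt t : a <= t <= b -> level t v < 1.
  by move=> tab; rewrite ltNge; apply/negP => tv; apply: free; exists t.
exists (fun=> v) => //; apply: sweeping_cst => t; first by move/v_lt/ltW.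
by move=> /andP[at_ tb]; apply: v_lt; rewrite !ltW.
Qed.

Lemma sweeping_cat eps a b e x y : a <= b -> b <= e -> x b = y b ->
  sweeping eps a b x -> sweeping eps b e y ->
  sweeping eps a e (fun t => if t <= b then x t else y t).
Proof.
move=> ab be xyb [xl x_le x_rule] [yl y_le y_rule]; set z := fun t => _.
have zx t : t <= b -> z t = x t by rewrite /z => ->.
have zy t : b <= t -> z t = y t.
  by rewrite /z le_eqVlt => /predU1P[<-|]; [rewrite lexx | rewrite leNgt => ->].
split=> [s t as_ st te|t /andP[at_ te]|].
- have [tb|/ltW bt] := leP t b; first by rewrite !zx ?(le_trans st) //; exact: xl.
  have [sb|/ltW bs] := leP s b; last by rewrite !zy //; exact: yl.
  have -> : z t - z s = (y t - y b) + (x b - x s) by rewrite (zx s) // (zy t) // xyb; lmod.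
  rewrite (le_trans (ler_normD _ _)) //.
  by have := yl b t (lexx b) bt te; have := xl s b as_ sb (lexx b); lra.
- have [tb|/ltW bt] := leP t b; first by rewrite zx // x_le // at_.
  by rewrite zy // y_le // bt.
apply: filterS3 x_rule y_rule (lebesgue_ae_neq b) => t xr yr; rewrite neq_lt.
move=> /orP[tb|bt] /andP[at_ te].
  rewrite zx ?(ltW tb) //; have [|d xd rd] := xr; first by rewrite at_.
  exists d => //; apply: near_eq_is_derive xd; near=> s; rewrite zx //.
  by apply: ltW; near: s; exact: lt_nbhsl.
rewrite zy ?(ltW bt) //; have [|d yd rd] := yr; first by rewrite bt.
exists d => //; apply: near_eq_is_derive yd; near=> s; rewrite zy //.
by apply: ltW; near: s; exact: lt_nbhsr.
Unshelve. all: by end_near.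
Qed.

Lemma exists_approximate_sweeping eps v : level 0 v <= 1 -> 0 < eps ->
  exists2 x, x 0 = v & sweeping eps 0 T x.
Proof.
move=> v_le /catching_up[r r0 step].
have [d d0 Md] := primitive_uniform_continuous dphi r0.
pose n := (Num.truncn (T / d)).+1; have n0 : (0 < n)%N by [].
have nR : 0 < n%:R :> R by rewrite ltr0n.
have Tnd : T / n%:R < d by rewrite ltr_pdivrMr // mulrC -ltr_pdivrMr // truncnS_gt.
suff on_node (k : nat) : (k <= n)%N -> exists2 x, x 0 = v & sweeping eps 0 (node T n k) x.
  by have := on_node n (leqnn n); rewrite node_last.
have node0 : node T n 0 = 0 by rewrite /node mul0r.
have node_ge0 (j : nat) : 0 <= node T n j by rewrite -[leLHS]node0 node_le.
elim: k => [_|k IH kn].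
  exists (fun=> v) => //; rewrite node0; apply: sweeping_cst => t.
    by move=> /le_anti <-.
  by move=> /andP[t0 /(lt_trans t0)]; rewrite ltxx.
have [x x0 xs] := IH (ltnW kn); have node_k := node_le T_gt0 n (leqnSn k).
have Mk : M (node T n k.+1) - M (node T n k) <= r by apply/ltW/Md => //; rewrite nodeS.
have node_T : node T n k.+1 <= T by rewrite -[leRHS](node_last T n0) node_le.
have [|y yx ys] := step _ _ (x (node T n k)) (node_ge0 k) node_k node_T Mk.
  by case: xs => _ x_le _; apply: x_le; rewrite node_ge0 lexx.
exists (fun t => if t <= node T n k then x t else y t); first by rewrite node_ge0.
exact: sweeping_cat.
Qed.

Section limit.
Variables (eps : nat -> R) (C : R) (xs : nat -> R -> X) (x : R -> X).
Hypothesis eps_gt0 : forall n, 0 < eps n.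
Hypothesis eps_cvg0 : eps n @[n --> \oo] --> (0 : R).
Hypothesis C_ge0 : 0 <= C.
Hypothesis xs_sweeping : forall n, sweeping (eps n) 0 T (xs n).
Hypothesis same_start : forall n, xs n 0 = x 0.
Hypothesis xs_dist : forall n t, 0 <= t <= T -> `|xs n t - x t| <= C * eps n.
Hypothesis xs_variation : forall n k s t, 0 <= s -> s <= t -> t <= T ->
  (1 - delta) * c * `|xs n t - xs k t - (xs n s - xs k s)|
    <= C * (eps n + eps k) * (M t - M s)
       - (level_gap (xs n) (xs k) t - level_gap (xs n) (xs k) s).

Let m := (1 - delta) * c.
Let m_gt0 : 0 < m. Proof. by rewrite mulr_gt0 // subr_gt0. Qed.

Let small_eps k e : 0 <= k -> 0 < e -> exists n0, forall n, (n0 <= n)%N -> k * eps n <= e.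
Proof.
move=> k0 e0; have : k * eps n @[n --> \oo] --> (0 : R).
  by rewrite -[X in _ --> X](mulr0 k); exact: cvgMl_tmp.
move=> /cvgrPdist_le /(_ e e0)[n0 _ small]; exists n0 => n n0n.
have := small n n0n; rewrite /= sub0r normrN ger0_norm // mulr_ge0 // ltW //.
Qed.

Let xs_cvg t : 0 <= t <= T -> xs n t @[n --> \oo] --> x t.
Proof.
move=> tT; apply/cvgrPdist_le => e /(small_eps C_ge0)[n0 small]; exists n0 => // n /= n0n.
by rewrite distrC (le_trans (xs_dist n tT)) // small.
Qed.

Let level_xs_dist n t : 0 <= t <= T -> level_gap (xs n) x t <= Cl * (C * eps n).
Proof.
move=> tT; have /andP[t0 tT'] := tT.
apply: le_trans (level_lip _ _ t0 (lexx t) tT') _.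
by rewrite subrr addr0 ler_wpM2l // xs_dist.
Qed.

Let level_gap_cvg n t : 0 <= t <= T ->
  level_gap (xs n) (xs j) t @[j --> \oo] --> level_gap (xs n) x t.
Proof.
move=> tT; apply: cvg_norm; apply: cvgB; first exact: cvg_cst.
apply/cvgrPdist_le => e /(small_eps (mulr_ge0 Cl_ge0 C_ge0))[n0 small]; exists n0 => // j /= n0j.
by rewrite distrC (le_trans (level_xs_dist j tT)) // mulrA small.
Qed.

Let limit_variation n s t : 0 <= s -> s <= t -> t <= T ->
  m * `|xs n t - x t - (xs n s - x s)|
    <= C * eps n * (M t - M s) - (level_gap (xs n) x t - level_gap (xs n) x s).
Proof.
move=> s0 st tT.
have sT : 0 <= s <= T by rewrite s0 (le_trans st).
have tT' : 0 <= t <= T by rewrite tT (le_trans s0).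
have lhs_cvg : m * `|xs n t - xs j t - (xs n s - xs j s)| @[j --> \oo]
    --> m * `|xs n t - x t - (xs n s - x s)|.
  apply: cvgMl_tmp; apply: cvg_norm.
  by apply: cvgB; apply: cvgB; [exact: cvg_cst|exact: xs_cvg|exact: cvg_cst|exact: xs_cvg].
have rhs_cvg : C * (eps n + eps j) * (M t - M s)
      - (level_gap (xs n) (xs j) t - level_gap (xs n) (xs j) s) @[j --> \oo]
    --> C * (eps n + 0) * (M t - M s) - (level_gap (xs n) x t - level_gap (xs n) x s).
  apply: cvgB; last by apply: cvgB; exact: level_gap_cvg.
  by apply: cvgMr_tmp; apply: cvgMl_tmp; apply: cvgD; [exact: cvg_cst|].
rewrite addr0 in rhs_cvg; apply: (ler_cvg_to lhs_cvg rhs_cvg).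
by near=> j; exact: xs_variation.
Unshelve. all: by end_near.
Qed.

Lemma limit_lip : lipschitz_wrt M 0 T kap x.
Proof.
move=> s t s0 st tT.
have xd : `|xs n t - xs n s| @[n --> \oo] --> `|x t - x s|.
  apply: cvg_norm; apply: cvgB; apply: xs_cvg.
    by rewrite (le_trans s0).
  by rewrite s0 (le_trans st).
apply: (ler_cvg_to xd (cvg_cst _)); near=> n.
by have [+ _ _] := xs_sweeping n; exact.
Unshelve. all: by end_near.
Qed.

Lemma limit_level_le t : 0 <= t <= T -> level t (x t) <= 1.
Proof.
move=> tT; apply/ler_addgt0Pr => e /(small_eps (mulr_ge0 Cl_ge0 C_ge0))[n small].
have [_ /(_ t tT) x_le _] := xs_sweeping n; have := small n (leqnn n).
rewrite -mulrA => /(le_trans (level_xs_dist n tT)); rewrite ler_norml => /andP[+ _]; lra.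
Qed.

Let h n t := C * eps n * M t - level_gap (xs n) x t.

Let h_increment n s t : 0 <= s -> s <= t -> t <= T ->
  m * `|xs n t - x t - (xs n s - x s)| <= h n t - h n s.
Proof.
move=> s0 st tT; apply: le_trans (limit_variation n s0 st tT) _.
by rewrite le_eqVlt; apply/orP; left; apply/eqP; rewrite /h; ring.
Qed.

Let h_nondecreasing n s t : 0 <= s -> s <= t -> t <= T -> h n s <= h n t.
Proof.
move=> s0 st tT; rewrite -subr_ge0; apply: le_trans (h_increment n s0 st tT).
by rewrite mulr_ge0 // ltW.
Qed.

Let h_lip n : lipschitz_wrt M 0 T (C * eps n + (Cl * (kap + 1) + Cl * (kap + 1))) (h n).
Proof.
have [xl _ _] := xs_sweeping n.
apply: lipschitz_wrtB => [s t _ st _|].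
  by rewrite -mulrBr ger0_norm ?mulr_ge0 ?subr_ge0 ?M_le // ltW.
by apply/lipschitz_wrt_norm/lipschitz_wrtB; apply: level_along_lip => //; exact: limit_lip.
Qed.

Let h_total : h n T - h n 0 @[n --> \oo] --> (0 : R).
Proof.
have eps_lim : eps n * (C * (M T - M 0)) @[n --> \oo] --> (0 : R).
  by rewrite -[X in _ --> X](mul0r (C * (M T - M 0))); exact: cvgMr_tmp.
apply: (squeeze_cvgr _ (cvg_cst 0) eps_lim); near=> n; apply/andP; split.
  by rewrite subr_ge0 h_nondecreasing // ltW.
rewrite /h /level_gap (same_start n) subrr normr0 subr0.
have := normr_ge0 (level T (xs n T) - level T (x T)); lra.
Unshelve. all: by end_near.
Qed.

(* The velocities of the approximations cannot be expected to converge at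
   every time, but they do so along a subsequence at almost every time. *)
Definition frequently_close_velocity t := forall e n0, 0 < e -> exists n d,
  [/\ (n0 <= n)%N, is_derive t 1 (xs n) d, velocity_rule (eps n) t (xs n t) d &
      \forall s \near t, `|xs n s - x s - (xs n t - x t)| <= e * `|s - t|].

Lemma ae_frequently_close_velocity :
  {ae mu, forall t : R, 0 < t < T -> frequently_close_velocity t}.
Proof.
have Lk n : 0 <= C * eps n + (Cl * (kap + 1) + Cl * (kap + 1)).
  by rewrite addr_ge0 ?mulr_ge0 ?addr_ge0 ?mulr_ge0 ?addr_ge0 // ltW.
have rules : {ae mu, forall (t : R) n, 0 < t < T ->
    exists2 d, is_derive t 1 (xs n) d & velocity_rule (eps n) t (xs n t) d}.
  by apply/ae_foralln => n; have [_ _] := xs_sweeping n.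
have := ae_frequently_small_derivative dphi (ltW T_gt0) Lk h_lip h_nondecreasing h_total.
apply: filterS2 rules => t rules small tT e n0 e0.
have me : 0 < m * e / 2 by rewrite divr_gt0 // mulr_gt0.
have [n [n0n [l hl /andP[l0 le]]]] := small tT _ n0 me.
have [d xd rd] := rules n tT; exists n, d; split=> //.
have /is_derive1P /(_ _ me) h_near := hl; have /andP[t0 tT'] := tT.
near=> s; have s0 : 0 <= s by apply: ltW; near: s; exact: lt_nbhsr.
have sT : s <= T by apply: ltW; near: s; exact: lt_nbhsl.
rewrite -(ler_pM2l m_gt0); apply: (@le_trans _ _ `|h n s - h n t|).
  have [st|/ltW ts] := leP s t.
    rewrite distrC [leRHS]distrC (le_trans (h_increment n s0 st (ltW tT'))) //; exact: ler_norm.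
  exact: le_trans (h_increment n (ltW t0) ts sT) (ler_norm _).
have -> : h n s - h n t = (h n s - h n t - (s - t) *: l) + (s - t) *: l by rewrite subrK.
rewrite (le_trans (ler_normD _ _)) // normrZ (ger0_norm l0).
have : `|h n s - h n t - (s - t) *: l| <= m * e / 2 * `|s - t| by near: s.
have : `|s - t| * l <= `|s - t| * (m * e / 2) by rewrite ler_wpM2l.
lra.
Unshelve. all: by end_near.
Qed.

Lemma limit_derivable t : frequently_close_velocity t -> derivable x t 1.
Proof.
move=> close; apply: derivable1_approx => e e0; have e2 : 0 < e / 2 by rewrite divr_gt0.
have [n [d [_ /is_derive1P /(_ _ e2) xd _ near_x]]] := close _ 0%N e2; exists d.
apply: filterS2 xd near_x => s xd near_x.
have -> : x s - x t - (s - t) *: d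
    = (xs n s - xs n t - (s - t) *: d) - (xs n s - x s - (xs n t - x t)) by lmod.
by rewrite (le_trans (ler_normB _ _)) //; lra.
Qed.

Lemma frequently_close_derivative t e n0 D : frequently_close_velocity t -> 0 < e ->
  is_derive t 1 x D -> exists n d,
    [/\ (n0 <= n)%N, `|d - D| <= e & velocity_rule (eps n) t (xs n t) d].
Proof.
move=> close e0 xD; have [n [d [n0n xd rd near_x]]] := close e n0 e0; exists n, d; split=> //.
have dB : is_derive t 1 (fun s => xs n s - x s) (d - D) by exact: is_deriveB.
have dE : is_derive t 1 (fun s => e * s) (e * 1) by apply: is_deriveZ; exact: is_derive_id.
rewrite -[leRHS](gtr0_norm e0) -[in leRHS](mulr1 e); apply: (is_derive1_norm_le dB dE).
by apply: cvg_within; apply: filterS near_x => s; rewrite -mulrBr normrM (gtr0_norm e0).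
Qed.

Lemma limit_velocity_rule t D : 0 < t < T -> frequently_close_velocity t ->
  is_derive t 1 x D -> velocity_rule 0 t (x t) D.
Proof.
move=> /andP[t0 tT'] close xD; have tT : 0 <= t <= T by rewrite !ltW.
split=> x1.
  apply/eqP; rewrite -normr_le0; apply/ler_addgt0Pr => e e0; rewrite add0r.
  have gap : 0 < (1 - level t (x t)) / 2 by rewrite divr_gt0 // subr_gt0.
  have [n0 small] := small_eps (mulr_ge0 Cl_ge0 C_ge0) gap.
  have [n [d [/small + dD [free _]]]] := frequently_close_derivative n0 close e0 xD.
  rewrite -mulrA => /(le_trans (level_xs_dist n tT)); rewrite ler_norml => /andP[_ near1].
  by move: dD; rewrite free ?sub0r ?normrN //; lra.
have p0 : normal t (x t) != 0.
  by rewrite -normr_gt0; apply: lt_le_trans (normal_ge tT x1).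
have [|a a0 ->] := near_ray_closed hX (c := c) (p := normal t (x t)) (d := D) c_gt0 p0.
  move=> e e0; have [n1 small1] := small_eps ler01 e0.
  have [n2 small2] := small_eps (mulr_ge0 Cn_ge0 C_ge0) e0.
  have [n [d [+ dD [free active]]]] := frequently_close_derivative (maxn n1 n2) close e0 xD.
  rewrite geq_max => /andP[/small1 eps_e /small2 Ceps_e]; rewrite mul1r in eps_e.
  exists (normal t (xs n t)), d, (eps n); split=> //.
    apply: le_trans Ceps_e; rewrite -mulrA.
    apply: le_trans (normal_lip _ _ (ltW t0) (lexx t) (ltW tT')) _.
    by rewrite subrr addr0 ler_wpM2l // xs_dist.
  have [_ /(_ t tT)] := xs_sweeping n; rewrite le_eqVlt => /predU1P[/active //|/free ->] _.
  by apply: near_ray0; exact: ltW.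
by exists a, (normal t (x t)); rewrite subrr normr0 ler_wpM2l // normal_ge.
Qed.

Lemma limit_sweeping : sweeping 0 0 T x.
Proof.
split; [exact: limit_lip | exact: limit_level_le |].
apply: filterS ae_frequently_close_velocity => t close tT.
exists ('D_1 x t); first exact/derivableP/limit_derivable/close.
by apply: limit_velocity_rule (close tT) _ => //; exact/derivableP/limit_derivable/close.
Qed.

End limit.

Lemma sweeping_exists v : level 0 v <= 1 -> exists2 x, x 0 = v & sweeping 0 0 T x.
Proof.
move=> v_le; have [C C0 comparison] := sweeping_comparison.
have eps_gt0 n : 0 < harmonic n :> R by rewrite invr_gt0.
have /choice[xs xsP] n : exists x, x 0 = v /\ sweeping (harmonic n) 0 T x.
  by have [x x0 xs] := exists_approximate_sweeping v_le (eps_gt0 n); exists x.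
have xs_start n k : xs n 0 = xs k 0 by rewrite (xsP n).1 (xsP k).1.
have cmp n k := comparison _ _ _ _ (ltW (eps_gt0 n)) (ltW (eps_gt0 k))
  (xsP n).2 (xsP k).2 (xs_start n k).
have /choice[x xs_dist] t : exists l, 0 <= t <= T -> forall n, `|xs n t - l| <= C * harmonic n.
  have [tT|tT] := boolP (0 <= t <= T); last by exists 0.
  have [l xl] := cauchy_rate_limit cvg_harmonic (fun n k => (cmp n k).1 t tT).
  by exists l.
have x0 : x 0 = v.
  have T0 : (0 : R) <= 0 <= T by rewrite lexx ltW.
  apply/eqP; rewrite -subr_eq0 -normr_le0 distrC.
  have Ch : C * harmonic n @[n --> \oo] --> (0 : R).
    by rewrite -[X in _ --> X](mulr0 C); apply: cvgMl_tmp; exact: cvg_harmonic.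
  apply: (ler_cvg_to (cvg_cst _) Ch); near=> n.
  by rewrite -(xsP n).1; exact: xs_dist.
exists x => //; apply: (limit_sweeping eps_gt0 cvg_harmonic C0 (fun n => (xsP n).2)).
- by move=> n; rewrite (xsP n).1.
- by move=> n t tT; exact: xs_dist.
by move=> n k; exact: (cmp n k).2.
Unshelve. all: by end_near.
Qed.

Lemma sweeping_unique x y : sweeping 0 0 T x -> sweeping 0 0 T y -> x 0 = y 0 ->
  forall t, 0 <= t <= T -> x t = y t.
Proof.
move=> xs ys xy0 t tT; have [C C0 comparison] := sweeping_comparison.
have [/(_ t tT) + _] := comparison 0 0 x y (lexx 0) (lexx 0) xs ys xy0.
by rewrite addr0 mulr0 normr_le0 subr_eq0 => /eqP.
Qed.

End sweeping.

(** * The state-dependent process *)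

Section chain_rule.
Context {R : realType}.
Implicit Types V W : normedModType R.

Lemma is_derive_line V W (F : V -> W) (x y : V) (s : R) d :
  is_derive (x + s *: y) y F d -> is_derive s 1 (fun r => F (x + r *: y)) d.
Proof.
have quotE : (fun h : R =>
      h^-1 *: (((fun r => F (x + r *: y)) \o shift s) (h *: 1) - F (x + s *: y)))
    = (fun h => h^-1 *: ((F \o shift (x + s *: y)) (h *: y) - F (x + s *: y))).
  apply/funext => h /=; congr (_ *: (F _ - _)).
  by rewrite [h *: 1]mulr1; lmod.
by move=> [Fd <-]; apply: DeriveDef; rewrite /derivable /derive quotE.
Qed.

Lemma is_derive1_linear V W (A : V -> W) K (x : R -> V) (t : R) d : linear A ->
  (forall v, `|A v| <= K * `|v|) -> is_derive t 1 x d ->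
  is_derive t 1 (fun s => A (x s)) (A d).
Proof.
move=> A_lin A_le /is_derive1P xd; apply/is_derive1P => e e0.
have A_sub v w (k : R) : A (v - k *: w) = A v - k *: A w.
  by rewrite addrC -scaleNr A_lin scaleNr addrC.
have K1 : 0 < `|K| + 1 by rewrite ltr_wpDl.
have /xd : 0 < e / (`|K| + 1) by rewrite divr_gt0.
apply: filterS => s xs.
have -> : A (x s) - A (x t) - (s - t) *: A d = A (x s - x t - (s - t) *: d).
  by rewrite A_sub -[x t in RHS]scale1r A_sub scale1r.
rewrite (le_trans (A_le _)) // (@le_trans _ _ ((`|K| + 1) * `|x s - x t - (s - t) *: d|)) //.
  by rewrite ler_wpM2r // (le_trans (ler_norm K)) // lerDl.
by rewrite -ler_pdivlMl // mulrA [_^-1 * e]mulrC.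
Qed.

Lemma is_derive1_quadratic V (f h : R -> V) K (t : R) d : is_derive t 1 h d ->
  (\forall s \near t, `|f s - f t - (h s - h t)| <= K * `|s - t| ^+ 2) -> is_derive t 1 f d.
Proof.
move=> /is_derive1P hd fh; apply/is_derive1P => e e0.
have e2 : 0 < e / 2 by rewrite divr_gt0.
have K1 : 0 < `|K| + 1 by rewrite ltr_wpDl.
near=> s; have fhs : `|f s - f t - (h s - h t)| <= K * `|s - t| ^+ 2 by near: s.
have hs : `|h s - h t - (s - t) *: d| <= e / 2 * `|s - t| by near: s; exact: hd.
have st : `|s - t| * (`|K| + 1) <= e / 2.
  rewrite -ler_pdivlMr // ltW //; near: s; apply/nbhs_ballP.
  by exists (e / 2 / (`|K| + 1)); [exact: divr_gt0 | move=> s; rewrite /ball /= distrC].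
have -> : f s - f t - (s - t) *: d = (f s - f t - (h s - h t)) + (h s - h t - (s - t) *: d) by lmod.
rewrite (le_trans (ler_normD _ _)) //.
have : `|s - t| * (`|K| + 1) * `|s - t| <= e / 2 * `|s - t| by rewrite ler_wpM2r.
have : K * `|s - t| ^+ 2 <= `|K| * `|s - t| ^+ 2 by rewrite ler_wpM2r ?sqr_ge0 ?ler_norm.
have := sqr_ge0 `|s - t|; lra.
Unshelve. all: by end_near.
Qed.

End chain_rule.

Section gradients.
Context {R : realType} {X W : normedModType R}.
Variables (ip : X -> X -> R) (G : X -> W -> R) (gx : X -> W -> X) (gw : X -> W -> W -> R).
Variables (K0 K1 C0 C1 : R).
Hypothesis hX : hilbert_inner ip.
Hypothesis grad_x : is_grad_x ip G gx.
Hypothesis grad_w : is_grad_w G gw.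
Hypothesis C0_gt0 : 0 < C0.
Hypothesis C1_gt0 : 0 < C1.
Hypothesis gx_le : forall x w, `|gx x w| <= K0.
Hypothesis gw_le : forall x w k, `|gw x w k| <= K1 * `|k|.
Hypothesis gx_lip : forall x w x' w', `|gx x w - gx x' w'| <= C0 * (`|x - x'| + `|w - w'|).
Hypothesis gw_lip : forall x w x' w' k,
  `|gw x w k - gw x' w' k| <= C1 * (`|x - x'| + `|w - w'|) * `|k|.
Implicit Types (x h : X) (w k : W) (s t : R).

Lemma gw_linear x w : linear (gw x w : W -> R).
Proof. by have [gw_lin _ _] := grad_w x w; exact: gw_lin. Qed.

Lemma gwB x w k k' : gw x w (k - k') = gw x w k - gw x w k'.
Proof. by rewrite addrC -scaleN1r gw_linear scaleN1r addrC. Qed.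

Lemma gw_dist_le x w x' w' k k' : `|gw x w k - gw x' w' k'|
  <= C1 * (`|x - x'| + `|w - w'|) * `|k| + K1 * `|k - k'|.
Proof.
have -> : gw x w k - gw x' w' k' = (gw x w k - gw x' w' k) + gw x' w' (k - k').
  by rewrite gwB addrA subrK.
by rewrite (le_trans (ler_normD _ _)) // lerD.
Qed.

Lemma is_derive_grad_x w x h s :
  is_derive s 1 (fun s => G (x + s *: h) w) (ip (gx (x + s *: h) w) h).
Proof.
apply: (@is_derive_line _ X R (G^~ w)).
have quotE : (fun r : R => r^-1 *: ((G^~ w \o shift (x + s *: h)) (r *: h) - G (x + s *: h) w))
    = (fun r => r^-1 * (G (x + s *: h + r *: h) w - G (x + s *: h) w)).
  by apply/funext => r /=; rewrite [r *: h + _]addrC.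
have : (fun r : R => r^-1 * (G (x + s *: h + r *: h) w - G (x + s *: h) w)) @ 0^'
    --> ip (gx (x + s *: h) w) h by exact: grad_x.
rewrite -quotE => q_cvg.
by apply: DeriveDef; [exact: cvgP q_cvg | exact: cvg_lim q_cvg].
Qed.

Lemma is_derive_grad_w x w k s :
  is_derive s 1 (fun s => G x (w + s *: k)) (gw x (w + s *: k) k).
Proof.
apply: (@is_derive_line _ W R (G x)).
have quotE : (fun r : R => r^-1 *: ((G x \o shift (w + s *: k)) (r *: k) - G x (w + s *: k)))
    = (fun r => r^-1 * (G x (w + s *: k + r *: k) - G x (w + s *: k))).
  by apply/funext => r /=; rewrite [r *: k + _]addrC.
have : (fun r : R => r^-1 * (G x (w + s *: k + r *: k) - G x (w + s *: k))) @ 0^'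
    --> gw x (w + s *: k) k by have [_ _] := grad_w x (w + s *: k); exact.
rewrite -quotE => q_cvg.
by apply: DeriveDef; [exact: cvgP q_cvg | exact: cvg_lim q_cvg].
Qed.

Lemma grad_x_lip x x' w : `|G x' w - G x w| <= K0 * `|x' - x|.
Proof.
have := @segment_mean_value_ineq R X R (G^~ w) x (x' - x) _ (fun s _ => is_derive_grad_x w x _ s).
rewrite subrKC; apply=> s _.
by rewrite (le_trans (cauchy_schwarz hX _ _)) // ler_wpM2r.
Qed.

Lemma grad_w_lip x w w' : `|G x w' - G x w| <= K1 * `|w' - w|.
Proof.
have := @segment_mean_value_ineq R W R (G x) w (w' - w) _ (fun s _ => is_derive_grad_w x w _ s).
by rewrite subrKC; apply=> s _; exact: gw_le.
Qed.

Lemma grad_x_level_lip w x x' : `|gx x w - gx x' w| <= C0 * `|x - x'|.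
Proof. by have := gx_lip x w x' w; rewrite subrr normr0 addr0. Qed.

Lemma grad_w_taylor x w k : `|G x (w + k) - G x w - gw x w k| <= C1 * `|k| ^+ 2.
Proof.
apply: (segment_taylor (fun s _ => is_derive_grad_w x w k s)) => s /andP[s0 s1].
rewrite (le_trans (gw_lip _ _ _ _ _)) // expr2 mulrA ler_wpM2r // subrr normr0 add0r ler_pM2l //.
by rewrite addrC addKr normrZ ger0_norm // ler_piMl.
Qed.

Lemma grad_taylor x w h k : `|G (x + h) (w + k) - G x w - (ip (gx x w) h + gw x w k)|
  <= (C0 + C1) * (`|h| + `|k|) ^+ 2.
Proof.
have tx := @level_taylor R X ip (G^~ (w + k)) (gx^~ (w + k)) C0 hX C0_gt0
  (is_derive_grad_x (w + k)) (grad_x_level_lip (w + k)) x h.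
have tw := grad_w_taylor x w k.
have cross : `|ip (gx x (w + k) - gx x w) h| <= C0 * `|k| * `|h|.
  rewrite (le_trans (cauchy_schwarz hX _ _)) // ler_wpM2r // (le_trans (gx_lip _ _ _ _)) //.
  by rewrite subrr normr0 add0r addrAC subrr add0r.
have -> : G (x + h) (w + k) - G x w - (ip (gx x w) h + gw x w k)
  = (G (x + h) (w + k) - G x (w + k) - ip (gx x (w + k)) h)
    + (G x (w + k) - G x w - gw x w k) + ip (gx x (w + k) - gx x w) h.
  by rewrite (ipBl hX); ring.
apply: le_trans (ler_normD _ _) _.
apply: le_trans (lerD (le_trans (ler_normD _ _) (lerD tx tw)) cross) _.
have hk : 0 <= `|h| * `|k| by rewrite mulr_ge0.
have : 0 <= C0 * (`|h| * `|k| + `|k| ^+ 2) by rewrite mulr_ge0 ?addr_ge0 ?sqr_ge0 // ltW.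
have : 0 <= C1 * (2 * (`|h| * `|k|) + `|h| ^+ 2).
  by rewrite mulr_ge0 ?addr_ge0 ?mulr_ge0 ?sqr_ge0 // ltW.
lra.
Qed.

Lemma grad_chain (x : R -> X) (w : R -> W) t x' w' : is_derive t 1 x x' -> is_derive t 1 w w' ->
  is_derive t 1 (fun s => G (x s) (w s)) (ip (gx (x t) (w t)) x' + gw (x t) (w t) w').
Proof.
move=> xd wd; set p := gx _ _; set q := gw _ _.
have ipd : is_derive t 1 (fun s => ip p (x s)) (ip p x').
  apply: (@is_derive1_linear _ X R (ip p) `|p|) => // [a h h'|h]; first by rewrite !(ipE hX).
  exact: cauchy_schwarz.
have qd : is_derive t 1 (fun s => q (w s)) (q w').
  by apply: (@is_derive1_linear _ W R q K1) => //; [exact: gw_linear | exact: gw_le].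
pose k := (`|x'| + 1) + (`|w'| + 1).
apply: (is_derive1_quadratic (K := (C0 + C1) * k ^+ 2) (is_deriveD ipd qd)).
have xl := is_derive1_lipschitz xd; have wl := is_derive1_lipschitz wd; near=> s.
have xs : `|x s - x t| <= (`|x'| + 1) * `|s - t| by near: s.
have ws : `|w s - w t| <= (`|w'| + 1) * `|s - t| by near: s.
have := grad_taylor (x t) (w t) (x s - x t) (w s - w t); rewrite !subrKC /=.
have -> : ip p (x s) + q (w s) - (ip p (x t) + q (w t)) = ip p (x s - x t) + q (w s - w t).
  by rewrite (ipBr hX) /q gwB; ring.
move=> /le_trans; apply; rewrite -mulrA -exprMn ler_pM2l ?addr_gt0 //.
by rewrite ler_pXn2r ?nnegrE ?addr_ge0 ?mulr_ge0 ?addr_ge0 // mulrDl lerD.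
Unshelve. all: by end_near.
Qed.

End gradients.

Section time_interval.
Context {R : realType}.
Local Notation mu := (@lebesgue_measure R).
Implicit Types (V : normedModType R) (T K e s t : R) (psi : R -> R).

Lemma within_continuous_ae_le V (f : R -> V) T K : 0 < T ->
  {within `[0, T]%classic, continuous f} ->
  {ae mu, forall t, 0 < t < T -> `|f t| <= K} -> forall t, 0 <= t <= T -> `|f t| <= K.
Proof.
move=> T0 /subspace_continuousP fc fK t tT; apply/ler_addgt0Pr => e e0.
have /cvgrPdist_le /(_ e e0) : f s @[s --> within `[0, T]%classic (nbhs t)] --> f t.
  by apply: fc; rewrite /= in_itv.
rewrite near_withinE => /nbhs_ballP[r /= r0 fr]; have /andP[t0 tT'] := tT.
have : Num.max 0 (t - r) < Num.min T (t + r).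
  by rewrite gt_max !lt_min; apply/andP; split; apply/andP; split; lra.
move=> /(ae_exists_itv fK)[s]; rewrite gt_max lt_min => /andP[/andP[s0 s1] /andP[sT s2]] fs.
have fts : `|f t - f s| <= e.
  apply: fr; last by rewrite /= in_itv /= !ltW.
  by rewrite /ball /= ltr_distl; apply/andP; split; lra.
have := fs; rewrite s0 sT => /(_ isT) {}fs.
by have := ler_normD (f t - f s) (f s); rewrite subrK; lra.
Qed.

Lemma within_continuous_increment_le V (f : R -> V) s t K : s < t ->
  {within `[s, t]%classic, continuous f} ->
  (forall x y, s < x -> x <= y -> y < t -> `|f y - f x| <= K) -> `|f t - f s| <= K.
Proof.
move=> st /(continuous_within_itvP _ st)[_ f_s f_t] fK.
have norm_at_t : `|f y - f s| @[y --> t^'-] --> `|f t - f s|.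
  by apply: cvg_norm; apply: cvgB => //; exact: cvg_cst.
apply: (ler_cvg_to norm_at_t (cvg_cst K)); near=> y.
have yt : y < t by near: y; exact: nbhs_left_lt.
have sy : s < y by near: y; exact: nbhs_left_gt.
have norm_at_s : `|f y - f x| @[x --> s^'+] --> `|f y - f s|.
  by apply: cvg_norm; apply: cvgB => //; exact: cvg_cst.
apply: (ler_cvg_to norm_at_s (cvg_cst K)); near=> x; apply: fK => //.
by apply: ltW; near: x; exact: nbhs_right_lt.
Unshelve. all: by end_near.
Qed.

Lemma derivable_increment_le V (f : R -> V) T psi : density psi ->
  {within `[0, T]%classic, continuous f} -> (forall t, 0 < t < T -> derivable f t 1) ->
  {ae mu, forall t, 0 < t < T -> `|'D_1 f t| <= psi t} ->
  forall s t, 0 <= s -> s <= t -> t <= T -> `|f t - f s| <= primitive psi t - primitive psi s.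
Proof.
move=> dpsi fc fd f_le s t s0; rewrite le_eqVlt => /predU1P[->|st tT].
  by rewrite !subrr normr0.
have P_le := primitive_nondecreasing dpsi.
apply: within_continuous_increment_le => // [|x y sx xy yt].
  apply: continuous_subspaceW fc => r /=; rewrite !in_itv /= => /andP[sr rt].
  by rewrite (le_trans s0) // (le_trans rt).
have inT r : x <= r <= y -> 0 < r < T.
  move=> /andP[xr ry]; apply/andP; split.
    exact: (le_lt_trans s0 (lt_le_trans sx xr)).
  exact: (lt_le_trans (le_lt_trans ry yt) tT).
apply: (@le_trans _ _ (primitive psi y - primitive psi x)); last first.
  by apply: lerB; apply: P_le; exact: ltW.
apply: null_variation_increment_le => //.
  by apply: derivable_null_variation => // r /inT; exact: fd.
apply: filterS f_le => r f_le /andP[xr ry]; have rT : 0 < r < T by apply: inT; rewrite !ltW.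
by exists ('D_1 f r); [exact/derivableP/fd | exact: f_le].
Qed.

Definition abs_restrict T (f : R -> R) t : R := `|(f \_ `[0, T]) t|.

Lemma abs_restrict_ge T f t : 0 <= t <= T -> f t <= abs_restrict T f t.
Proof. by move=> tT; rewrite /abs_restrict patchE mem_set ?ler_norm //= in_itv. Qed.

Lemma density_abs_restrict T f : L1 T f -> density (abs_restrict T f).
Proof.
move=> If; split=> [|t]; last exact: normr_ge0.
have := integrable_abse (integrable_patch (measurable_itv `[0, T]) If).
by rewrite /integrableT; congr (_.-integrable _ _); apply/funext => t.
Qed.

End time_interval.

Section moving_constraint.
Context {R : realType} {X W : normedModType R}.
Local Notation mu := (@lebesgue_measure R).
Variables (T : R) (g : R -> X -> X -> W) (a b : R -> R) (gam om Cxi Cu : R).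
Hypothesis T_gt0 : 0 < T.
Hypothesis hg : hypg T g a b gam om Cxi Cu.
Implicit Types (s t : R) (u v xi eta du dxi : X).

Definition regular_time t := forall u v xi eta,
  [/\ [/\ forall h, `|'d (g t u) xi h| <= gam * `|h|,
          forall h, `|'d (fun u' => g t u' xi) u h| <= om * `|h| &
          `|'D_1 (fun s => g s u xi) t| <= a t],
      forall h, `|'d (g t u) xi h - 'd (g t v) eta h|
                  <= Cxi * (`|u - v| + `|xi - eta|) * `|h|,
      forall h, `|'d (fun u' => g t u' xi) u h - 'd (fun u' => g t u' eta) v h|
                  <= Cu * (`|u - v| + `|xi - eta|) * `|h| &
      `|'D_1 (fun s => g s u xi) t - 'D_1 (fun s => g s v eta) t|
        <= b t * (`|u - v| + `|xi - eta|)].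

Lemma ae_regular_time : {ae mu, forall t, 0 < t < T -> regular_time t}.
Proof.
have [_ _ _ _ reg] := hg; apply: filterS reg => t reg tT.
by apply: reg; rewrite /= in_itv.
Qed.

Lemma is_derive_xi_line t u xi h (s : R) : 0 <= t <= T ->
  is_derive s 1 (fun s => g t u (xi + s *: h)) ('d (g t u) (xi + s *: h) h).
Proof.
move=> tT; have [_ dg _ _ _] := hg.
have := dg t u (xi + s *: h); rewrite /= in_itv /= => /(_ tT)[dgx _].
apply: (@is_derive_line _ X W (g t u)); rewrite -deriveE //.
exact/derivableP/diff_derivable.
Qed.

Lemma is_derive_u_line t u xi h (s : R) : 0 <= t <= T ->
  is_derive s 1 (fun s => g t (u + s *: h) xi) ('d (fun u' => g t u' xi) (u + s *: h) h).
Proof.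
move=> tT; have [_ dg _ _ _] := hg.
have := dg t (u + s *: h) xi; rewrite /= in_itv /= => /(_ tT)[_ dgu].
apply: (@is_derive_line _ X W (fun u' => g t u' xi)); rewrite -deriveE //.
exact/derivableP/diff_derivable.
Qed.

Lemma within_continuous_g u xi : {within `[0, T]%classic, continuous (fun t => g t u xi)}.
Proof.
have [/subspace_continuousP g_cont _ _ _ _] := hg; apply/subspace_continuousP => t tT.
have tA : (`[0, T]%classic `*` setT `*` setT) (t, u, xi) by [].
apply/cvgrPdist_le => e e0; have /cvgrPdist_le /(_ e e0) := g_cont _ tA.
rewrite near_withinE => /nbhs_ballP[r /= r0 near_g]; rewrite near_withinE.
apply/nbhs_ballP; exists r => // s ts sT; apply: (near_g (s, u, xi)) => //.
by split; [split|] => //; exact: ballxx.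
Qed.

Let g_diff_ae_le u v xi eta K :
  (forall t, 0 < t < T -> regular_time t -> `|g t u xi - g t v eta| <= K) ->
  forall t, 0 <= t <= T -> `|g t u xi - g t v eta| <= K.
Proof.
move=> gK; apply: within_continuous_ae_le => //; last first.
  by apply: filterS ae_regular_time => t reg tT; apply: gK => //; exact: reg.
by move=> t; apply: continuousB; exact: within_continuous_g.
Qed.

(* The bounds on the partial derivatives are only assumed at almost every time,
   but the resulting Lipschitz estimates extend to all times by continuity. *)
Lemma constraint_lip_xi t u xi eta : 0 <= t <= T -> `|g t u eta - g t u xi| <= gam * `|eta - xi|.
Proof.
apply: g_diff_ae_le => {}t /andP[t0 tT] reg.
have t0T : 0 <= t <= T by rewrite !ltW.
have := @segment_mean_value_ineq R X W (g t u) xi (eta - xi) _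
  (fun s _ => is_derive_xi_line u xi _ s t0T).
by rewrite subrKC; apply=> s _; have [[+ _ _] _ _ _] := reg u u (xi + s *: (eta - xi)) xi.
Qed.

Lemma constraint_lip_u t u v xi : 0 <= t <= T -> `|g t v xi - g t u xi| <= om * `|v - u|.
Proof.
apply: g_diff_ae_le => {}t /andP[t0 tT] reg.
have t0T : 0 <= t <= T by rewrite !ltW.
have := @segment_mean_value_ineq R X W (fun u' => g t u' xi) u (v - u) _
  (fun s _ => is_derive_u_line u xi _ s t0T).
by rewrite subrKC; apply=> s _; have [[_ + _] _ _ _] := reg (u + s *: (v - u)) u xi xi.
Qed.

Lemma is_derive_time t u xi : 0 < t < T ->
  is_derive t 1 (fun s => g s u xi) ('D_1 (fun s => g s u xi) t).
Proof.
by move=> tT; have [_ _ dt _ _] := hg; apply/derivableP/dt; rewrite /= in_itv.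
Qed.

Lemma constraint_time_increment u xi s t : 0 <= s -> s <= t -> t <= T ->
  `|g t u xi - g s u xi| <= primitive (abs_restrict T a) t - primitive (abs_restrict T a) s.
Proof.
have [_ _ _ [La _ _] _] := hg.
apply: (derivable_increment_le (T := T) (f := fun s => g s u xi)).
- exact: density_abs_restrict.
- exact: within_continuous_g.
- by move=> r /(is_derive_time u xi)[].
apply: filterS ae_regular_time => r reg rT; have /andP[r0 rT'] := rT.
have [[_ _ g_le] _ _ _] := reg rT u u xi xi; rewrite (le_trans g_le) //.
by apply: abs_restrict_ge; rewrite !ltW.
Qed.

Lemma constraint_diff_time_increment u v xi eta s t : 0 <= s -> s <= t -> t <= T ->
  `|g t u xi - g t v eta - (g s u xi - g s v eta)|
    <= (`|u - v| + `|xi - eta|)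
       * (primitive (abs_restrict T b) t - primitive (abs_restrict T b) s).
Proof.
have [_ _ _ [_ Lb _] _] := hg; have db := density_abs_restrict Lb.
set k := `|u - v| + _; have k0 : 0 <= k by exact: addr_ge0.
have diffd r : 0 < r < T -> is_derive r 1 (fun s => g s u xi - g s v eta)
    ('D_1 (fun s => g s u xi) r - 'D_1 (fun s => g s v eta) r).
  by move=> rT; apply: is_deriveB; exact: is_derive_time.
move=> s0 st tT; rewrite mulrBr -!primitiveZ; [|exact: db.1|exact: db.1].
apply: (derivable_increment_le (T := T) (f := fun s => g s u xi - g s v eta)) => //.
- exact: densityZ.
- by move=> r; apply: continuousB; exact: within_continuous_g.
- by move=> r /diffd[].
apply: filterS ae_regular_time => r reg rT; have [_ ->] := diffd r rT.
have [_ _ _ g_le] := reg rT u v xi eta; rewrite (le_trans g_le) // mulrC ler_wpM2l //.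
by have /andP[r0 rT'] := rT; apply: abs_restrict_ge; rewrite !ltW.
Qed.

Lemma constraint_taylor t v v' z z' : 0 < t < T -> regular_time t ->
  `|g t v' z' - g t v z - ('d (fun u' => g t u' z) v (v' - v) + 'd (g t v) z (z' - z))|
   <= (Cxi + Cu) * (`|v' - v| + `|z' - z|) ^+ 2.
Proof.
move=> /andP[t0 tT] reg; have t0T : 0 <= t <= T by rewrite !ltW.
have [_ _ _ [_ _ [_ _ Cxi0 Cu0]] _] := hg.
set A := `|v' - v|; set B := `|z' - z|.
have taylor_xi : `|g t v' z' - g t v' z - 'd (g t v) z (z' - z)| <= Cxi * (A + B) * B.
  have := @segment_taylor R X W (g t v') z (z' - z) _
    (fun s _ => is_derive_xi_line v' z _ s t0T) ('d (g t v) z (z' - z)) (Cxi * (A + B) * B).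
  rewrite subrKC; apply=> s /andP[s0 s1].
  have [_ dxi_lip _ _] := reg v' v (z + s *: (z' - z)) z; rewrite (le_trans (dxi_lip _)) //.
  rewrite ler_wpM2r // ler_pM2l // lerD2l addrC addKr normrZ ger0_norm //.
  by rewrite ler_piMl.
have taylor_u : `|g t v' z - g t v z - 'd (fun u' => g t u' z) v (v' - v)| <= Cu * A * A.
  have := @segment_taylor R X W (fun u' => g t u' z) v (v' - v) _
    (fun s _ => is_derive_u_line v z _ s t0T) ('d (fun u' => g t u' z) v (v' - v)) (Cu * A * A).
  rewrite subrKC; apply=> s /andP[s0 s1].
  have [_ _ du_lip _] := reg (v + s *: (v' - v)) v z z; rewrite (le_trans (du_lip _)) //.
  rewrite subrr normr0 addr0 ler_wpM2r // ler_pM2l // addrC addKr normrZ ger0_norm //.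
  by rewrite ler_piMl.
have -> : g t v' z' - g t v z - ('d (fun u' => g t u' z) v (v' - v) + 'd (g t v) z (z' - z))
  = (g t v' z' - g t v' z - 'd (g t v) z (z' - z))
  + (g t v' z - g t v z - 'd (fun u' => g t u' z) v (v' - v)) by lmod.
apply: le_trans (ler_normD _ _) _; apply: le_trans (lerD taylor_xi taylor_u) _.
have A0 : 0 <= A by exact: normr_ge0.
have B0 : 0 <= B by exact: normr_ge0.
have : 0 <= Cxi * ((A + B) * A) by rewrite !mulr_ge0 ?addr_ge0 // ltW.
have : 0 <= Cu * (2 * (A * B) + B ^+ 2).
  by rewrite mulr_ge0 ?addr_ge0 ?mulr_ge0 ?sqr_ge0 // ltW.
lra.
Qed.

Definition constraint_velocity t u xi du dxi : W :=
  'D_1 (fun s => g s u xi) t + ('d (fun u' => g t u' xi) u du + 'd (g t u) xi dxi).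

Lemma constraint_diff_time_dist u v xi eta s t : 0 <= s <= T -> 0 <= t <= T ->
  `|g t u xi - g t v eta - (g s u xi - g s v eta)|
    <= (`|u - v| + `|xi - eta|)
       * `|primitive (abs_restrict T b) t - primitive (abs_restrict T b) s|.
Proof.
wlog st : s t / s <= t => [le_dist|/andP[s0 _] /andP[_ tT]].
  have [|/ltW ts] := leP s t; first exact: le_dist.
  by move=> sT tT; rewrite distrC [X in _ * X]distrC; exact: le_dist.
rewrite (le_trans (constraint_diff_time_increment _ _ _ _ s0 st tT)) //.
by rewrite ler_wpM2l ?addr_ge0 // ler_norm.
Qed.

Lemma constraint_velocity_le t u xi du dxi : regular_time t ->
  `|constraint_velocity t u xi du dxi| <= a t + (om * `|du| + gam * `|dxi|).
Proof.
move=> /(_ u u xi xi)[[xi_le u_le t_le] _ _ _]; rewrite (le_trans (ler_normD _ _)) // lerD //.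
by rewrite (le_trans (ler_normD _ _)) // lerD.
Qed.

Lemma constraint_velocity_dist_le t u x1 x2 du d1 d2 : regular_time t ->
  `|constraint_velocity t u x1 du d1 - constraint_velocity t u x2 du d2|
    <= (b t + (Cu * `|du| + Cxi * `|d1|)) * `|x1 - x2| + gam * `|d1 - d2|.
Proof.
move=> reg; have [[_ _ _] xi_lip u_lip t_lip] := reg u u x1 x2.
have [[xi_le _ _] _ _ _] := reg u u x2 x2; rewrite subrr normr0 add0r in xi_lip u_lip t_lip.
have -> : constraint_velocity t u x1 du d1 - constraint_velocity t u x2 du d2
  = ('D_1 (fun s => g s u x1) t - 'D_1 (fun s => g s u x2) t)
    + (('d (fun u' => g t u' x1) u du - 'd (fun u' => g t u' x2) u du)
       + ('d (g t u) x1 d1 - 'd (g t u) x2 d1)) + 'd (g t u) x2 (d1 - d2).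
  by rewrite /constraint_velocity linearB /=; lmod.
rewrite (le_trans (ler_normD _ _)) // lerD //.
rewrite (le_trans (ler_normD _ _)) // mulrDl lerD // (le_trans (ler_normD _ _)) //.
by rewrite mulrDl lerD // mulrAC.
Qed.

Lemma constraint_chain t (v z : R -> X) dv dz : 0 < t < T -> regular_time t ->
  derivable (primitive (abs_restrict T b)) t 1 -> is_derive t 1 v dv -> is_derive t 1 z dz ->
  is_derive t 1 (fun s => g s (v s) (z s)) (constraint_velocity t (v t) (z t) dv dz).
Proof.
move=> tT reg Bd vd zd; set Bt := primitive _ in Bd.
have [_ _ _ [_ _ [_ _ Cxi0 Cu0]] _] := hg.
have [[xi_le u_le _] _ _ _] := reg (v t) (v t) (z t) (z t).
pose Du : X -> W := 'd (fun u' => g t u' (z t)) (v t); pose Dxi : X -> W := 'd (g t (v t)) (z t).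
have hd : is_derive t 1 (fun s => g s (v t) (z t) + (Du (v s) + Dxi (z s)))
    (constraint_velocity t (v t) (z t) dv dz).
  apply: is_deriveD; first exact: is_derive_time.
  by apply: is_deriveD;
    [apply: (is_derive1_linear (K := om)) | apply: (is_derive1_linear (K := gam))];
    rewrite // /Du /Dxi; exact: linearP.
have /is_derive1_lipschitz := derivableP Bd; set kb := _ + 1 => Bl.
pose k := (`|dv| + 1) + (`|dz| + 1).
apply: (is_derive1_quadratic (K := k * kb + (Cxi + Cu) * k ^+ 2) hd).
have vl := is_derive1_lipschitz vd; have zl := is_derive1_lipschitz zd.
have /andP[t0 tT'] := tT; near=> s.
have sT : 0 <= s <= T.
  by apply/andP; split; apply: ltW; near: s; [exact: lt_nbhsr | exact: lt_nbhsl].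
have vz : `|v s - v t| + `|z s - z t| <= k * `|s - t|.
  by rewrite mulrDl lerD //; near: s.
have Bs : `|Bt s - Bt t| <= kb * `|s - t| by near: s.
have time_le := constraint_diff_time_dist (v s) (v t) (z s) (z t) (_ : 0 <= t <= T) sT.
have taylor := constraint_taylor (v t) (v s) (z t) (z s) tT reg.
rewrite /= (_ : _ - _ - _
  = (g s (v s) (z s) - g s (v t) (z t) - (g t (v s) (z s) - g t (v t) (z t)))
  + (g t (v s) (z s) - g t (v t) (z t) - (Du (v s - v t) + Dxi (z s - z t)))); last first.
  by rewrite /Du /Dxi !linearB /=; lmod.
rewrite mulrDl (le_trans (ler_normD _ _)) // lerD //.
  apply: le_trans (time_le _) _; first by rewrite !ltW.
  by rewrite [_ ^+ 2]expr2 mulrACA ler_pM ?addr_ge0.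
apply: le_trans taylor _; rewrite -mulrA -exprMn ler_pM2l ?addr_gt0 //.
by rewrite ler_pXn2r ?nnegrE ?addr_ge0 // (le_trans _ vz) ?addr_ge0.
Unshelve. all: by end_near.
Qed.

End moving_constraint.

Section model.
Context {R : realType} {X : completeNormedModType R} {W : normedModType R}.
Local Notation mu := (@lebesgue_measure R).
Variables (ip : X -> X -> R) (G : X -> W -> R) (gx : X -> W -> X) (gw : X -> W -> W -> R).
Variables (lam c L : R) (mu1 : W -> R -> R) (mu2 : R -> R) (K0 K1 C0 C1 : R).
Variables (T : R) (g : R -> X -> X -> W) (a b : R -> R) (gam om Cxi Cu : R).
Variables (u : R -> X) (phiu : R -> R).
Hypothesis hX : hilbert_inner ip.
Hypothesis hH : hypH ip G gx lam c L mu1 mu2.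
Hypothesis hL : hypL G gx gw K0 K1 C0 C1.
Hypothesis T_gt0 : 0 < T.
Hypothesis hg : hypg T g a b gam om Cxi Cu.
Hypothesis hdelta : K1 * gam / c < 1.
Hypothesis hu : W11 T u.
Hypothesis dphiu : density phiu.
Hypothesis u_increment : forall s t, 0 <= s -> s <= t -> t <= T ->
  `|u t - u s| <= primitive phiu t - primitive phiu s.
Implicit Types (s t : R) (x z d xi : X) (w : W).

Let delta := K1 * gam / c.
Let phi t := phiu t + (abs_restrict T a t + abs_restrict T b t).
Let M := primitive phi.
Let constraint t xi := g t (u t) xi.
Let level t xi := G (u t - xi) (constraint t xi).
Let normal t xi := gx (u t - xi) (constraint t xi).
Let drift t xi d := ip (normal t xi) ('D_1 u t)
  + gw (u t - xi) (constraint t xi) (constraint_velocity g t (u t) xi ('D_1 u t) d).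
Let speed t := (1 - delta)^-1 * ((1 + om * K1 / c) * `|'D_1 u t| + K1 / c * a t).

Let Cl := K0 + K1 * (1 + om + gam).
Let Cn := C0 * (2 + om + gam).
Let kap := Cl / ((1 - delta) * c / 2) + (1 - delta)^-1 * (1 + om * K1 / c + K1 / c).
Let Cd := C0 * (1 + gam) + C1 * (1 + gam) * (1 + om + gam * kap) + K1 * (1 + Cu + Cxi * kap).

Let grad_x : is_grad_x ip G gx. Proof. by case: hH. Qed.
Let grad_w : is_grad_w G gw. Proof. by case: hL => [[]]. Qed.
Let lam_gt0 : 0 < lam. Proof. by case: hH => _ []. Qed.
Let c_gt0 : 0 < c. Proof. by case: hH => _ []. Qed.
Let K0_gt0 : 0 < K0. Proof. by case: hL => [[]]. Qed.
Let K1_gt0 : 0 < K1. Proof. by case: hL => [[]]. Qed.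
Let C0_gt0 : 0 < C0. Proof. by case: hL => [[]]. Qed.
Let C1_gt0 : 0 < C1. Proof. by case: hL => [[]]. Qed.
Let gam_gt0 : 0 < gam. Proof. by case: hg => _ _ _ [_ _ []]. Qed.
Let om_gt0 : 0 < om. Proof. by case: hg => _ _ _ [_ _ []]. Qed.
Let Cxi_gt0 : 0 < Cxi. Proof. by case: hg => _ _ _ [_ _ []]. Qed.
Let Cu_gt0 : 0 < Cu. Proof. by case: hg => _ _ _ [_ _ []]. Qed.
Let gx_le x w : `|gx x w| <= K0. Proof. by case: hL => _ []. Qed.
Let gw_le x w k : `|gw x w k| <= K1 * `|k|. Proof. by case: hL => _ []. Qed.
Let gx_lip x w x' w' : `|gx x w - gx x' w'| <= C0 * (`|x - x'| + `|w - w'|).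
Proof. by case: hL => _ []. Qed.
Let gw_lip x w x' w' k : `|gw x w k - gw x' w' k| <= C1 * (`|x - x'| + `|w - w'|) * `|k|.
Proof. by case: hL => _ []. Qed.
Let gx_ge x w : G x w = 1 -> c <= `|gx x w|. Proof. by case: hH => _ _ _ [+ _ _ _ _]; exact. Qed.

Let deltaE : delta * c = K1 * gam. Proof. by rewrite /delta mulfVK // gt_eqF. Qed.
Let delta_ge0 : 0 <= delta. Proof. by rewrite divr_ge0 ?mulr_ge0 // ltW. Qed.
Let om_K1_c_ge0 : 0 <= om * K1 / c. Proof. by rewrite divr_ge0 ?mulr_ge0 // ltW. Qed.
Let K1_c_ge0 : 0 <= K1 / c. Proof. by rewrite divr_ge0 // ltW. Qed.
Let inv_delta_ge0 : 0 <= (1 - delta)^-1. Proof. by rewrite invr_ge0 subr_ge0 ltW. Qed.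
Let Cl_ge0 : 0 <= Cl. Proof. by rewrite addr_ge0 ?mulr_ge0 ?addr_ge0 // ltW. Qed.
Let Cn_ge0 : 0 <= Cn. Proof. by rewrite mulr_ge0 ?addr_ge0 // ltW. Qed.

Let step_rate_le : Cl / ((1 - delta) * c / 2) <= kap.
Proof. by rewrite lerDl mulr_ge0 // !addr_ge0. Qed.

Let speed_rate_le : (1 - delta)^-1 * (1 + om * K1 / c + K1 / c) <= kap.
Proof.
by rewrite lerDr divr_ge0 // divr_ge0 // mulr_ge0 ?subr_ge0 // ltW.
Qed.

Let kap_ge0 : 0 <= kap.
Proof. by apply: le_trans speed_rate_le; rewrite mulr_ge0 // !addr_ge0. Qed.

Let velocity_rate_ge0 : 0 <= 1 + om + gam * kap.
Proof. by rewrite !addr_ge0 ?mulr_ge0 // ltW. Qed.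

Let velocity_dist_rate_ge0 : 0 <= 1 + Cu + Cxi * kap.
Proof. by rewrite !addr_ge0 ?mulr_ge0 // ltW. Qed.

Let Cd_ge0 : 0 <= Cd.
Proof.
have gam1 : 0 <= 1 + gam by rewrite addr_ge0 // ltW.
by rewrite !addr_ge0 ?mulr_ge0 // ltW.
Qed.

Let da : density (abs_restrict T a).
Proof. by case: hg => _ _ _ [La _ _] _; exact: density_abs_restrict. Qed.
Let db : density (abs_restrict T b).
Proof. by case: hg => _ _ _ [_ Lb _] _; exact: density_abs_restrict. Qed.
Let dphi : density phi. Proof. by apply: densityD => //; exact: densityD. Qed.
Let M_le s t : s <= t -> M s <= M t. Proof. exact: primitive_nondecreasing. Qed.

Let a_le_phi t : 0 <= t <= T -> a t <= phi t.
Proof.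
move=> /abs_restrict_ge /le_trans; apply.
by rewrite /phi addrCA lerDl addr_ge0 ?dphiu.2 ?db.2.
Qed.

Let b_le_phi t : 0 <= t <= T -> b t <= phi t.
Proof.
by move=> /abs_restrict_ge /le_trans; apply; rewrite /phi addrA lerDr addr_ge0 ?dphiu.2 ?da.2.
Qed.

Lemma input_increment_le s t : 0 <= s -> s <= t -> t <= T -> `|u t - u s| <= M t - M s.
Proof.
move=> s0 st tT; apply: le_trans (u_increment s0 st tT) _.
apply: primitive_increment_le => //; [exact: dphiu.1 | exact: dphi.1 |].
by move=> r; rewrite /phi lerDl addr_ge0 ?da.2 ?db.2.
Qed.

Lemma constraint_increment_le s t xi xi' : 0 <= s -> s <= t -> t <= T ->
  `|constraint t xi - constraint s xi'| <= (om + 1) * (M t - M s) + gam * `|xi - xi'|.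
Proof.
move=> s0 st tT; have t0T : 0 <= t <= T by rewrite (le_trans s0).
have u_le := constraint_lip_u T_gt0 hg (u s) (u t) xi t0T.
have xi_le := constraint_lip_xi T_gt0 hg (u s) xi' xi t0T.
have t_le := constraint_time_increment hg (u s) xi' s0 st tT.
have a_le : primitive (abs_restrict T a) t - primitive (abs_restrict T a) s <= M t - M s.
  apply: primitive_increment_le => //; [exact: da.1 | exact: dphi.1 |].
  by move=> r; rewrite /phi addrCA lerDl addr_ge0 ?dphiu.2 ?db.2.
have om_le : om * `|u t - u s| <= om * (M t - M s) by rewrite ler_pM2l // input_increment_le.
have -> : constraint t xi - constraint s xi' = (g t (u t) xi - g t (u s) xi)
    + (g t (u s) xi - g t (u s) xi') + (g t (u s) xi' - g s (u s) xi') by rewrite /constraint; lmod.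
apply: le_trans (ler_normD _ _) _; apply: le_trans (lerD (ler_normD _ _) t_le) _.
by apply: le_trans (lerD (lerD u_le xi_le) a_le) _; rewrite mulrDl mul1r; lra.
Qed.

Lemma state_increment_le s t xi xi' : 0 <= s -> s <= t -> t <= T ->
  `|u t - xi - (u s - xi')| <= (M t - M s) + `|xi - xi'|.
Proof.
move=> s0 st tT; have -> : u t - xi - (u s - xi') = (u t - u s) - (xi - xi') by lmod.
by rewrite (le_trans (ler_normB _ _)) // lerD2r input_increment_le.
Qed.

Lemma level_lip s t xi xi' : 0 <= s -> s <= t -> t <= T ->
  `|level t xi - level s xi'| <= Cl * (`|xi - xi'| + (M t - M s)).
Proof.
move=> s0 st tT; set k := constraint t xi; set k' := constraint s xi'.
have x_le := grad_x_lip hX grad_x gx_le (u s - xi') (u t - xi) k.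
have w_le := grad_w_lip grad_w gw_le (u s - xi') k' k.
rewrite /level -/k -/k' -(subrK (G (u s - xi') k) (G (u t - xi) k)) -addrA.
rewrite (le_trans (ler_normD _ _)) //.
have : K0 * `|u t - xi - (u s - xi')| <= K0 * ((M t - M s) + `|xi - xi'|).
  by rewrite ler_pM2l // state_increment_le.
have : K1 * `|k - k'| <= K1 * ((om + 1) * (M t - M s) + gam * `|xi - xi'|).
  by rewrite ler_pM2l // constraint_increment_le.
have : 0 <= K1 * ((1 + om) * `|xi - xi'| + gam * (M t - M s)).
  by rewrite mulr_ge0 ?(ltW K1_gt0) // addr_ge0 // mulr_ge0 ?subr_ge0 ?M_le ?addr_ge0 // ltW.
move: x_le w_le; rewrite /Cl; move: (M t - M s) `|xi - xi'| => dM dxi; lra.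
Qed.

Lemma normal_lip s t xi xi' : 0 <= s -> s <= t -> t <= T ->
  `|normal t xi - normal s xi'| <= Cn * (`|xi - xi'| + (M t - M s)).
Proof.
move=> s0 st tT; rewrite (le_trans (gx_lip _ _ _ _)) // /Cn -mulrA ler_pM2l //.
apply: le_trans (lerD (state_increment_le _ _ s0 st tT) (constraint_increment_le _ _ s0 st tT)) _.
have : 0 <= (1 + om) * `|xi - xi'| + gam * (M t - M s).
  by rewrite addr_ge0 // mulr_ge0 ?subr_ge0 ?M_le ?addr_ge0 // ltW.
by move: (M t - M s) `|xi - xi'| => dM dxi; lra.
Qed.

Lemma normal_ge t xi : 0 <= t <= T -> level t xi = 1 -> c <= `|normal t xi|.
Proof. by move=> _; exact: gx_ge. Qed.

Let sublevel_line w := is_derive_grad_x grad_x w.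
Let sublevel_lip w := grad_x_level_lip gx_lip w.

Lemma level_decrease t xi d : 0 <= t <= T ->
  level t (xi + d) <= level t xi - ip (normal t xi) d + delta * c * `|d| + C0 * `|d| ^+ 2.
Proof.
move=> tT; set k := constraint t xi.
have := @level_taylor R X ip (G^~ k) (gx^~ k) C0 hX C0_gt0 (sublevel_line k) (sublevel_lip k)
  (u t - xi) (- d).
have := grad_w_lip grad_w gw_le (u t - (xi + d)) k (constraint t (xi + d)).
have : K1 * `|constraint t (xi + d) - k| <= K1 * gam * `|d|.
  rewrite -mulrA ler_pM2l // (le_trans (constraint_lip_xi T_gt0 hg _ _ _ tT)) //.
  by rewrite addrAC subrr add0r.
have -> : u t - xi - d = u t - (xi + d) by lmod.
rewrite deltaE /= (ipNr hX) normrN !ler_norml /level /normal -/k.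
by move=> K1_le /andP[_ w_le] /andP[_ x_le]; lra.
Qed.

Definition good_time t := [/\ is_derive t 1 u ('D_1 u t), `|'D_1 u t| <= phi t,
  regular_time g a b gam om Cxi Cu t & derivable (primitive (abs_restrict T b)) t 1].

Lemma ae_good_time : {ae mu, forall t : R, 0 < t < T -> good_time t}.
Proof.
have [_ u_der] := hu.
apply: filterS2 (filterI u_der (primitive_is_derive dphi.1))
  (filterI (ae_regular_time hg) (primitive_is_derive db.1)).
move=> t [ut Mt] [reg [Bt _]] tT; have ud : is_derive t 1 u ('D_1 u t).
  by apply/derivableP/ut; rewrite /= in_itv.
split=> //; last exact: reg.
rewrite -[phi t]mul1r; apply: (lipschitz_wrt_velocity_le dphi ler01 tT _ ud Mt).
by move=> r s r0 rs sT; rewrite mul1r input_increment_le.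
Qed.

Lemma level_along_chain t : 0 < t < T -> good_time t -> level_chain ip level normal drift t.
Proof.
move=> tT [ud _ reg Bd] xi d xid.
have := grad_chain hX grad_x grad_w C0_gt0 C1_gt0 gw_le gx_lip gw_lip
  (is_deriveB ud xid) (constraint_chain hg tT reg Bd ud xid).
by rewrite /= (ipBr hX) addrAC.
Qed.

Lemma drift_le t xi d : good_time t -> drift t xi d
  <= `|normal t xi| * `|'D_1 u t| + K1 * (a t + (om * `|'D_1 u t| + gam * `|d|)).
Proof.
move=> [_ _ reg _]; apply: lerD; first exact: ip_le.
rewrite (le_trans (ler_norm _)) // (le_trans (gw_le _ _ _)) // ler_pM2l //.
exact: constraint_velocity_le.
Qed.

Lemma drift_dist_le t : 0 < t < T -> good_time t -> drift_lip c delta Cd kap phi drift t.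
Proof.
move=> /andP[t0 tT] [_ up reg _] x1 x2 d1 d2 d1k _.
have t0T : 0 <= t <= T by rewrite !ltW.
have p0 : 0 <= phi t by exact: dphi.2.
set e := `|x1 - x2|; set V1 := constraint_velocity g t (u t) x1 ('D_1 u t) d1.
set V2 := constraint_velocity g t (u t) x2 ('D_1 u t) d2.
have arg_le : `|u t - x1 - (u t - x2)| + `|constraint t x1 - constraint t x2| <= (1 + gam) * e.
  have -> : u t - x1 - (u t - x2) = - (x1 - x2) by lmod.
  rewrite normrN mulrDl mul1r lerD2l; exact: (constraint_lip_xi T_gt0 hg).
have V1_le : `|V1| <= (1 + om + gam * kap) * phi t.
  rewrite (le_trans (constraint_velocity_le _ _ _ _ reg)) //.
  have := a_le_phi t0T; have : om * `|'D_1 u t| <= om * phi t by rewrite ler_pM2l.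
  have : gam * `|d1| <= gam * (kap * phi t) by rewrite ler_pM2l.
  lra.
have V12_le : `|V1 - V2| <= (1 + Cu + Cxi * kap) * phi t * e + gam * `|d1 - d2|.
  rewrite (le_trans (constraint_velocity_dist_le _ _ _ _ _ _ reg)) // lerD2r ler_wpM2r //.
  have := b_le_phi t0T; have : Cu * `|'D_1 u t| <= Cu * phi t by rewrite ler_pM2l.
  have : Cxi * `|d1| <= Cxi * (kap * phi t) by rewrite ler_pM2l.
  lra.
have normal_le : `|ip (normal t x1) ('D_1 u t) - ip (normal t x2) ('D_1 u t)|
    <= C0 * ((1 + gam) * e) * phi t.
  rewrite -(ipBl hX) (le_trans (cauchy_schwarz hX _ _)) // ler_pM //.
  by apply: le_trans (gx_lip _ _ _ _) _; rewrite ler_pM2l.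
have gw_dist := gw_dist_le grad_w gw_le gw_lip (u t - x1) (constraint t x1) (u t - x2)
  (constraint t x2) V1 V2.
rewrite (_ : drift t x1 d1 - drift t x2 d2
  = (ip (normal t x1) ('D_1 u t) - ip (normal t x2) ('D_1 u t))
    + (gw (u t - x1) (constraint t x1) V1 - gw (u t - x2) (constraint t x2) V2)); last first.
  by rewrite /drift -/V1 -/V2; ring.
rewrite (le_trans (ler_normD _ _)) // (le_trans (lerD normal_le gw_dist)) // deltaE.
have : K1 * `|V1 - V2| <= K1 * ((1 + Cu + Cxi * kap) * phi t * e + gam * `|d1 - d2|).
  by rewrite ler_pM2l.
set A := `|_| + _ in arg_le *.
have : C1 * A * `|V1| <= C1 * ((1 + gam) * e) * ((1 + om + gam * kap) * phi t).
  by rewrite ler_pM ?mulr_ge0 ?addr_ge0 ?ler_pM2l // ltW.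
rewrite /Cd; lra.
Qed.

Let ae_chain_lip : {ae mu, forall t : R, 0 < t < T ->
  level_chain ip level normal drift t /\ drift_lip c delta Cd kap phi drift t}.
Proof.
apply: filterS ae_good_time => t good tT.
by split; [apply: level_along_chain (good tT) | apply: drift_dist_le (good tT)].
Qed.

Lemma gradient_hypomonotone w x z : G x w = 1 -> G z w = 1 ->
  - lam * `|x - z| ^+ 2 <= ip (gx x w - gx z w) (x - z).
Proof.
move=> Gx Gz; have [_ _ _ [_ _ mono _ _]] := hH; apply: mono; last by rewrite /Zset /= Gz.
apply: (@level_set_bdry R X ip (G^~ w) (gx^~ w) hX (sublevel_line w)) => //.
by rewrite -normr_gt0; apply: lt_le_trans (gx_ge Gx).
Qed.

(* The variational inequality of the sweeping process expresses that the
   velocity is a proximal normal, hence a nonnegative multiple of the gradient. *)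
Lemma velocity_rule_proximal_normal t xi d : level t xi <= 1 ->
  velocity_rule c level normal 0 t xi d
    <-> proximal_normal ip (G^~ (constraint t xi)) (c / lam) (u t - xi) d.
Proof.
move=> level_le; set w := constraint t xi; have r0 : 0 < c / lam by rewrite divr_gt0.
split=> [[free active]|nd].
  move: level_le; rewrite le_eqVlt => /predU1P[xi1|/free -> z _]; last first.
    by rewrite (ip0r hX) normr0 !mul0r addr0.
  have [k [p [k0 pn _ ->]]] := active xi1.
  have {pn}-> : p = normal t xi by apply/eqP; rewrite -subr_eq0 -normr_le0.
  apply: (@gradient_proximal_normal R X ip (G^~ w) (gx^~ w) C0 hX C0_gt0
    (sublevel_line w) (sublevel_lip w) c lam) => //.
  - by move=> x; exact: gx_ge.
  - by move=> x z; exact: gradient_hypomonotone.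
split=> xi1.
  exact: (@proximal_normal_interior R X ip (G^~ w) (gx^~ w) hX (sublevel_line w) _ _ _ r0 xi1 nd).
have gr0 : gx (u t - xi) w != 0 by rewrite -normr_gt0; apply: lt_le_trans (gx_ge xi1).
have [k k0 ->] := @proximal_normal_ray R X ip (G^~ w) (gx^~ w) hX (sublevel_line w)
  _ _ _ r0 xi1 gr0 nd.
by exists k, (normal t xi); rewrite subrr normr0 ler_wpM2l // gx_ge.
Qed.

Lemma speed_le_kap t : 0 < t < T -> good_time t -> speed t <= kap * phi t.
Proof.
move=> /andP[t0 tT] [_ up _ _]; apply: le_trans (ler_wpM2r (dphi.2 t) speed_rate_le).
rewrite /speed -[leRHS]mulrA ler_wpM2l // [leRHS]mulrDl lerD // ler_wpM2l ?addr_ge0 //.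
by apply: a_le_phi; rewrite !ltW.
Qed.

Lemma velocity_rule_speed t (xi : R -> X) d : 0 < t < T -> good_time t ->
  (forall s, 0 <= s <= T -> level s (xi s) <= 1) -> is_derive t 1 xi d ->
  velocity_rule c level normal 0 t (xi t) d -> `|d| <= speed t.
Proof.
move=> tT good xi_le xid [free active]; have /andP[t0 tT'] := tT.
have t0T : 0 <= t <= T by rewrite !ltW.
have [_ _ reg _] := good; have [[_ _ g_le] _ _ _] := reg (u t) (u t) (xi t) (xi t).
have a0 : 0 <= a t by exact: le_trans g_le.
have delta1 : 0 < 1 - delta by rewrite subr_gt0.
set v := `|'D_1 u t|; have v0 : 0 <= v by exact: normr_ge0.
have omv : 0 <= om * K1 / c * v by rewrite mulr_ge0.
have Ka : 0 <= K1 / c * a t by rewrite mulr_ge0.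
have := xi_le t t0T; rewrite le_eqVlt => /predU1P[xi1|/free ->]; last first.
  by rewrite normr0 mulr_ge0 // addr_ge0 // mulr_ge0 // addr_ge0.
rewrite /speed -/v mulrC ler_pdivlMr //.
have [dv|/ltW vd] := leP `|d| v.
  have : delta * `|d| >= 0 by rewrite mulr_ge0.
  lra.
have normal_d : ip (normal t (xi t)) d = `|normal t (xi t)| * `|d|.
  have [k [p [k0 pn _ ->]]] := active xi1.
  have {pn}-> : p = normal t (xi t) by apply/eqP; rewrite -subr_eq0 -normr_le0.
  by rewrite (ipZr hX) (ipxx hX) normrZ ger0_norm //; ring.
have := drift_le (xi t) d good.
rewrite (active_drift tT (level_along_chain tT good) xi_le xi1 xid) normal_d -/v => balance.
have : c * (`|d| - v) <= `|normal t (xi t)| * (`|d| - v).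
  by rewrite ler_wpM2r ?subr_ge0 // gx_ge.
move=> normal_ge_c; have : c * (`|d| - v) <= K1 * (a t + (om * v + gam * `|d|)) by lra.
have -> : K1 * (a t + (om * v + gam * `|d|)) = c * (K1 / c * a t + om * K1 / c * v + delta * `|d|).
  by rewrite /delta; field; rewrite gt_eqF.
by rewrite ler_pM2l //; lra.
Qed.

Lemma sweeping_solution x0 (xi : R -> X) : xi 0 = u 0 - x0 ->
  sweeping c kap phi level normal 0 0 T xi ->
  Omega T u x0 K1 c om delta a xi /\ is_solution ip G g T (c / lam) u x0 xi.
Proof.
move=> xi0 [xi_lip xi_le xi_rule].
have xiW : W11 T xi.
  split; last first.
    by apply: filterS xi_rule => t xit; rewrite /= in_itv => /xit[d []].
  apply: (primitive_abs_cont (densityZ kap_ge0 dphi)) => s t s0 st tT.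
  by rewrite !(primitiveZ _ _ dphi.1) -mulrBr; exact: xi_lip.
split.
  split=> //; apply: filterS2 ae_good_time xi_rule => t good rule; rewrite /= in_itv => tT.
  have [d xid rd] := rule tT; have [_ ->] := xid.
  exact: velocity_rule_speed (good tT) xi_le xid rd.
split; [exact: xiW | | | by rewrite xi0; lmod].
  by move=> t; rewrite /= in_itv; exact: xi_le.
apply: (filterS _ xi_rule) => t rule; rewrite /= in_itv => tT.
have [d xid /velocity_rule_proximal_normal nd] := rule tT; have [_ ->] := xid.
by apply: nd; apply: xi_le; have /andP[t0 tT'] := tT; rewrite !ltW.
Qed.

Lemma solution_sweeping x0 (xi : R -> X) : Omega T u x0 K1 c om delta a xi ->
  is_solution ip G g T (c / lam) u x0 xi -> sweeping c kap phi level normal 0 0 T xi.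
Proof.
move=> [[xi_ac xi_der] _ xi_speed] [_ xi_Z xi_vi _].
have xi_le t : 0 <= t <= T -> level t (xi t) <= 1 by move=> tT; apply: xi_Z; rewrite /= in_itv.
have derivative t : (`]0, T[%classic t -> derivable xi t 1) -> 0 < t < T ->
    is_derive t 1 xi ('D_1 xi t).
  by move=> xit tT; apply/derivableP/xit; rewrite /= in_itv.
split=> // [s t s0 st tT|].
  rewrite mulrBr -!(primitiveZ _ _ dphi.1).
  apply: (null_variation_increment_le st (densityZ kap_ge0 dphi)).
    exact: abs_cont_null_variation s0 st tT xi_ac.
  apply: filterS3 ae_good_time xi_der xi_speed => r good xir speed_r /andP[sr rt].
  have rT : 0 < r < T by rewrite (le_lt_trans s0 sr) (lt_le_trans rt tT).
  exists ('D_1 xi r); first exact: derivative.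
  by apply: le_trans (speed_le_kap rT (good rT)); apply: speed_r; rewrite /= in_itv.
apply: filterS2 xi_der xi_vi => t xit vi tT; exists ('D_1 xi t); first exact: derivative.
apply/velocity_rule_proximal_normal; first by have /andP[t0 tT'] := tT; rewrite xi_le // !ltW.
by move=> z Gz; apply: vi => //; rewrite /= in_itv.
Qed.

Lemma unique_solution x0 : G x0 (g 0 (u 0) (u 0 - x0)) <= 1 ->
  exists xi : R -> X,
    [/\ Omega T u x0 K1 c om delta a xi, is_solution ip G g T (c / lam) u x0 xi &
        forall xi' : R -> X, Omega T u x0 K1 c om delta a xi' ->
          is_solution ip G g T (c / lam) u x0 xi' ->
          forall t, `[0, T]%classic t -> xi' t = xi t].
Proof.
move=> x0_le; have start : level 0 (u 0 - x0) <= 1.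
  by rewrite /level; have -> : u 0 - (u 0 - x0) = x0 by lmod.
have [xi xi0 xi_sw] := sweeping_exists hX T_gt0 c_gt0 hdelta Cl_ge0 Cn_ge0 (ltW C0_gt0) Cd_ge0
  kap_ge0 dphi level_lip normal_lip normal_ge ae_chain_lip step_rate_le level_decrease start.
have [xi_Omega xi_sol] := sweeping_solution xi0 xi_sw.
exists xi; split=> // xi' xi'_Omega xi'_sol t; rewrite /= in_itv => tT.
apply: (sweeping_unique hX T_gt0 c_gt0 hdelta Cl_ge0 Cn_ge0 Cd_ge0 kap_ge0 dphi level_lip
  normal_lip normal_ge ae_chain_lip (solution_sweeping xi'_Omega xi'_sol) xi_sw) => //.
by have [_ -> _] := xi'_Omega.
Qed.

End model.

Theorem theorem4p4 (R : realType)
  (X : completeNormedModType R) (ip : X -> X -> R) (hX : hilbert_inner ip)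
  (W : completeNormedModType R)
  (G : X -> W -> R) (G_ge0 : forall x w, 0 <= G x w) (G_lip : loc_lipschitz2 G)
  (gx : X -> W -> X) (gw : X -> W -> W -> R)
  (lam c L : R) (mu1 : W -> R -> R) (mu2 : R -> R)
  (hH : hypH ip G gx lam c L mu1 mu2)
  (K0 K1 C0 C1 : R) (hL : hypL G gx gw K0 K1 C0 C1)
  (T : R) (T_gt0 : 0 < T)
  (g : R -> X -> X -> W) (a b : R -> R) (gam om Cxi Cu : R)
  (hg : hypg T g a b gam om Cxi Cu)
  (hdelta : K1 * gam / c < 1)
  (u : R -> X) (x0 : X) (hu : W11 T u)
  (hx0 : Zset G (g 0 (u 0) (u 0 - x0)) x0) :
  exists xi : R -> X,
    [/\ Omega T u x0 K1 c om (K1 * gam / c) a xi,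
        is_solution ip G g T (c / lam) u x0 xi &
        forall xi' : R -> X,
          Omega T u x0 K1 c om (K1 * gam / c) a xi' ->
          is_solution ip G g T (c / lam) u x0 xi' ->
          forall t, `[0, T]%classic t -> xi' t = xi t].
Proof.
have [phiu dphiu u_increment] := W11_dominated T_gt0 hu.
exact: (unique_solution hX hH hL T_gt0 hg hdelta hu dphiu u_increment hx0).
Qed.
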